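(* For $\alpha\in\mathbb Z$ (and arbitrary $\beta$), the supercharacters of $\mathrm{Ker}F_{(\alpha;\beta)}$ and $\mathrm{Coker}F_{(\alpha;\beta)}$ are given by $$Sch_{\mathrm{Ker}F_{(\alpha;\beta)}}=Sch_{\mathrm{Ker}F^{(0)}_{(\alpha;\beta)}}=\sum_{l=1}^\infty(-1)^{l+1}Sch_{F^{(-l)}_{(\alpha;\beta)}}=\frac{(-1)^{\beta-\alpha}q^{-\alpha(\alpha+1)}}{\prod_{n=1}^\infty(1-q^{2n})^3}\sum_{i,j\in\mathbb Z}(-1)^j\sum_{l=1}^\infty(-1)^{l+1}q^{l(l-1)+2l(\alpha-j)+(2i^2-2ij+j^2+j)}x^{2i-j}y^{\alpha-i},$$ $$Sch_{\mathrm{Coker}F_{(\alpha;\beta)}}=Sch_{\mathrm{Coker}F^{(0)}_{(\alpha;\beta)}}=\sum_{l=1}^\infty(-1)^{l+1}Sch_{F^{(l)}_{(\alpha;\beta)}}=\frac{(-1)^{\beta-\alpha}q^{-\alpha(\alpha+1)}}{\prod_{n=1}^\infty(1-q^{2n})^3}\sum_{i,j\in\mathbb Z}(-1)^j\sum_{l=1}^\infty(-1)^{l+1}q^{l(l+1)-2l(\alpha-j)+(2i^2-2ij+j^2+j)}x^{2i-j}y^{\alpha-i}.$$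
   Context: Let $[m]=\frac{q^m-q^{-m}}{q-q^{-1}}$. The bosonic $q$-oscillators $a^1_n,a^2_n,b_n,c_n$ ($n\in\mathbb Z$), $Q_{a^1},Q_{a^2},Q_b,Q_c$ have as only nonvanishing commutators (for $m\neq0$) $[a^i_m,a^j_n]=\delta_{ij}\delta_{m+n,0}\frac{[m]^2}{m}$, $[b_m,b_n]=-\delta_{m+n,0}\frac{[m]^2}{m}$, $[c_m,c_n]=\delta_{m+n,0}\frac{[m]^2}{m}$, and $[a^i_0,Q_{a^j}]=\delta_{ij}$, $[b_0,Q_b]=-1$, $[c_0,Q_c]=1$. Put $h^1_m=a^1_mq^{-|m|/2}-a^2_mq^{|m|/2}$ and $h^2_m=a^2_mq^{-|m|/2}+b_mq^{-|m|/2}$ for all $m\in\mathbb Z$. The vacuum $|0\rangle$ is annihilated by all $a^i_m,b_m,c_m$ with $m>0$ and by the zero modes. Put $|\lambda_{a^1},\lambda_{a^2},\lambda_b,\lambda_c\rangle=e^{\lambda_{a^1}Q_{a^1}+\lambda_{a^2}Q_{a^2}+\lambda_bQ_b+\lambda_cQ_c}|0\rangle$, and let $F_{\lambda_{a^1},\lambda_{a^2},\lambda_b,\lambda_c}$ be the bosonic Fock space generated over this vector by $a^1_{-m},a^2_{-m},b_{-m},c_{-m}$ ($m>0$). For $l\in\mathbb Z$, $$F^{(l)}_{(\alpha;\beta)}=\bigoplus_{i,j\in\mathbb Z}F_{\beta+i,\ \beta-i+j,\ \beta-\alpha+j,\ -\alpha+j+l},\qquad F_{(\alpha;\beta)}=F^{(0)}_{(\alpha;\beta)}.$$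 Let $c(z;0)=-\sum_{n\ne0}\frac{c_n}{[n]}z^{-n}+Q_c+c_0\ln z$, $\eta(z)=\sum_n\eta_nz^{-n-1}=:e^{c(z;0)}:$ and $\xi(z)=\sum_n\xi_nz^{-n}=:e^{-c(z;0)}:$, where $:\ :$ is bosonic normal ordering. Then $\eta_0:F^{(l)}_{(\alpha;\beta)}\to F^{(l+1)}_{(\alpha;\beta)}$, $\xi_0:F^{(l)}_{(\alpha;\beta)}\to F^{(l-1)}_{(\alpha;\beta)}$, $\eta_0\xi_0+\xi_0\eta_0=1$, $\eta_0^2=\xi_0^2=0$. Put $\mathrm{Ker}F_{(\alpha;\beta)}=\eta_0\xi_0F_{(\alpha;\beta)}$ and $\mathrm{Coker}F_{(\alpha;\beta)}=\xi_0\eta_0F_{(\alpha;\beta)}=F_{(\alpha;\beta)}/\eta_0\xi_0F_{(\alpha;\beta)}$ (and likewise with $F^{(0)}_{(\alpha;\beta)}=F_{(\alpha;\beta)}$). The level-one bosonization of $U_q(\widehat{sl}(2|1))$ acts on $F_{(\alpha;\beta)}$, and Ker and Coker are submodule and quotient module. The derivation operator is $$d=\sum_{m\ge1}\frac{m^2}{[m]^2}\{h^1_{-m}h^2_m+h^2_{-m}h^1_m+(q^m+q^{-m})h^2_{-m}h^2_m\}-\sum_{m\ge1}\frac{m^2}{[m]^2}c_{-m}c_m+h^1_0h^2_0+h^2_0h^2_0-\tfrac12c_0(c_0+1),$$ which commutes with $\eta_0,\xi_0$. The Fermi-number operator is $(-1)^{N_f}=(-1)^{b_0}$, and the supercharacter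 of $V$ is $Sch_V(q,x,y)=\mathrm{Str}_V(q^{-2d}x^{h^1_0}y^{h^2_0})=\mathrm{tr}_V((-1)^{N_f}q^{-2d}x^{h^1_0}y^{h^2_0})$.
   Formalization: The Fock space is generated by the negative modes of h^1, h^2, c only: with all of a^1, a^2, b, c weight spaces are infinite-dimensional and the supertraces do not exist. For non-integral β, (-1)^{b_0} is read as e^{-iπ b_0} and (-1)^{β-α} as e^{iπ(β-α)}; characters are formal series. *)

(* Defs.v *)
From HB Require Import structures.
From mathcomp Require Import all_boot all_order all_algebra.
From mathcomp Require Import finmap.
From mathcomp Require Import boolp classical_sets cardinality fsbigop reals.
From mathcomp Require Import sequences exp trigo complex.
From mathcomp.multinomials Require Import monalg.

Set Implicit Arguments.
Unset Strict Implicit.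
Unset Printing Implicit Defensive.
Import Order.TTheory GRing.Theory Num.Theory.
Local Open Scope classical_set_scope.
Local Open Scope ring_scope.

Definition cexp (R : realType) (z : R[i]) : R[i] :=
  let: Complex x y := z in Complex (expR x * cos y) (expR x * sin y).

Definition ipi (R : realType) : R[i] := Complex 0 pi.

(* (-1)^z = e^(i pi z). *)
Definition m1pow (R : realType) (z : R[i]) : R[i] := cexp (ipi R * z).

Definition occupation : choiceType := {fsfun 'I_4 * nat -> nat with 0%N}.

HB.lock Definition set_occ (k : occupation) (x : 'I_4 * nat) (n : nat) :
    occupation := [fsfun k with x |-> n].

(* The oscillators a^1, a^2, b, c are indexed by 'I_4 in this order.  A state
   (lambda, k) stands for the monomial
     prod_(i, m) (x^i_(-(m+1)))^(k (i, m))  |lambda>,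
   where x^i is the i-th oscillator: m = 0 is the mode of index -1. *)
Definition state (R : realType) : Type :=
  ({ffun 'I_4 -> R[i]} * occupation)%type.
HB.instance Definition _ (R : realType) := Choice.on (state R).

Definition boson (R : realType) : Type := {malg R[i][state R]}.
HB.instance Definition _ (R : realType) := GRing.Lmodule.on (boson R).

Definition ia1 : 'I_4 := inord 0.
Definition ia2 : 'I_4 := inord 1.
Definition ib : 'I_4 := inord 2.
Definition ic : 'I_4 := inord 3.

Definition posnat : set nat := [set m | (0 < m)%N].

HB.lock Definition basis_vec (R : realType) (s : state R) : boson R := << s >>.

HB.lock Definition linext (R : realType) (F : state R -> boson R) (v : boson R) :
    boson R :=
  \sum_(s <- msupp v) v@_s *: F s.

Section Oscillators.
Variable R : realType.
Local Notation C := R[i].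
Local Notation V := (boson R).

(* [q] is the deformation parameter and [sq] a square root of it. *)
Variables (q sq : C).

Definition lam4 (x1 x2 x3 x4 : C) : {ffun 'I_4 -> C} :=
  [ffun i : 'I_4 => nth 0 [:: x1; x2; x3; x4] i].

Definition qnum (m : int) : C := (q ^ m - q ^ (- m)) / (q - q^-1).

Definition eps (i : 'I_4) : C := if i == ib then -1 else 1.

(* Realizes [x^i_m, x^j_n] = eps_i delta_ij delta_(m+n,0) [m]^2 / m and
   [x^i_0, Q_j] = eps_i delta_ij, see [osc_comm] and [osc0_expQ] below. *)
Definition osc (i : 'I_4) (n : int) : V -> V := linext (fun s =>
  match n with
  | Posz 0 => (eps i * s.1 i) *: basis_vec s
  | Posz m.+1 =>
      (eps i * (qnum m.+1 ^+ 2 / m.+1%:R) * (s.2 (i, m))%:R) *: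
        basis_vec (s.1, set_occ s.2 (i, m) (s.2 (i, m)).-1)
  | Negz m => basis_vec (s.1, set_occ s.2 (i, m) (s.2 (i, m)).+1)
  end).

(* exp (mu_1 Q_(a^1) + mu_2 Q_(a^2) + mu_3 Q_b + mu_4 Q_c) *)
Definition expQ (mu : {ffun 'I_4 -> C}) : V -> V :=
  linext (fun s => basis_vec (s.1 + mu, s.2)).

Definition vacuum : V := basis_vec (0, [fsfun of _ => 0%N]).
Definition ket (lambda : {ffun 'I_4 -> C}) : V := expQ lambda vacuum.

Definition h1 (m : int) (v : V) : V :=
  sq ^- `|m|%N *: osc ia1 m v - sq ^+ `|m|%N *: osc ia2 m v.
Definition h2 (m : int) (v : V) : V :=
  sq ^- `|m|%N *: osc ia2 m v + sq ^- `|m|%N *: osc ib m v.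
Definition c_ (m : int) : V -> V := osc ic m.

Definition tdec (m : int) (v : V) : V :=
  q ^+ `|m|%N *: osc ia1 m v + osc ia2 m v + osc ib m v.

Lemma linextEw (F : state R -> V) (D : {fset state R}) (v : V) :
  (msupp v `<=` D)%fset -> linext F v = \sum_(s <- D) v@_s *: F s.
Proof.
move=> vD; rewrite linext.unlock (big_fset_incl _ vD) //= => s _ sv.
by rewrite mcoeff_outdom // scale0r.
Qed.

Lemma linext_is_linear (F : state R -> V) : linear (linext F).
Proof.
move=> a u v; pose D := (msupp u `|` msupp v)%fset.
have uD : (msupp u `<=` D)%fset by exact: fsubsetUl.
have vD : (msupp v `<=` D)%fset by exact: fsubsetUr.
have wD : (msupp (a *: u + v : V) `<=` D)%fset.
  by apply: (fsubset_trans (msuppD_le _ _)); apply: fsetSU; exact: msuppZ_le.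
rewrite (linextEw _ uD) (linextEw _ vD) (linextEw _ wD) scaler_sumr -big_split.
by apply: eq_bigr => s _; rewrite mcoeffD mcoeffZ scalerDl scalerA.
Qed.

HB.instance Definition _ (F : state R -> V) :=
  GRing.isLinear.Build C V V *:%R (linext F) (linext_is_linear F).

Lemma linext_basis (F : state R -> V) s : linext F (basis_vec s) = F s.
Proof.
by rewrite linext.unlock basis_vec.unlock msuppU oner_eq0 big_seq_fset1 mcoeffUU scale1r.
Qed.

Lemma boson_basis (v : V) : v = linext (@basis_vec R) v.
Proof.
apply/malgP => k; rewrite {1}[v]monalgE linext.unlock !raddf_sum.
by apply: eq_bigr => s _; rewrite basis_vec.unlock /= mcoeffZ [in LHS]mcoeffU [in RHS]mcoeffU mulr_natr.
Qed.

Lemma linear_ext (f g : {linear V -> V}) :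
  (forall s, f (basis_vec s) = g (basis_vec s)) -> f =1 g.
Proof.
move=> fg v; rewrite [v]boson_basis linext.unlock !linear_sum.
by apply: eq_bigr => s _; rewrite !linearZ /= fg.
Qed.

HB.instance Definition _ (i : 'I_4) (n : int) :=
  GRing.Linear.copy (osc i n) (linext _).

HB.instance Definition _ mu := GRing.Linear.copy (expQ mu) (linext _).

Lemma osc_basis i n s : osc i n (basis_vec s) =
  match n with
  | Posz 0 => (eps i * s.1 i) *: basis_vec s
  | Posz m.+1 =>
      (eps i * (qnum m.+1 ^+ 2 / m.+1%:R) * (s.2 (i, m))%:R) *:
        basis_vec (s.1, set_occ s.2 (i, m) (s.2 (i, m)).-1)
  | Negz m => basis_vec (s.1, set_occ s.2 (i, m) (s.2 (i, m)).+1)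
  end.
Proof. by rewrite /osc linext_basis. Qed.

Lemma set_occE (k : occupation) x n y : set_occ k x n y = if y == x then n else k y.
Proof. by rewrite set_occ.unlock fsfun_withE. Qed.

Lemma set_occC (k : occupation) x y a b : x != y ->
  set_occ (set_occ k x a) y b = set_occ (set_occ k y b) x a.
Proof.
move=> xy; apply/fsfunP => z; rewrite !set_occE.
by case: (eqVneq z x) => [->|_]; rewrite ?(negPf xy).
Qed.

Lemma set_occK (k : occupation) x a b : b = k x -> set_occ (set_occ k x a) x b = k.
Proof.
by move=> ->; apply/fsfunP => z; rewrite !set_occE; case: eqVneq => [->|].
Qed.

Lemma oscP i n : linear (osc i n).
Proof. exact: linearP. Qed.

Lemma oscZ i n (a : C) v : osc i n (a *: v) = a *: osc i n v.
Proof. exact: linearZ. Qed.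

Lemma boson_ext (f g : V -> V) : linear f -> linear g ->
  (forall s, f (basis_vec s) = g (basis_vec s)) -> f =1 g.
Proof.
move=> lf lg.
pose f' : {linear V -> V} := HB.pack f (GRing.isLinear.Build C V V *:%R f lf).
pose g' : {linear V -> V} := HB.pack g (GRing.isLinear.Build C V V *:%R g lg).
exact: (@linear_ext f' g').
Qed.

Lemma qnumN m : qnum (- m) = - qnum m.
Proof. by rewrite /qnum opprK -mulNr opprB. Qed.

Lemma osc_pm (i j : 'I_4) (m n : nat) l k :
  osc i m.+1%:Z (osc j (Negz n) (basis_vec (l, k))) =
  osc j (Negz n) (osc i m.+1%:Z (basis_vec (l, k))) +
  (if (i, m) == (j, n) then eps i * (qnum m.+1 ^+ 2 / m.+1%:R) else 0) *:
    basis_vec (l, k).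
Proof.
rewrite [osc j _ _]osc_basis [in LHS]osc_basis [osc i _ _]osc_basis oscZ.
rewrite osc_basis /=.
have [[<- <-]|mn] := eqVneq (i, m) (j, n).
  rewrite set_occE eqxx set_occK // set_occE eqxx /=.
  case E: (k (i, m)) => [|e] /=.
    by rewrite mulr1 mulr0 scale0r add0r.
  rewrite (set_occK _ (esym E)).
  rewrite -[e.+2]addn1 natrD mulrDr mulr1.
  by rewrite scalerDl.
rewrite scale0r addr0 set_occE (negPf mn) set_occE eq_sym (negPf mn).
by rewrite set_occC // eq_sym.
Qed.

Lemma occC (k : occupation) x y (f : nat -> nat) :
  set_occ (set_occ k y (f (k y))) x (f (set_occ k y (f (k y)) x)) =
  set_occ (set_occ k x (f (k x))) y (f (set_occ k x (f (k x)) y)).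
Proof.
have [->//|xy] := eqVneq x y.
rewrite [in LHS](set_occE _ y) (negPf xy).
rewrite [in RHS](set_occE _ x) [y == x]eq_sym (negPf xy).
by rewrite set_occC // eq_sym.
Qed.

Lemma occ_coefC (k : occupation) x y (f : nat -> nat) (a : 'I_4 * nat -> C) :
  a y * (k y)%:R * (a x * (set_occ k y (f (k y)) x)%:R) =
  a x * (k x)%:R * (a y * (set_occ k x (f (k x)) y)%:R).
Proof.
have [->//|xy] := eqVneq x y.
by rewrite !set_occE [y == x]eq_sym (negPf xy) mulrC.
Qed.

Lemma osc_comm_basis (i j : 'I_4) (m n : int) (s : state R) :
  osc i m (osc j n (basis_vec s)) = osc j n (osc i m (basis_vec s)) +
  (if [&& i == j, m + n == 0 & m != 0] then eps i * (qnum m ^+ 2 / m%:~R)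
   else 0) *: basis_vec s.
Proof.
case: s => l k.
case: m => [[|m]|m]; case: n => [[|n]|n].
- rewrite !andbF scale0r addr0.
  rewrite osc_basis [X in X = _]oscZ osc_basis.
  by rewrite [RHS]oscZ osc_basis !scalerA /= [X in X *: _]mulrC.
- rewrite !andbF scale0r addr0.
  rewrite osc_basis [X in X = _]oscZ osc_basis [X in _ = osc j _ X]osc_basis.
  by rewrite [RHS]oscZ osc_basis !scalerA /= [X in X *: _]mulrC.
- rewrite !andbF scale0r addr0.
  rewrite osc_basis [X in X = _]osc_basis [X in _ = osc j _ X]osc_basis.
  by rewrite [RHS]oscZ osc_basis /=.
- rewrite addr0 andbF scale0r addr0.
  rewrite osc_basis [X in X = _]oscZ osc_basis.
  by rewrite [RHS]oscZ osc_basis !scalerA /= [X in X *: _]mulrC.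
- rewrite andbF scale0r addr0.
  rewrite osc_basis [X in X = _]oscZ osc_basis [X in _ = osc j _ X]osc_basis.
  rewrite [RHS]oscZ osc_basis !scalerA /=.
  pose a (x : 'I_4 * nat) : C := eps x.1 * (qnum x.2.+1 ^+ 2 / x.2.+1%:R).
  rewrite (occC k (i, m) (j, n) predn).
  by rewrite (occ_coefC k (i, m) (j, n) predn a).
- rewrite osc_pm NegzE subr_eq0 andbT xpair_eqE.
  by rewrite (_ : (m.+1%:Z == n.+1%:Z) = (m == n)).
- rewrite addr0 andbF scale0r addr0.
  rewrite osc_basis [LHS]oscZ osc_basis.
  by rewrite [RHS]osc_basis /=.
- rewrite osc_pm -addrA -scalerDl NegzE [_ + n.+1%:Z]addrC subr_eq0 oppr_eq0 andbT.
  rewrite xpair_eqE.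
  rewrite [n.+1%:Z == _](_ : _ = (n == m)) // [j == i]eq_sym.
  have [->|] := eqVneq i j; last by rewrite addr0 scale0r addr0.
  have [->|] := eqVneq n m; last by rewrite addr0 scale0r addr0.
  rewrite /= qnumN sqrrN mulrNz invrN mulrN mulrN subrr scale0r addr0.
  by [].
- rewrite andbF scale0r addr0.
  rewrite osc_basis [X in X = _]osc_basis osc_basis [RHS]osc_basis /=.
  by rewrite (occC k (i, m) (j, n) S).
Qed.

Lemma lin_aux (M : lmodType C) (a b : C) (x y u w : M) :
  b *: x + y + a *: (b *: u + w) = b *: (x + a *: u) + (y + a *: w).
Proof.
by rewrite !scalerDr !scalerA [a * b]mulrC addrACA.
Qed.

Lemma osc_comm (i j : 'I_4) (m n : int) (v : V) :
  osc i m (osc j n v) = osc j n (osc i m v) +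
  (if [&& i == j, m + n == 0 & m != 0] then eps i * (qnum m ^+ 2 / m%:~R)
   else 0) *: v.
Proof.
set a := (X in X *: _).
apply: (@boson_ext (fun w => osc i m (osc j n w))
          (fun w => osc j n (osc i m w) + a *: w)) => [b u w|b u w|s].
- by rewrite (oscP j n b u w) (oscP i m b).
- rewrite (oscP i m b u w) (oscP j n b); exact: lin_aux.
- exact: osc_comm_basis.
Qed.

Lemma osc0_expQ (i : 'I_4) (mu : {ffun 'I_4 -> C}) (v : V) :
  osc i 0 (expQ mu v) = expQ mu (osc i 0 v) + (eps i * mu i) *: expQ mu v.
Proof.
have expP : linear (expQ mu) by exact: linearP.
apply: (@boson_ext (fun w => osc i 0 (expQ mu w))
          (fun w => expQ mu (osc i 0 w) + (eps i * mu i) *: expQ mu w))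
  => [b u w|b u w|s].
- by rewrite (expP b u w) (oscP i 0 b).
- rewrite (oscP i 0 b u w) !(expP b); exact: lin_aux.
- rewrite [osc i 0 (basis_vec s)]osc_basis.
  have expZ c w : expQ mu (c *: w) = c *: expQ mu w by exact: linearZ.
  rewrite expZ /expQ linext_basis osc_basis -scalerDl ffunE mulrDr.
  by [].
Qed.

Lemma osc_vacuum (i : 'I_4) (n : nat) : osc i n (vacuum) = 0.
Proof.
rewrite /vacuum osc_basis; case: n => [|n] /=.
  by rewrite ffunE mulr0 scale0r.
by rewrite fsfunE mulr0 scale0r.
Qed.

Lemma tdec_aux1 (M : lmodType C) (A B Q k : C) (a1 a2 a3 b1 b2 b3 v : M) :
  A * (Q * k) = B * k ->
  A *: (Q *: (a1 + k *: v) + a2 + a3) - B *: (Q *: b1 + (b2 + k *: v) + b3) =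
  Q *: (A *: a1 - B *: b1) + (A *: a2 - B *: b2) + (A *: a3 - B *: b3).
Proof.
move=> AB.
have -> : Q *: (a1 + k *: v) + a2 + a3 =
          (Q *: a1 + a2 + a3) + (Q * k) *: v.
  by rewrite scalerDr scalerA (ACl (1*3*4*2)).
have -> : Q *: b1 + (b2 + k *: v) + b3 = k *: v + (Q *: b1 + b2 + b3).
  by rewrite addrA (ACl (3*(1*2*4))).
rewrite [A *: (_ + _ *: v)]scalerDr [B *: (_ *: v + _)]scalerDr.
rewrite !(scalerA _ _ v) AB opprD addrA addrK.
rewrite !scalerDr !scalerN !scalerA [Q * A]mulrC [Q * B]mulrC !opprD !addrA.
by rewrite (ACl (1*4*2*5*3*6)).
Qed.

Lemma tdec_aux2 (M : lmodType C) (A Q k : C) (a1 a2 a3 b1 b2 b3 v : M) :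
  A *: (Q *: a1 + (a2 + k *: v) + a3) + A *: (Q *: b1 + b2 + (b3 + (- k) *: v)) =
  Q *: (A *: a1 + A *: b1) + (A *: a2 + A *: b2) + (A *: a3 + A *: b3).
Proof.
rewrite -!(scalerDr A) scalerA [Q * A]mulrC -scalerA -!scalerDr; congr (_ *: _).
rewrite scaleNr scalerDr !addrA.
rewrite [LHS](ACl (((1*5*2*6*4*7)*3)*8)) /=.
by rewrite addrK.
Qed.

Lemma ind_neq : [/\ ia1 != ia2, ia1 != ib & ia2 != ib].
Proof. by split; apply/eqP => /(congr1 val); rewrite /= !inordK. Qed.

Section TdecComm.
Variables (M : lmodType C) (O : 'I_4 -> int -> M -> M) (e : int -> C).
Hypothesis OP : forall i n, linear (O i n).
Hypothesis O_comm : forall i j m n v,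
  O i m (O j n v) = O j n (O i m v) +
  (if [&& i == j, m + n == 0 & m != 0] then eps i * e m else 0) *: v.

Let OD i n u v : O i n (u + v) = O i n u + O i n v.
Proof. by have := OP i n 1 u v; rewrite !scale1r. Qed.

Let O0 i n : O i n 0 = 0.
Proof. by have := OP i n (-1) 0 0; rewrite !scaler0 !addr0 scaleN1r addNr. Qed.

Let OZ i n a v : O i n (a *: v) = a *: O i n v.
Proof. by have := OP i n a v 0; rewrite O0 !addr0. Qed.

Let OB i n u v : O i n (u - v) = O i n u - O i n v.
Proof. by rewrite OD -scaleN1r OZ scaleN1r. Qed.

Let O_commN i j m n v : i != j -> O i m (O j n v) = O j n (O i m v).
Proof. by move=> ij; rewrite O_comm (negPf ij) scale0r addr0. Qed.

Let O_comm_eq i m n v : O i m (O i n v) = O i n (O i m v) +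
  (if (m + n == 0) && (m != 0) then eps i * e m else 0) *: v.
Proof. by rewrite O_comm eqxx. Qed.

Lemma h1_tdec_abs (A B Q : C) m n v :
  (m + n == 0 -> A * Q = B) ->
  A *: O ia1 m (Q *: O ia1 n v + O ia2 n v + O ib n v) -
  B *: O ia2 m (Q *: O ia1 n v + O ia2 n v + O ib n v) =
  Q *: O ia1 n (A *: O ia1 m v - B *: O ia2 m v) +
  O ia2 n (A *: O ia1 m v - B *: O ia2 m v) +
  O ib n (A *: O ia1 m v - B *: O ia2 m v).
Proof.
move=> AB; have [n12 n13 n23] := ind_neq.
have n21 : ia2 != ia1 by rewrite eq_sym.
rewrite !OB !OD !OZ (O_comm_eq ia1 m n v) (O_comm_eq ia2 m n v).
rewrite (O_commN m n v n12) (O_commN m n v n13).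
rewrite (O_commN m n v n21) (O_commN m n v n23).
rewrite /eps (negPf n13) (negPf n23).
apply: tdec_aux1; case: ifP => [/andP[/AB <- _]|_]; last by rewrite !mulr0.
by rewrite mulrA.
Qed.

Lemma h2_tdec_abs (A Q : C) m n v :
  A *: O ia2 m (Q *: O ia1 n v + O ia2 n v + O ib n v) +
  A *: O ib m (Q *: O ia1 n v + O ia2 n v + O ib n v) =
  Q *: O ia1 n (A *: O ia2 m v + A *: O ib m v) +
  O ia2 n (A *: O ia2 m v + A *: O ib m v) +
  O ib n (A *: O ia2 m v + A *: O ib m v).
Proof.
have [n12 n13 n23] := ind_neq.
have n21 : ia2 != ia1 by rewrite eq_sym.
have n31 : ib != ia1 by rewrite eq_sym.
have n32 : ib != ia2 by rewrite eq_sym.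
rewrite !OD !OZ (O_comm_eq ia2 m n v) (O_comm_eq ib m n v).
rewrite (O_commN m n v n21) (O_commN m n v n23).
rewrite (O_commN m n v n31) (O_commN m n v n32).
rewrite /eps (negPf n23) eqxx mul1r mulN1r -[X in if _ then - _ else X]oppr0.
by rewrite -(fun_if (@GRing.opp C)) tdec_aux2.
Qed.

End TdecComm.

Lemma h1_tdec_comm (m n : int) (v : V) : sq ^+ 2 = q -> sq != 0 ->
  h1 m (tdec n v) = tdec n (h1 m v).
Proof.
move=> sqE sq0; apply: (h1_tdec_abs oscP osc_comm) => /eqP mn.
have -> : `|m|%N = `|n|%N by rewrite -(addr0_eq mn) abszN.
by rewrite -sqE -exprM mulnC muln2 -addnn exprD mulKf // expf_neq0.
Qed.

Lemma h2_tdec_comm (m n : int) (v : V) :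
  h2 m (tdec n v) = tdec n (h2 m v).
Proof. exact: (h2_tdec_abs oscP osc_comm). Qed.

Definition d_op (v : V) : V :=
  \sum_(m \in posnat) ((m%:R ^+ 2 / qnum m ^+ 2) *:
     (h1 (- m%:Z) (h2 m v) + h2 (- m%:Z) (h1 m v)
      + (q ^+ m + q ^- m) *: h2 (- m%:Z) (h2 m v)))
  - \sum_(m \in posnat) ((m%:R ^+ 2 / qnum m ^+ 2) *: c_ (- m%:Z) (c_ m v))
  + h1 0 (h2 0 v) + h2 0 (h2 0 v)
  - 2^-1 *: c_ 0 (c_ 0 v + v).

(* (-1)^(b_0).  The determination e^(-i pi) of -1 is used here, while [m1pow]
   uses e^(i pi): b_0 is minus the coefficient of Q_b, so that this operator is
   m1pow lambda_b on |lambda>.  The choice is immaterial if b_0 is integral. *)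
Definition fermi : V -> V :=
  linext (fun s => cexp (- ipi R * (eps ib * s.1 ib)) *: basis_vec s).

(* Coefficient of z^k in exp (sum_(m >= 1) t_m z^m) for commuting t_m. *)
Definition expcoef (t : nat -> V -> V) (k : nat) (v : V) : V :=
  \sum_(r < k.+1) (r`!%:R)^-1 *:
    \sum_(u : r.-tuple 'I_k.+1 |
          all (leq 1) (map val u) && (sumn (map val u) == k))
      foldr (fun m w => t m w) v (map val u).

(* Projection onto the eigenspace of c_0 for the eigenvalue mu. *)
Definition c0proj (mu : int) : V -> V :=
  linext (fun s => if s.1 ic == mu%:~R then basis_vec s else 0).

(* Coefficient of z^e in
     :e^(s c(z;0)): = e^(s Q_c) z^(s c_0) exp(s sum_(m>0) c_(-m) z^m / [m])
                                          exp(-s sum_(m>0) c_m z^(-m) / [m])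
   for a sign s: the term of degree k in the first exponential and of degree
   -j in the second contributes through the eigenvalue mu of c_0 with
   s mu + k - j = e.  On a given vector only finitely many terms survive. *)
Definition vertex_coef (s e : int) (v : V) : V :=
  \sum_(kj \in [set: nat * nat])
    expQ (lam4 0 0 0 s%:~R)
      (expcoef (fun m w => (s%:~R / qnum m) *: c_ (- m%:Z) w) kj.1
        (expcoef (fun m w => (- s%:~R / qnum m) *: c_ m w) kj.2
          (c0proj (s * (e - kj.1%:Z + kj.2%:Z)) v))).

Definition eta_ (n : int) : V -> V := vertex_coef 1 (- n - 1).
Definition xi_ (n : int) : V -> V := vertex_coef (-1) (- n).

Definition subspace (S : set V) : Prop :=
  S 0 /\ forall (a : C) u v, S u -> S v -> S (a *: u + v).

(* The Fock space over |lambda> of the oscillators h^1, h^2, c through which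
   the algebra acts.  The combination [tdec m] = q^m a^1_m + a^2_m + b_m of the
   four oscillators commutes with every h^1_n, h^2_n, c_n (see [h1_tdec_comm],
   [h2_tdec_comm]), hence with d, eta_0, xi_0; over the space generated by all
   of a^1, a^2, b, c every joint eigenspace of d, h^1_0, h^2_0 would therefore
   be zero or infinite-dimensional and the traces would not exist. *)
Definition Fock (lambda : {ffun 'I_4 -> C}) : set V :=
  smallest
    [set S | subspace S /\
       forall (m : nat) v, (0 < m)%N -> S v ->
         [/\ S (h1 (- m%:Z) v), S (h2 (- m%:Z) v) & S (c_ (- m%:Z) v)]]
    [set ket lambda].

Definition Fl (alpha : int) (beta : C) (l : int) : set V :=
  smallest subspace
    (\bigcup_(ij in [set: int * int])
       Fock (lam4 (beta + ij.1%:~R)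
                  (beta - ij.1%:~R + ij.2%:~R)
                  (beta - alpha%:~R + ij.2%:~R)
                  (- alpha%:~R + ij.2%:~R + l%:~R))).

Definition Fab (alpha : int) (beta : C) : set V := Fl alpha beta 0.

Definition Ker (S : set V) : set V := (fun v => eta_ 0 (xi_ 0 v)) @` S.
Definition Coker (S : set V) : set V := (fun v => xi_ 0 (eta_ 0 v)) @` S.

Definition is_basis (S : set V) (n : nat) (e : 'I_n -> V) : Prop :=
  [/\ forall i, S (e i),
      forall v, S v -> exists x : 'I_n -> C, v = \sum_(i < n) x i *: e i
    & forall x : 'I_n -> C, \sum_(i < n) x i *: e i = 0 -> forall i, x i = 0].

(* S has finite dimension, is stable under f, and f has trace t on S. *)
Definition is_trace (S : set V) (f : V -> V) (t : C) : Prop :=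
  exists n (e : 'I_n -> V) (M : 'M[C]_n),
    [/\ is_basis S e, forall i, f (e i) = \sum_(j < n) M i j *: e j
      & t = \tr M].

Definition weight_space (S : set V) (n a b : int) : set V :=
  [set v | [/\ S v, (-2) *: d_op v = n%:~R *: v,
               h1 0 v = a%:~R *: v & h2 0 v = b%:~R *: v]].

(* Formal series sum_(n, a, b) S n a b q^n x^a y^b. *)
Definition fseries := int -> int -> int -> C.

(* Str_S(q^(-2d) x^(h^1_0) y^(h^2_0)) as a formal series; it is meaningful
   under [has_Sch S]. *)
Definition Sch (S : set V) : fseries := fun n a b =>
  xget 0 [set t | is_trace (weight_space S n a b) fermi t].

Definition has_Sch (S : set V) : Prop :=
  S `<=` smallest subspace
           (\bigcup_(w in [set: int * int * int])
              weight_space S w.1.1 w.1.2 w.2) /\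
  forall n a b, exists t, is_trace (weight_space S n a b) fermi t.

End Oscillators.

Section Series.
Variable R : realType.
Local Notation C := R[i].
Local Notation fseries := (fseries R).

(* q^n x^a y^b *)
Definition smono (n a b : int) : fseries := fun n' a' b' =>
  [&& n' == n, a' == a & b' == b]%:R.

Definition sscale (c : C) (S : fseries) : fseries := fun n a b => c * S n a b.

(* q^e S *)
Definition qshift (e : int) (S : fseries) : fseries := fun n a b => S (n - e) a b.

(* Sums of families of series are taken coefficientwise; [fsum] is meaningful
   for families satisfying [summable]. *)
Definition summable (T : choiceType) (D : set T) (S : T -> fseries) : Prop :=
  forall n a b, finite_set [set t | D t /\ S t n a b != 0].

Definition fsum (T : choiceType) (D : set T) (S : T -> fseries) : fseries :=
  fun n a b => \sum_(t \in D) S t n a b.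

(* Coefficient of q^k in 1 / P for P = prod_(n >= 1) (1 - q^(2n))^3: truncation
   of P modulo q^(k+1), inverted by 1 / P = sum_r (1 - P)^r. *)
Definition inv_prod3 (k : nat) : C :=
  let P : {poly C} := \prod_(1 <= n < k.+1) (1 - 'X^(2 * n)) ^+ 3 in
  (\sum_(r < k.+1) (1 - P) ^+ r)`_k.

Definition inv_prod3_terms (S : fseries) (k : nat) : fseries :=
  sscale (inv_prod3 k) (qshift k%:Z S).

(* S / prod_(n >= 1) (1 - q^(2n))^3 *)
Definition div_prod3 (S : fseries) : fseries := fsum [set: nat] (inv_prod3_terms S).

End Series.

(* Main.v *)
Require Import Defs.
From HB Require Import structures.
From mathcomp Require Import all_boot all_order all_algebra.
From mathcomp Require Import finmap.
From mathcomp Require Import boolp classical_sets cardinality fsbigop reals.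
From mathcomp Require Import sequences exp trigo complex.
From mathcomp.multinomials Require Import monalg.
From mathcomp Require Import zify ring.
Set Implicit Arguments.
Unset Strict Implicit.
Unset Printing Implicit Defensive.
Import Order.TTheory GRing.Theory Num.Theory.
Local Open Scope classical_set_scope.
Local Open Scope ring_scope.

(* Since eta_0 xi_0 + xi_0 eta_0 = 1 and eta_0 eta_0 = 0, the spaces F^(l) form an
   exact complex, which d, h^1_0 and h^2_0 split into finite-dimensional weight
   spaces.  There (-1)^(N_f) is a scalar, so that supercharacters count
   dimensions: writing k_l for the dimension of the part of
   eta_0 xi_0 F^(l) in a given weight,
     exactness gives dim F^(l) = k_l + k_(l+1),
   hence the two alternating sums.  The dimension of a weight space of F^(l) is
   a number of three-coloured partitions: the Fock space generated by h^1, h^2,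
     c
   is the common kernel of q^m a^1_m + a^2_m + b_m (m > 0) on the vectors of
     given
   zero modes, and projecting out the states with an occupied a^2-mode is
   injective on it. *)

(** The relations between eta_0 and xi_0 are derived for modes of vertex operators, without formal
    delta functions. A commutator with c_n carries the defect [anticomm] of an expected relation
    into a combination of defects with shifted indices. This reduces the relation to vectors without
    c-excitations, then to results of c-degree zero, and finally to the coefficients of (1 - w)^(s
    s'), the scalar produced by moving an annihilation exponential past a creation one. The sums
    over l are finite in every weight: there the energy of F^(l) is a quadratic polynomial in l with
    leading coefficient 1, so that F^(l) lacks the weight for large |l|, and solving the recursion
    for k_l towards either end leaves no remainder. A weight together with l determines all zero
    modes. What is left of the weight is an oscillator degree, and comparing polynomials modulo
    powers of X matches the number of states of that degree with the truncated inverse of the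
    product. *)

Section LinearMaps.
Variables (C : comPzRingType) (M N : lmodType C).
Implicit Types f g : M -> N.

Lemma lin0 f : linear f -> f 0 = 0.
Proof. by move=> lf; have := lf (-1) 0 0;
  rewrite scaler0 addr0 scaleN1r addNr. Qed.

Lemma linD f : linear f -> {morph f : u v / u + v}.
Proof. by move=> lf u v; have := lf 1 u v; rewrite !scale1r. Qed.

Lemma linZ f a u : linear f -> f (a *: u) = a *: f u.
Proof. by move=> lf; have := lf a u 0; rewrite lin0 // !addr0. Qed.

Lemma linB f : linear f -> {morph f : u v / u - v}.
Proof. by move=> lf u v; rewrite -scaleN1r linD // linZ // scaleN1r. Qed.

Lemma lin_sum f (I : Type) (r : seq I) (P : pred I) (F : I -> M) : linear f ->
  f (\sum_(i <- r | P i) F i) = \sum_(i <- r | P i) f (F i).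
Proof.
move=> lf; elim/big_rec2: _ => [|i y1 y2 _ <-]; first exact: lin0.
by rewrite linD.
Qed.

Lemma linear_add f g : linear f -> linear g -> linear (fun v => f v + g v).
Proof. by move=> lf lg a u v; rewrite lf lg scalerDr addrACA. Qed.

Lemma linear_scale (c : C) f : linear f -> linear (fun v => c *: f v).
Proof. by move=> lf a u v; rewrite lf scalerDr !scalerA mulrC. Qed.

Lemma linear_sub f g : linear f -> linear g -> linear (fun v => f v - g v).
Proof. by move=> lf lg a u v; rewrite lf lg scalerBr opprD addrACA. Qed.

Lemma linear_sum (I : Type) (r : seq I) (P : pred I) (F : I -> M -> N) :
  (forall i, P i -> linear (F i)) -> linear (fun v =>
    \sum_(i <- r | P i) F i v).
Proof.
move=> lF a u v; rewrite scaler_sumr -big_split /=.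
by apply: eq_bigr => i Pi; rewrite lF.
Qed.

End LinearMaps.

Lemma linear_id (C : comPzRingType) (M : lmodType C) : linear (fun v : M => v).
Proof. by []. Qed.

Lemma linear_comp (C : comPzRingType) (M N K : lmodType C) (f : N ->
  K) (g : M -> N) :
  linear f -> linear g -> linear (fun v => f (g v)).
Proof. by move=> lf lg a u v; rewrite lg lf. Qed.

Lemma linear_zero (C : comPzRingType) (M N : lmodType C) :
  linear (fun _ : M => 0 : N).
Proof. by move=> a u v; rewrite scaler0 addr0. Qed.

(** * Coefficients of powers and exponentials of a series of commuting operators *)

Section PowerSums.
Variables (C : numFieldType) (V : lmodType C).
Variable t : nat -> V -> V.
Hypothesis t_lin : forall m, linear (t m).
Hypothesis t_comm : forall m n v, t m (t n v) = t n (t m v).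
Let tZ m a u : t m (a *: u) = a *: t m u. Proof. exact: linZ (t_lin m). Qed.
Let t0 m : t m 0 = 0. Proof. exact: lin0 (t_lin m). Qed.
Let tD m : {morph t m : u v / u + v}. Proof. exact: linD (t_lin m). Qed.

(* Coefficient of z^k in (sum_(m >= 1) t_m z^m)^r. *)
Fixpoint powcoef (r k : nat) (v : V) : V :=
  if r is r'.+1 then \sum_(j < k) t j.+1 (powcoef r' (k - j.+1) v)
  else if k == 0%N then v else 0.

(** Splitting off the head of a tuple gives the recursion of [powcoef]. The bound n stays fixed
    while k drops; no tuple is lost, since positive entries with sum k are at most k. *)
Lemma powcoef_tuples r (n k : nat) (v : V) : (k <= n)%N ->
  \sum_(u : r.-tuple 'I_n.+1 |
        all (leq 1) (map val u) && (sumn (map val u) == k))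
     foldr (fun m w => t m w) v (map val u) = powcoef r k v.
Proof.
elim: r k => [|r IH] k kn.
  rewrite (eq_bigl (fun u => (k == 0%N) && (u == [tuple]))); last first.
    by move=> u; rewrite tuple0 /= eq_sym eqxx andbT.
  rewrite /=; case: eqP => _ /=; last by rewrite big_pred0.
  by rewrite big_pred1_eq.
rewrite (reindex (fun p : 'I_n.+1 * r.-tuple 'I_n.+1 =>
  [tuple of p.1 :: p.2])) /=; last first.
  exists (fun u => (thead u, [tuple of behead u])) => [[x u] _|u _] /=.
    by congr pair; apply: val_inj.
  by rewrite [RHS]tuple_eta; apply: val_inj.
rewrite (eq_bigl (fun p : 'I_n.+1 * r.-tuple 'I_n.+1 => (1 <= p.1 <= k)%N &&
   (all (leq 1) (map val p.2) && (sumn (map val p.2) == k - p.1)%N)));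
     last first.
  move=> [x u] /=; case: (leqP 1 x) => //= x1; case: (leqP x k) => /= xk.
    by rewrite -{1}(subnKC xk) eqn_add2l.
  by apply/andP => -[_ /eqP E]; move: xk; rewrite -E ltnNge leq_addr.
rewrite -(pair_big_dep (fun x : 'I_n.+1 =>
  (1 <= x <= k)%N) (fun (x : 'I_n.+1) (u : r.-tuple 'I_n.+1) =>
   all (leq 1) (map val u) && (sumn (map val u) == k - x)%N) (fun x u =>
     t x (foldr (fun m w => t m w) v (map val u)))) /=.
transitivity (\sum_(x < n.+1 | (1 <= x <= k)%N) t x (powcoef r (k - x) v)).
  apply: eq_bigr => x /andP[x1 xk]; rewrite -(lin_sum _ _ _ (t_lin _)) IH //.
  by rewrite leq_subLR (leq_trans kn) ?leq_addl.
rewrite big_mkcond big_ord_recl /= add0r -big_mkcond /=.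
rewrite -(big_mkord (fun i => (i < k)%N) (fun i =>
  t i.+1 (powcoef r (k - i.+1) v))).
by rewrite -(big_mkord xpredT (fun i =>
  t i.+1 (powcoef r (k - i.+1) v))) (big_nat_widen _ _ _ _ _ kn).
Qed.

Lemma powcoef_lin r k : linear (powcoef r k).
Proof.
elim: r k => [|r IH] k /=; first by case: eqP => _;
  [exact: linear_id|exact: linear_zero].
by apply: linear_sum => i _; apply: linear_comp.
Qed.

Lemma powcoef_gt r k v : (k < r)%N -> powcoef r k v = 0.
Proof.
elim: r k => [//|r IH] k kr /=; apply: big1 => i _.
by rewrite IH ?t0 //; have := ltn_ord i; lia.
Qed.

(** A power r > k of a series without constant term does not reach z^k ([powcoef_gt]), so the
    truncation at r = k is the full exponential. *)
Definition expser (k : nat) (v : V) : V :=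
  \sum_(r < k.+1) (r`!%:R)^-1 *: powcoef r k v.

Lemma expserEw n k v : (k <= n)%N ->
  expser k v = \sum_(r < n.+1) (r`!%:R)^-1 *: powcoef r k v.
Proof.
move=> kn; rewrite /expser.
rewrite -(big_mkord xpredT (fun r => (r`!%:R)^-1 *: powcoef r k v)).
rewrite -(big_mkord xpredT (fun r => (r`!%:R)^-1 *: powcoef r k v)).
rewrite (@big_cat_nat _ _ _ k.+1 0 n.+1) //= [X in _ = _ + X]big1_seq ?addr0 //.
by move=> i; rewrite mem_index_iota => /andP[_ /andP[ki _]];
  rewrite powcoef_gt ?scaler0.
Qed.

Lemma expser_lin k : linear (expser k).
Proof.
move=> a u v; rewrite /expser scaler_sumr -big_split; apply: eq_bigr => r _.
by rewrite /= powcoef_lin scalerDr !scalerA mulrC.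
Qed.

Lemma expser0 v : expser 0 v = v.
Proof. by rewrite /expser big_ord_recl big_ord0 /= addr0 invr1 scale1r. Qed.

(** Both sums range over i + j + 1 < k, a condition symmetric in i and j. *)
Lemma sum_triangle_exchange (W : zmodType) (F : nat -> nat -> W) k :
  \sum_(j < k) \sum_(i < k - j.+1) F j i =
  \sum_(j < k) \sum_(i < k - j.+1) F i j.
Proof.
have E (G : nat -> nat -> W) : \sum_(j < k) \sum_(i < k - j.+1) G j i =
  \sum_(j < k) \sum_(i < k) if (i + j.+1 < k)%N then G j i else 0.
  apply: eq_bigr => j _; rewrite -big_mkcond /=.
  rewrite -(big_mkord xpredT (G j)) -(big_mkord (fun i =>
    (i + j.+1 < k)%N) (G j)).
  rewrite (big_nat_widen _ _ k) ?leq_subr //.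
  by apply: eq_bigl => i; rewrite ltn_subRL addnC.
rewrite E (E (fun i j => F j i)) exchange_big /=.
by apply: eq_bigr => j _; apply: eq_bigr => i _; rewrite addnS addnC -addnS.
Qed.

(* Both sides are coefficients of z (d/dz) p^(r+1) = (r+1) (z dp/dz) p^r
   for p = sum_(m >= 1) t_m z^m. *)
Lemma powcoef_deriv r k v : k%:R *: powcoef r.+1 k v =
  r.+1%:R *: \sum_(j < k) j.+1%:R *: t j.+1 (powcoef r (k - j.+1) v).
Proof.
elim: r k => [|r IH] k.
  rewrite scale1r [powcoef 1 k v]/= scaler_sumr; apply: eq_bigr => j _ /=.
  have [E|kj] := eqVneq (k - j.+1)%N 0%N; last by rewrite t0 !scaler0.
  apply: (congr1 (fun n : nat => n%:R *: t j.+1 v)).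
  by apply/eqP; rewrite eqn_leq (ltn_ord j) -subn_eq0 E eqxx.
pose A := \sum_(j < k) j.+1%:R *: t j.+1 (powcoef r.+1 (k - j.+1) v).
have -> : k%:R *: powcoef r.+2 k v =
    A + \sum_(j < k) t j.+1 ((k - j.+1)%:R *: powcoef r.+1 (k - j.+1) v).
  rewrite [powcoef r.+2 k v]/= scaler_sumr -big_split; apply: eq_bigr => j _.
  by rewrite /= tZ -scalerDl -natrD subnKC.
have -> : \sum_(j < k) t j.+1 ((k - j.+1)%:R *: powcoef r.+1 (k - j.+1) v) =
  r.+1%:R *: A.
  under eq_bigr do rewrite IH tZ (lin_sum _ _ _ (t_lin _)).
  rewrite -scaler_sumr; congr (_ *: _).
  rewrite (sum_triangle_exchange (fun j i =>
     t j.+1 (i.+1%:R *: t i.+1 (powcoef r (k - j.+1 - i.+1) v)))).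
  apply: eq_bigr => j _; rewrite [powcoef r.+1 _ _]/= (lin_sum _ _ _ (t_lin _))
    scaler_sumr.
  apply: eq_bigr => i _.
  by rewrite tZ t_comm -!subnDA addnC.
by rewrite -/A -[r.+2]add1n natrD scalerDl scale1r.
Qed.

(** The coefficient of z^k in z (d/dz) exp p = (z dp/dz) exp p. In characteristic zero this
    recurrence determines [expser] and replaces the defining sum in all later inductions. *)
Lemma expser_deriv k v : k%:R *: expser k v =
  \sum_(j < k) j.+1%:R *: t j.+1 (expser (k - j.+1) v).
Proof.
case: k => [|k]; first by rewrite scale0r big_ord0.
rewrite [in LHS]/expser big_ord_recl /= scaler0 add0r scaler_sumr.
transitivity (\sum_(i < k.+1) \sum_(j < k.+1)
  j.+1%:R *: ((i`!%:R)^-1 *: t j.+1 (powcoef i (k.+1 - j.+1) v))).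
  apply: eq_bigr => i _; rewrite /bump leq0n add1n.
  rewrite scalerA mulrC -scalerA powcoef_deriv scalerA.
  rewrite factS natrM invfM mulrAC mulVf ?pnatr_eq0 // mul1r scaler_sumr.
  by apply: eq_bigr => j _; rewrite !scalerA mulrC.
rewrite exchange_big; apply: eq_bigr => j _ /=.
rewrite -scaler_sumr (@expserEw k); last by rewrite subSS leq_subr.
congr (_ *: _); rewrite (lin_sum _ _ _ (t_lin _)).
by apply: eq_bigr => i _; rewrite linZ.
Qed.

End PowerSums.

Lemma natscaleI (C : numFieldType) (M : lmodType C) (k : nat) (u v : M) :
  (0 < k)%N -> k%:R *: u = k%:R *: v -> u = v.
Proof.
move=> k0 E; have k1 : (k%:R : C) != 0 by rewrite pnatr_eq0; lia.
by rewrite -[u](scalerK k1) E scalerK.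
Qed.

(** * Commutators with exponential series *)

Section ExpcoefComm.
Variables (C : numFieldType) (V : lmodType C) (t : nat -> V -> V).
Hypothesis t_lin : forall m, linear (t m).
Hypothesis t_comm : forall m n v, t m (t n v) = t n (t m v).
Let tZ m a u : t m (a *: u) = a *: t m u. Proof. exact: linZ (t_lin m). Qed.
Let t0 m : t m 0 = 0. Proof. exact: lin0 (t_lin m). Qed.
Let tD m : {morph t m : u v / u + v}. Proof. exact: linD (t_lin m). Qed.

Lemma expser_comm (D : V -> V) k v : linear D ->
  (forall m w, (0 < m)%N -> D (t m w) = t m (D w)) ->
  D (expser t k v) = expser t k (D v).
Proof.
move=> lD Dt; have [n kn] := ubnP k; elim: n k kn => // n IH k kn.
case: k kn => [|k] kn; first by rewrite !expser0.
apply: (@natscaleI _ _ k.+1); first by [].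
rewrite -(linZ _ _ lD).
rewrite (expser_deriv t_lin t_comm k.+1 v).
rewrite (expser_deriv t_lin t_comm k.+1 (D v)).
rewrite (lin_sum _ _ _ lD).
apply: eq_bigr => j _.
by rewrite (linZ _ _ lD) Dt // IH //; lia.
Qed.

(** If the commutator of D with p is the scalar a z^n, its commutator with exp p is a z^n exp p. *)
Lemma expser_derivation (D : V -> V) (n : nat) (a : C) k v :
  linear D -> (0 < n)%N ->
  (forall m w, (0 < m)%N ->
     D (t m w) = t m (D w) + (if m == n then a else 0) *: w) ->
  D (expser t k v) = expser t k (D v) +
     (if (n <= k)%N then a *: expser t (k - n) v else 0).
Proof.
move=> lD n0 Dt; have [N kN] := ubnP k; elim: N k kN => // N IH k kN.
case: k kN => [|k] kN; first by rewrite leqNgt n0 addr0 !expser0.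
apply: (@natscaleI _ _ k.+1); first by [].
rewrite -(linZ _ _ lD) (expser_deriv t_lin t_comm k.+1 v) (lin_sum _ _ _ lD).
rewrite scalerDr (expser_deriv t_lin t_comm k.+1 (D v)).
have step (j : 'I_k.+1) : D (j.+1%:R *: t j.+1 (expser t (k.+1 - j.+1) v)) =
    j.+1%:R *: t j.+1 (expser t (k.+1 - j.+1) (D v)) +
    (j.+1%:R *: ((if j.+1 == n then a else 0) *: expser t (k.+1 - j.+1) v) +
     j.+1%:R *: t j.+1 (if (n <= k.+1 - j.+1)%N then
       a *: expser t (k.+1 - j.+1 - n) v else 0)).
  rewrite (linZ _ _ lD) Dt // IH; last by lia.
  by rewrite (linD (t_lin _)) !scalerDr -!addrA [X in _ + X = _]addrC.
rewrite (eq_bigr _ (fun j _ => step j)) !big_split /=; congr (_ + _).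
(* The commutator with the leading factor contributes n times the expected term, the induction
   hypothesis k + 1 - n times; together this is the factor k + 1. *)
have S1 : \sum_(i < k.+1) i.+1%:R *: ((if i.+1 == n then a else 0) *:
      expser t (k.+1 - i.+1) v) =
    if (n <= k.+1)%N then n%:R *: (a *: expser t (k.+1 - n) v) else 0.
  rewrite -(big_mkord xpredT (fun i =>
    i.+1%:R *: ((if i.+1 == n then a else 0) *:
      expser t (k.+1 - i.+1) v))).
  case: n n0 {Dt IH step} => // n _; case nk: (n < k.+1)%N.
    rewrite (bigD1_seq n) ?mem_index_iota ?iota_uniq // eqxx big1 => [|i ni];
      first exact: addr0.
    by rewrite eqSS (negPf ni) scale0r scaler0.
  rewrite big1_seq // => i; rewrite mem_index_iota => /andP[_ /andP[_ ik]].
  by rewrite eqSS ifF ?scale0r ?scaler0 //; lia.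
have S2 : \sum_(i < k.+1) i.+1%:R *: t i.+1 (if (n <= k.+1 - i.+1)%N then
      a *: expser t (k.+1 - i.+1 - n) v else 0) =
    if (n <= k.+1)%N then (k.+1 - n)%:R *: (a *: expser t (k.+1 - n) v) else 0.
  rewrite -(big_mkord xpredT (fun i =>
    i.+1%:R *: t i.+1 (if (n <= k.+1 - i.+1)%N then
      a *: expser t (k.+1 - i.+1 - n) v else 0))).
  case nk: (n <= k.+1)%N; last first.
    apply: big1 => i _; rewrite ifF ?(lin0 (t_lin _)) ?scaler0 //; lia.
  rewrite (@big_cat_nat _ _ _ (k.+1 - n)) ?leq_subr //= addrC big1_seq ?add0r;
    last first.
    move=> i; rewrite mem_index_iota => /andP[_ /andP[i1 i2]].
    by rewrite ifF ?(lin0 (t_lin _)) ?scaler0 //; lia.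
  rewrite scalerA mulrC -scalerA (expser_deriv t_lin t_comm) scaler_sumr
    big_mkord.
  apply: eq_bigr => i _; rewrite ifT; last by have := ltn_ord i; lia.
  by rewrite (linZ _ _ (t_lin _)) !scalerA mulrC;
    congr (_ *: t _ (expser t _ v)); lia.
rewrite S1 S2; case nk: (n <= k.+1)%N; last by rewrite addr0 scaler0.
by rewrite -scalerDl -natrD subnKC.
Qed.

End ExpcoefComm.

(** * Occupation numbers and their weighted degrees *)

Section Occupations.
Implicit Types (w : 'I_4 * nat -> nat) (k : occupation) (x : 'I_4 * nat).

(** Several weights w occur: [cweight] gives the c-degree, [tweight] the total degree, the constant
    1 the number of quanta, the indicator of [ia2] the number of a^2-quanta. *)
Definition wdeg w k : nat := (\sum_(x <- finsupp k) w x * k x)%N.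

Lemma wdegEw w k (D : {fset 'I_4 * nat}) : (finsupp k `<=` D)%fset ->
  wdeg w k = (\sum_(x <- D) w x * k x)%N.
Proof.
move=> kD; rewrite /wdeg (big_fset_incl _ kD) //= => x _ xk.
by rewrite fsfun_dflt // muln0.
Qed.

Lemma wdeg_set w k x n :
  (wdeg w (set_occ k x n) + w x * k x = wdeg w k + w x * n)%N.
Proof.
pose D := (finsupp k `|` finsupp (set_occ k x n) `|` [fset x])%fset.
have kD : (finsupp k `<=` D)%fset by rewrite /D -fsetUA fsubsetUl.
have k'D : (finsupp (set_occ k x n) `<=` D)%fset.
  by rewrite /D fsetUAC fsubsetUr.
have xD : x \in D by rewrite !inE eqxx orbT.
rewrite (wdegEw w kD) (wdegEw w k'D) !(big_fsetD1 x xD) /= set_occE eqxx.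
suff -> : (\sum_(y <- (D `\ x)%fset) w y * set_occ k x n y =
           \sum_(y <- (D `\ x)%fset) w y * k y)%N by rewrite -addnA addnC [X in
             (X + _)%N]addnC.
by apply: eq_big_seq => y; rewrite !inE => /andP[yx _];
  rewrite set_occE (negPf yx).
Qed.

Lemma wdegS w k x : wdeg w (set_occ k x (k x).+1) = (wdeg w k + w x)%N.
Proof. by have := wdeg_set w k x (k x).+1; rewrite mulnS; lia. Qed.

Lemma wdeg_pred w k x : (0 < k x)%N ->
  (wdeg w (set_occ k x (k x).-1) + w x = wdeg w k)%N.
Proof.
move=> kx; have := wdeg_set w k x (k x).-1.
by case: (k x) kx => // n _ /=; rewrite mulnS; lia.
Qed.

Lemma wdeg_eq0 w k : wdeg w k = 0%N -> forall x, (w x * k x)%N = 0%N.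
Proof.
move=> k0 x; have [xk|xk] := boolP (x \in finsupp k);
  last by rewrite fsfun_dflt ?muln0.
by move: k0; rewrite /wdeg (big_fsetD1 x xk) /=; lia.
Qed.

Lemma wdeg_neq0 w k : wdeg w k != 0%N -> exists x, (0 < w x * k x)%N.
Proof.
move=> k0; apply: contrapT => H; case/eqP: k0.
by apply: big1 => x _; apply/eqP; rewrite -leqn0 leqNgt; apply/negP => ?;
  apply: H; exists x.
Qed.

Lemma set_occ_predK k x : (0 < k x)%N ->
  set_occ (set_occ k x (k x).-1) x (set_occ k x (k x).-1 x).+1 = k.
Proof. by move=> kx; apply: set_occK; rewrite set_occE eqxx prednK. Qed.

Lemma set_occ_succK k x :
  set_occ (set_occ k x (k x).+1) x (set_occ k x (k x).+1 x).-1 = k.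
Proof. by apply: set_occK; rewrite set_occE eqxx. Qed.

End Occupations.

(** * Free modules on the states: coefficients, supports and projections *)

Definition fstate (C : Type) : Type := ({ffun 'I_4 -> C} * occupation)%type.

(* A free module on the states.  Reasoning on an abstract one keeps the scaling
   of [boson R] from being unfolded by conversion. *)
Record fmodule (C : numFieldType) := FModule {
  fcarrier :> lmodType C;
  bas : fstate C -> fcarrier;
  lext : (fstate C -> fcarrier) -> fcarrier -> fcarrier;
  coef : fstate C -> fcarrier -> C;
  lext_linear : forall F, linear (lext F);
  lext_bas : forall F s, lext F (bas s) = F s;
  coef_linear : forall s a u v, coef s (a *: u + v) = a * coef s u + coef s v;
  coef_bas : forall s t, coef s (bas t) = (s == t)%:R;
  bas_expand : forall v, exists S : seq (fstate C),
    v = \sum_(s <- S) coef s v *: bas s }.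

Arguments bas {C B} s : rename.
Arguments lext {C B} F v : rename.
Arguments coef {C B} s v : rename.

Section Coefficients.
Variables (C : numFieldType) (B : fmodule C).
Implicit Types (u v : B) (s : fstate C) (P : fstate C -> Prop).

Lemma fcoefD s u v : coef s (u + v) = coef s u + coef s v.
Proof. by rewrite -{1}[u]scale1r coef_linear mul1r. Qed.

Lemma fcoef0 s : coef s (0 : B) = 0.
Proof. by apply: (addrI (coef s (0 : B))); rewrite -fcoefD !addr0. Qed.

Lemma fcoefZ s a u : coef s (a *: u) = a * coef s u.
Proof. by rewrite -{1}[a *: u]addr0 coef_linear fcoef0 addr0. Qed.

Lemma fcoefN s u : coef s (- u) = - coef s u.
Proof. by rewrite -scaleN1r fcoefZ mulN1r. Qed.

Lemma fcoefB s u v : coef s (u - v) = coef s u - coef s v.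
Proof. by rewrite fcoefD fcoefN. Qed.

Lemma fcoef_sum s (I : Type) (r : seq I) (P : pred I) (F : I -> B) :
  coef s (\sum_(i <- r | P i) F i) = \sum_(i <- r | P i) coef s (F i).
Proof.
by elim/big_rec2: _ => [|i y1 y2 _ <-]; [exact: fcoef0|rewrite fcoefD].
Qed.

Lemma coef_ext u v : (forall s, coef s u = coef s v) -> u = v.
Proof.
move=> uv; apply/eqP; rewrite -subr_eq0; have [S ->] := bas_expand (u - v).
by rewrite big1 // => s _; rewrite fcoefB uv subrr scale0r.
Qed.

Lemma lin_expand (N : lmodType C) (f : B -> N) v : linear f ->
  exists S : seq (fstate C), f v = \sum_(s <- S) coef s v *: f (bas s).
Proof.
move=> lf; have [S vE] := bas_expand v; exists S.
by rewrite {1}vE (lin_sum _ _ _ lf); apply: eq_bigr => s _;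
  rewrite (linZ _ _ lf).
Qed.

Lemma fm_ext (N : lmodType C) (f g : B -> N) : linear f -> linear g ->
  (forall s, f (bas s) = g (bas s)) -> f =1 g.
Proof.
move=> lf lg fg v; apply/eqP; rewrite -subr_eq0; apply/eqP.
have [S ->] := lin_expand v (linear_sub lf lg).
by rewrite big1 // => s _; rewrite fg subrr scaler0.
Qed.

Lemma fm_ind (Q : B -> Prop) : Q 0 -> (forall a u v,
  Q u -> Q v -> Q (a *: u + v)) ->
  (forall s, Q (bas s)) -> forall v, Q v.
Proof.
move=> Q0 QD Qb v; have [S ->] := bas_expand v.
elim: S => [|s S IH]; first by rewrite big_nil.
by rewrite big_cons; apply: QD.
Qed.

Definition vsupp P v : Prop := forall s, ~ P s -> coef s v = 0.

Lemma vsupp0 P : vsupp P 0.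
Proof. by move=> s _; exact: fcoef0. Qed.

Lemma vsupp_linear P a u v : vsupp P u -> vsupp P v -> vsupp P (a *: u + v).
Proof. by move=> Pu Pv s Ps; rewrite coef_linear Pu // Pv // mulr0 addr0. Qed.

Lemma vsuppZ P a v : vsupp P v -> vsupp P (a *: v).
Proof. by move=> Pv s Ps; rewrite fcoefZ Pv // mulr0. Qed.

Lemma vsuppD P u v : vsupp P u -> vsupp P v -> vsupp P (u + v).
Proof. by move=> Pu Pv s Ps; rewrite fcoefD Pu // Pv // addr0. Qed.

Lemma vsupp_sum P (I : Type) (r : seq I) (D : pred I) (F : I -> B) :
  (forall i, D i -> vsupp P (F i)) -> vsupp P (\sum_(i <- r | D i) F i).
Proof.
by move=> PF s Ps; rewrite fcoef_sum big1 // => i Di; rewrite PF.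
Qed.

Lemma vsupp_bas P s : P s -> vsupp P (bas s).
Proof.
by move=> Ps t Pt; rewrite coef_bas; case: eqP => // E; case: Pt; rewrite E.
Qed.

Lemma vsupp_sub P P' v : (forall s, P s -> P' s) -> vsupp P v -> vsupp P' v.
Proof. by move=> PP' Pv s P's; apply: Pv => /PP'. Qed.

Lemma vsupp_false P v : (forall s, ~ P s) -> vsupp P v -> v = 0.
Proof. by move=> NP Pv; apply: coef_ext => s; rewrite fcoef0; apply: Pv. Qed.

Lemma vsupp_ind P (Q : B -> Prop) v : Q 0 ->
  (forall a u v, Q u -> Q v -> Q (a *: u + v)) -> (forall s,
    P s -> Q (bas s)) ->
  vsupp P v -> Q v.
Proof.
move=> Q0 QD Qb Pv; have [S ->] := bas_expand v.
elim: S => [|s S IH]; first by rewrite big_nil.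
rewrite big_cons; have [Ps|Ps] := pselect (P s); first by apply: QD => //;
  exact: Qb.
by rewrite Pv // scale0r add0r.
Qed.

Lemma lin_vsupp P P' (f : B -> B) v : linear f ->
  (forall s, P s -> vsupp P' (f (bas s))) -> vsupp P v -> vsupp P' (f v).
Proof.
move=> lf fP; apply: (@vsupp_ind P (fun u => vsupp P' (f u))) => //.
- by rewrite (lin0 lf); exact: vsupp0.
- by move=> a u w Pu Pw; rewrite lf; exact: vsupp_linear.
Qed.

Lemma lin_vsupp_eq P (N : lmodType C) (f g : B -> N) v : linear f -> linear g ->
  (forall s, P s -> f (bas s) = g (bas s)) -> vsupp P v -> f v = g v.
Proof.
move=> lf lg fg; apply: (@vsupp_ind P (fun u => f u = g u)) => //;
  first by rewrite (lin0 lf) (lin0 lg).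
by move=> a u w fu fw; rewrite lf lg fu fw.
Qed.

Lemma finite_coef v : exists S : seq (fstate C), forall s,
  coef s v != 0 -> s \in S.
Proof.
have [S vE] := bas_expand v; exists S => s; apply: contraR => sS.
rewrite vE fcoef_sum big1_seq // => t /andP[_ tS].
rewrite fcoefZ coef_bas; case: eqP => [E|]; last by rewrite mulr0.
by rewrite E tS in sS.
Qed.

Definition vproj P : B -> B := lext (fun s => if `[< P s >] then bas s else 0).

Lemma vproj_linear P : linear (vproj P).
Proof. exact: lext_linear. Qed.

Lemma coef_vproj P s v : coef s (vproj P v) =
  if `[< P s >] then coef s v else 0.
Proof.
(* With C^o the scalars are a module over themselves, so that [fm_ext] applies to coefficient
   functionals. *)
pose f (u : B) : C^o := coef s (vproj P u).
pose g (u : B) : C^o := if `[< P s >] then coef s u else 0.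
apply: (@fm_ext _ f g _ _ _ v) => [a u w|a u w|t].
- by rewrite /f vproj_linear coef_linear.
- by rewrite /g; case: ifP => _; rewrite ?coef_linear // scaler0 addr0.
- rewrite /f /g /vproj lext_bas (fun_if (coef s)) fcoef0 coef_bas.
  by case: (eqVneq s t) => [->//|]; case: ifP; case: ifP.
Qed.

Lemma vproj_supp P v : vsupp P (vproj P v).
Proof. by move=> s Ps; rewrite coef_vproj asboolF. Qed.

Lemma vproj_id P v : vsupp P v -> vproj P v = v.
Proof.
by move=> Pv; apply: coef_ext => s; rewrite coef_vproj; case: asboolP => // /Pv.
Qed.

End Coefficients.

(** * Oscillators on a free module and their matrix coefficients *)

Section Operators.
Variables (C : numFieldType) (B : fmodule C) (q : C).
Implicit Types (u v : B) (s : fstate C).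

Definition qint (m : int) : C := (q ^ m - q ^ (- m)) / (q - q^-1).

Definition sgn4 (i : 'I_4) : C := if i == ib then -1 else 1.

Definition fosc (i : 'I_4) (n : int) : B -> B := lext (fun s =>
  match n with
  | Posz 0 => (sgn4 i * s.1 i) *: bas s
  | Posz m.+1 =>
      (sgn4 i * (qint m.+1 ^+ 2 / m.+1%:R) * (s.2 (i, m))%:R) *:
        bas (s.1, set_occ s.2 (i, m) (s.2 (i, m)).-1)
  | Negz m => bas (s.1, set_occ s.2 (i, m) (s.2 (i, m)).+1)
  end).

Definition fexpQ (mu : {ffun 'I_4 -> C}) : B -> B :=
  lext (fun s => bas (s.1 + mu, s.2)).

Definition fchproj (mu : int) : B -> B :=
  lext (fun s => if s.1 ic == mu%:~R then bas s else 0).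

Lemma fosc_linear i n : linear (fosc i n). Proof. exact: lext_linear. Qed.
Lemma fexpQ_linear mu : linear (fexpQ mu). Proof. exact: lext_linear. Qed.
Lemma fchproj_linear mu : linear (fchproj mu). Proof. exact: lext_linear. Qed.

Lemma fosc0_bas i s : fosc i 0 (bas s) = (sgn4 i * s.1 i) *: bas s.
Proof. exact: lext_bas. Qed.

Lemma fosc_pos_bas i m s : fosc i m.+1 (bas s) =
  (sgn4 i * (qint m.+1 ^+ 2 / m.+1%:R) * (s.2 (i, m))%:R) *:
    bas (s.1, set_occ s.2 (i, m) (s.2 (i, m)).-1).
Proof. exact: lext_bas. Qed.

Lemma fosc_neg_bas i m s :
  fosc i (Negz m) (bas s) = bas (s.1, set_occ s.2 (i, m) (s.2 (i, m)).+1).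
Proof. exact: lext_bas. Qed.

Lemma fexpQ_bas mu s : fexpQ mu (bas s) = bas (s.1 + mu, s.2).
Proof. exact: lext_bas. Qed.

Lemma coef_fosc0 i s v : coef s (fosc i 0 v) = sgn4 i * s.1 i * coef s v.
Proof.
pose f (u : B) : C^o := coef s (fosc i 0 u).
pose g (u : B) : C^o := sgn4 i * s.1 i * coef s u.
apply: (@fm_ext _ _ _ f g _ _ _ v) => [a u w|a u w|t].
- by rewrite /f fosc_linear coef_linear.
- by rewrite /g coef_linear mulrDr mulrCA.
- rewrite /f /g fosc0_bas fcoefZ coef_bas.
  by case: (eqVneq s t) => [->//|]; rewrite !mulr0.
Qed.

(** The only state lowered to (l, k) is the one with an additional quantum in the mode (i, m). *)
Lemma coef_fosc_pos i m l k v : coef (l, k) (fosc i m.+1 v) =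
  sgn4 i * (qint m.+1 ^+ 2 / m.+1%:R) * (k (i, m)).+1%:R *
    coef (l, set_occ k (i, m) (k (i, m)).+1) v.
Proof.
set a := sgn4 i * _; set b := a * _.
pose f (u : B) : C^o := coef (l, k) (fosc i m.+1 u).
pose g (u : B) : C^o := b * coef (l, set_occ k (i, m) (k (i, m)).+1) u.
apply: (@fm_ext _ _ _ f g _ _ _ v) => [c u w|c u w|[l' k']].
- by rewrite /f fosc_linear coef_linear.
- by rewrite /g coef_linear mulrDr mulrCA.
rewrite /f /g fosc_pos_bas /= fcoefZ !coef_bas !xpair_eqE.
case: (eqVneq l l') => [_|]; last by rewrite !mulr0.
have [k0|k0] := posnP (k' (i, m)).
  (* On an empty mode the factor k' (i, m) is zero, which makes the truncated predecessor
     harmless. *)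
  rewrite k0 mulr0 mul0r; case: eqP => [E|_]; last by rewrite mulr0.
  by move: k0; rewrite -E set_occE eqxx.
have -> : (k == set_occ k' (i, m) (k' (i, m)).-1) =
          (set_occ k (i, m) (k (i, m)).+1 == k').
  apply/eqP/eqP => [->|<-]; first exact: set_occ_predK.
  by rewrite set_occ_succK.
case: eqP => [<-|_]; last by rewrite !mulr0.
by rewrite set_occE eqxx.
Qed.

Lemma coef_fosc_neg i m l k v : coef (l, k) (fosc i (Negz m) v) =
  if k (i, m) == 0%N then 0 else coef (l, set_occ k (i, m) (k (i, m)).-1) v.
Proof.
pose f (u : B) : C^o := coef (l, k) (fosc i (Negz m) u).
pose g (u : B) : C^o := if k (i, m) == 0%N then 0
  else coef (l, set_occ k (i, m) (k (i, m)).-1) u.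
apply: (@fm_ext _ _ _ f g _ _ _ v) => [c u w|c u w|[l' k']].
- by rewrite /f fosc_linear coef_linear.
- by rewrite /g; case: eqP => _; rewrite ?coef_linear // scaler0 addr0.
rewrite /f /g fosc_neg_bas /= !coef_bas !xpair_eqE.
case: (eqVneq l l') => [_|_] /=; last by rewrite if_same.
have [k0|k0] := posnP (k (i, m)).
  by case: eqP => // E; move: k0; rewrite E set_occE eqxx.
congr (_%:R); congr nat_of_bool.
apply/eqP/eqP => [->|<-]; first by rewrite set_occ_succK.
by rewrite set_occ_predK.
Qed.

Lemma coef_fchproj mu s v :
  coef s (fchproj mu v) = if s.1 ic == mu%:~R then coef s v else 0.
Proof.
pose f (u : B) : C^o := coef s (fchproj mu u).
pose g (u : B) : C^o := if s.1 ic == mu%:~R then coef s u else 0.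
apply: (@fm_ext _ _ _ f g _ _ _ v) => [c u w|c u w|t].
- by rewrite /f fchproj_linear coef_linear.
- by rewrite /g; case: eqP => _; rewrite ?coef_linear // scaler0 addr0.
rewrite /f /g /fchproj lext_bas (fun_if (coef s)) fcoef0 coef_bas.
by case: (eqVneq s t) => [->//|_]; rewrite !if_same.
Qed.

End Operators.

(** * Zero modes and degrees under the operators *)

Section Gradings.
Variables (C : numFieldType) (B : fmodule C) (q : C).
Implicit Types (u v : B) (s : fstate C) (l : {ffun 'I_4 -> C}).

(** The degree z is an integer, so that lowering operators may push it below zero, where only the
    zero vector is left ([hdeg_lt0]). *)
Definition hdeg l (w : 'I_4 * nat -> nat) (z : int) s : Prop :=
  s.1 = l /\ (wdeg w s.2)%:Z = z.

Lemma hdeg_lt0 l w z v : z < 0 -> vsupp (hdeg l w z) v -> v = 0.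
Proof. by move=> z0; apply: vsupp_false => s [_ E]; move: z0; rewrite -E. Qed.

Lemma fosc_hdeg_pos i m l w z v : vsupp (hdeg l w z) v ->
  vsupp (hdeg l w (z - (w (i, m))%:Z)) (fosc q i m.+1 v).
Proof.
apply: lin_vsupp; first exact: fosc_linear.
move=> s [sl sz]; rewrite fosc_pos_bas.
have [k0|k0] := posnP (s.2 (i, m)).
  by rewrite k0 mulr0 scale0r; exact: vsupp0.
apply: vsuppZ; apply: vsupp_bas; split=> //=.
by rewrite -sz -(wdeg_pred w k0) PoszD addrK.
Qed.

Lemma fosc_hdeg_neg i m l w z v : vsupp (hdeg l w z) v ->
  vsupp (hdeg l w (z + (w (i, m))%:Z)) (fosc q i (Negz m) v).
Proof.
apply: lin_vsupp; first exact: fosc_linear.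
move=> s [sl sz]; rewrite fosc_neg_bas.
by apply: vsupp_bas; split=> //=; rewrite -sz wdegS PoszD.
Qed.

Lemma fexpQ_hdeg mu l w z v : vsupp (hdeg l w z) v ->
  vsupp (hdeg (l + mu) w z) (fexpQ mu v).
Proof.
apply: lin_vsupp; first exact: fexpQ_linear.
by move=> s [sl sz]; rewrite fexpQ_bas; apply: vsupp_bas; split=> //=;
  rewrite sl.
Qed.

Lemma fchproj_hdeg m l w z v : vsupp (hdeg l w z) v ->
  fchproj m v = if l ic == m%:~R then v else 0.
Proof.
move=> vl; apply: coef_ext => s; rewrite coef_fchproj.
have [[<- _]|E] := pselect (hdeg l w z s); first by case: ifP; rewrite ?fcoef0.
by rewrite (vl _ E); do 2!case: ifP; rewrite ?fcoef0 ?(vl _ E).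
Qed.

(** The sign [sg] distinguishes creation from annihilation. The recurrence of [expser_deriv],
    divided by k + 1, adds the shifts of its two factors. *)
Lemma expser_graded (t : nat -> B -> B) (sg : int)
    (G : int -> fstate C -> Prop) k z v :
  (forall m, linear (t m)) -> (forall m n v, t m (t n v) = t n (t m v)) ->
  (forall m z u, vsupp (G z) u -> vsupp (G (z + sg * m.+1%:Z)) (t m.+1 u)) ->
  vsupp (G z) v -> vsupp (G (z + sg * k%:Z)) (expser t k v).
Proof.
move=> lt ct tG vG; have [n kn] := ubnP k; elim: n k kn => // n IH k kn.
case: k kn => [|k] kn; first by rewrite mulr0 addr0 expser0.
have k1 : (k.+1%:R : C) != 0 by rewrite pnatr_eq0.
rewrite -[expser t k.+1 v](scalerK k1); apply: vsuppZ.
rewrite (expser_deriv lt ct); apply: vsupp_sum => j _; apply: vsuppZ.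
have -> : z + sg * k.+1%:Z = z + sg * (k.+1 - j.+1)%N%:Z + sg * j.+1%:Z.
  by rewrite -addrA -mulrDr -PoszD subnK.
by apply: tG; apply: IH; lia.
Qed.

Lemma fosc_fexpQ i n mu v : n != 0 ->
  fosc q i n (fexpQ mu v) = fexpQ mu (fosc q i n v).
Proof.
move=> n0; apply: (@fm_ext _ _ _ (fun v => fosc q i n (fexpQ mu v))
   (fun v => fexpQ mu (fosc q i n v))) => [||s].
- by apply: linear_comp; [exact: fosc_linear|exact: fexpQ_linear].
- by apply: linear_comp; [exact: fexpQ_linear|exact: fosc_linear].
case: n n0 => [[//|n]|n] _; rewrite fexpQ_bas.
  by rewrite !fosc_pos_bas (linZ _ _ (@fexpQ_linear _ _ _)) fexpQ_bas.
by rewrite !fosc_neg_bas fexpQ_bas.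
Qed.

Lemma fosc_fchproj i n mu v :
  fosc q i n (fchproj mu v) = fchproj mu (fosc q i n v).
Proof.
apply: (@fm_ext _ _ _ (fun v => fosc q i n (fchproj mu v))
   (fun v => fchproj mu (fosc q i n v))) => [||s].
- by apply: linear_comp; [exact: fosc_linear|exact: fchproj_linear].
- by apply: linear_comp; [exact: fchproj_linear|exact: fosc_linear].
have f0 : fosc q i n (0 : B) = 0 by exact: (lin0 (@fosc_linear C B q i n)).
case: n f0 => [[|n]|n] f0; rewrite [X in fosc q i _ X]lext_bas (fun_if (fosc q
  i _)) f0.
- rewrite fosc0_bas (linZ _ _ (@fchproj_linear _ _ _)) [fchproj _ _]lext_bas.
  by case: ifP => _; rewrite ?scaler0.
- rewrite fosc_pos_bas (linZ _ _ (@fchproj_linear _ _ _)) [fchproj _ _]lext_bas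
  /=.
  by case: ifP => _; rewrite ?scaler0.
- by rewrite fosc_neg_bas [fchproj _ _]lext_bas.
Qed.

End Gradings.

(** * Vertex operators and the anticommutation of their modes *)

Section VertexOperators.
Variables (C : numFieldType) (B : fmodule C) (q : C).
Hypothesis qint_neq0 : forall m, qint q m.+1 != 0.
Hypothesis fosc_comm : forall i j m n (v : B),
  fosc q i m (fosc q j n v) = fosc q j n (fosc q i m v) +
  (if [&& i == j, m + n == 0 & m != 0]
   then sgn4 C i * (qint q m ^+ 2 / m%:~R) else 0) *: v.
Implicit Types (u v : B) (s : int) (l : {ffun 'I_4 -> C}).

Local Notation c := (fosc q ic).

Definition flam4 (x1 x2 x3 x4 : C) : {ffun 'I_4 -> C} :=
  [ffun i : 'I_4 => nth 0 [:: x1; x2; x3; x4] i].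

Definition craise (s : int) (m : nat) (v : B) : B :=
  (s%:~R / qint q m) *: c (- m%:Z) v.
Definition clower (s : int) (m : nat) (v : B) : B :=
  (- s%:~R / qint q m) *: c m v.

Definition vterm (s e : int) (kj : nat * nat) (v : B) : B :=
  fexpQ (flam4 0 0 0 s%:~R) (expser (craise s) kj.1
    (expser (clower s) kj.2 (fchproj (s * (e - kj.1%:Z + kj.2%:Z)) v))).

Definition vop (s e : int) (v : B) : B :=
  \sum_(kj \in [set: nat * nat]) vterm s e kj v.

(** For n of either sign, s [kappa] n z^n is the commutator of c_n with the exponent s c(z;0). *)
Definition kappa (n : int) : C := qint q n / n%:~R.

Lemma qintN m : qint q (- m) = - qint q m.
Proof. by rewrite /qint opprK -mulNr opprB. Qed.

Lemma kappaN n : kappa (- n) = kappa n.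
Proof. by rewrite /kappa qintN mulrNz invrN mulrNN. Qed.

Lemma c_comm m n v : c m (c n v) = c n (c m v) +
  (if (m + n == 0) && (m != 0) then qint q m ^+ 2 / m%:~R else 0) *: v.
Proof.
have ic_ib : (ic == ib) = false by apply/eqP => /(congr1 val);
  rewrite /= !inordK.
by rewrite fosc_comm eqxx /sgn4 ic_ib mul1r.
Qed.

Lemma c_commute m n v : m + n != 0 -> c m (c n v) = c n (c m v).
Proof. by move=> mn; rewrite c_comm (negPf mn) scale0r addr0. Qed.

Lemma craise_linear s m : linear (craise s m).
Proof. by apply: linear_scale; exact: fosc_linear. Qed.

Lemma clower_linear s m : linear (clower s m).
Proof. by apply: linear_scale; exact: fosc_linear. Qed.

Let cZ n a v : c n (a *: v) = a *: c n v.
Proof. exact: (linZ _ _ (@fosc_linear _ _ _ _ _)). Qed.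

Lemma craise_comm s m n v : craise s m (craise s n v) =
  craise s n (craise s m v).
Proof.
rewrite /craise !cZ !scalerA mulrC; congr (_ *: _).
have [/eqP|] := boolP (- m%:Z + - n%:Z == 0 :> int); last exact: c_commute.
rewrite -opprD => /eqP; rewrite oppr_eq0 -PoszD => /eqP[] /eqP.
by rewrite addn_eq0 => /andP[/eqP-> /eqP->].
Qed.

Lemma clower_comm s m n v : clower s m (clower s n v) =
  clower s n (clower s m v).
Proof.
rewrite /clower !cZ !scalerA mulrC; congr (_ *: _).
have [/eqP[] /eqP|] := boolP (m%:Z + n%:Z == 0 :> int); last exact: c_commute.
by rewrite addn_eq0 => /andP[/eqP-> /eqP->].
Qed.

Lemma c_craise s (n m : nat) v : (0 < n)%N ->
  c n (craise s m v) = craise s m (c n v) +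
    (if m == n then s%:~R * kappa n else 0) *: v.
Proof.
case: n => // n _; rewrite /craise cZ c_comm scalerDr scalerA;
  congr (_ + _ *: _).
rewrite subr_eq0 andbT eqz_nat eq_sym; case: eqP => [->|_];
  last by rewrite mulr0.
rewrite /kappa; move: (qint q n.+1) (qint_neq0 n) => x x0.
by rewrite expr2 -!mulrA mulKf.
Qed.

Lemma c_clower s (n m : nat) v : (0 < n)%N ->
  c (- n%:Z) (clower s m v) = clower s m (c (- n%:Z) v) +
    (if m == n then s%:~R * kappa n else 0) *: v.
Proof.
case: n => // n _; rewrite /clower cZ c_comm scalerDr scalerA;
  congr (_ + _ *: _).
rewrite addrC subr_eq0 oppr_eq0 andbT eqz_nat; case: eqP => [->|_];
  last by rewrite mulr0.
rewrite /kappa qintN sqrrN mulrNz invrN;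
  move: (qint q n.+1) (qint_neq0 n) => x x0.
by rewrite mulrN mulNr mulNr mulrN opprK expr2 -!mulrA mulKf.
Qed.

Lemma c_clower_comm s (n m : nat) v : c n (clower s m v) = clower s m (c n v).
Proof.
rewrite /clower cZ; congr (_ *: _).
have [/eqP[] /eqP|] := boolP (n%:Z + m%:Z == 0 :> int); last exact: c_commute.
by rewrite addn_eq0 => /andP[/eqP-> /eqP->].
Qed.

Lemma c_craise_comm s (n m : nat) v :
  c (- n%:Z) (craise s m v) = craise s m (c (- n%:Z) v).
Proof.
rewrite /craise cZ; congr (_ *: _).
have [/eqP|] := boolP (- n%:Z + - m%:Z == 0 :> int); last exact: c_commute.
rewrite -opprD => /eqP; rewrite oppr_eq0 -PoszD => /eqP[] /eqP.
by rewrite addn_eq0 => /andP[/eqP-> /eqP->].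
Qed.

Local Notation S s := (expser (craise s)).
Local Notation T s := (expser (clower s)).

Lemma S_linear s k : linear (S s k).
Proof. by apply: expser_lin; exact: craise_linear. Qed.

Lemma T_linear s k : linear (T s k).
Proof. by apply: expser_lin; exact: clower_linear. Qed.

Lemma vterm_linear s e kj : linear (vterm s e kj).
Proof.
apply: linear_comp; first exact: fexpQ_linear.
apply: linear_comp; first exact: S_linear.
by apply: linear_comp; [exact: T_linear|exact: fchproj_linear].
Qed.

Lemma S_hdeg s k l w z v : (forall m, w (ic, m) = m.+1) ->
  vsupp (hdeg l w z) v -> vsupp (hdeg l w (z + k%:Z)) (S s k v).
Proof.
move=> wc vz; rewrite -[k%:Z]mul1r.
apply: (@expser_graded _ _ _ 1 (hdeg l w)) => //; first exact: craise_linear.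
  exact: craise_comm.
move=> m y u uy; by apply: vsuppZ;
  have := @fosc_hdeg_neg _ _ q ic m _ _ _ _ uy; rewrite mul1r wc NegzE.
Qed.

Lemma T_hdeg s k l w z v : (forall m, w (ic, m) = m.+1) ->
  vsupp (hdeg l w z) v -> vsupp (hdeg l w (z - k%:Z)) (T s k v).
Proof.
move=> wc vz; rewrite -[- k%:Z]mulN1r.
apply: (@expser_graded _ _ _ (-1) (hdeg l w)) => //; first exact: clower_linear.
  exact: clower_comm.
move=> m y u uy; by apply: vsuppZ;
  have := @fosc_hdeg_pos _ _ q ic m _ _ _ _ uy; rewrite mulN1r wc.
Qed.

(** A term survives only if s mu + k - j = e, so every surviving term changes the degree by the same
    amount k - j = e - s mu. *)
Lemma vterm_hdeg s e kj l w z mu v : s * s = 1 -> (forall m, w (ic,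
  m) = m.+1) ->
  l ic = mu%:~R -> vsupp (hdeg l w z) v ->
  vsupp (hdeg (l + flam4 0 0 0 s%:~R) w (z + (e - s * mu))) (vterm s e kj v).
Proof.
move=> ss wc lmu vz; rewrite /vterm (fchproj_hdeg _ vz) lmu.
case: eqP => [/intr_inj E|_]; last first.
  by rewrite (lin0 (T_linear _ _)) (lin0 (S_linear _ _)) (lin0 (@fexpQ_linear _
    _ _)); exact: vsupp0.
apply: fexpQ_hdeg.
have -> : z + (e - s * mu) = z - kj.2%:Z + kj.1%:Z.
  by rewrite E mulrA ss mul1r; ring.
by apply: S_hdeg => //; apply: T_hdeg.
Qed.

Definition cweight (x : 'I_4 * nat) : nat := if x.1 == ic then x.2.+1 else 0.

Lemma cweightE m : cweight (ic, m) = m.+1.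
Proof. by rewrite /cweight eqxx. Qed.

(** On a basis state, j is at most the c-degree, and an integral charge then determines k from j. A
    non-integral charge leaves no term at all. *)
Lemma vterm_finite s e v : s * s = 1 ->
  exists N, forall k j, (N <= k)%N || (N <= j)%N -> vterm s e (k, j) v = 0.
Proof.
move=> ss; elim/fm_ind: v => [|a u v [N1 H1] [N2 H2]|st].
- by exists 0%N => k j _; exact: (lin0 (vterm_linear _ _ _)).
- exists (maxn N1 N2) => k j kj.
  by rewrite vterm_linear H1 ?H2 ?scaler0 ?addr0 //; lia.
have vs : vsupp (hdeg st.1 cweight (wdeg cweight st.2)%:Z) (bas st : B) by
  exact: vsupp_bas.
pose d := wdeg cweight st.2.
have Tk k j : (d < j)%N -> vterm s e (k, j) (bas st) = 0.
  move=> dj; rewrite /vterm (fchproj_hdeg _ vs); case: ifP => _; last first.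
    by rewrite (lin0 (T_linear _ _)) (lin0 (S_linear _ _)) (lin0 (@fexpQ_linear
      _ _ _)).
  rewrite (@hdeg_lt0 _ _ _ _ _ (T s j (bas st)) _ (@T_hdeg s j _ _ _ _ cweightE
    vs)); last by lia.
  by rewrite (lin0 (S_linear _ _)) (lin0 (@fexpQ_linear _ _ _)).
have V0 k j : st.1 ic != (s * (e - k%:Z + j%:Z))%:~R -> vterm s e (k,
  j) (bas st) = 0.
  move=> ne; rewrite /vterm (fchproj_hdeg _ vs) (negPf ne).
  by rewrite (lin0 (T_linear _ _)) (lin0 (S_linear _ _)) (lin0 (@fexpQ_linear _
    _ _)).
have [[mu muE]|nmu] := pselect (exists mu : int, st.1 ic = mu%:~R); last first.
  exists 0%N => k j _; apply: V0; apply/eqP => E; apply: nmu; by eexists;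
    exact: E.
exists (d + absz e + absz (s * mu)%R).+1 => k j kj.
have [dj|dj] := ltnP d j; first exact: Tk.
apply: V0; rewrite muE; apply/eqP => /intr_inj E.
have : s * mu = e - k%:Z + j%:Z by rewrite E mulrA ss mul1r.
move: kj; rewrite leqNgt; lia.
Qed.

(** The two bounds are independent because a commutator with c_n shifts only one of the two
    summation indices. *)
Lemma vop_sum s e v : s * s = 1 -> exists N, forall M1 M2,
  (N <= M1)%N -> (N <= M2)%N ->
  vop s e v = \sum_(k < M1) \sum_(j < M2) vterm s e (k : nat, j : nat) v.
Proof.
move=> ss; have [N HN] := vterm_finite e v ss; exists N => M1 M2 NM1 NM2.
rewrite /vop (fsbigE [seq (k, j) | k <- iota 0 M1, j <- iota 0 M2]) //.
- rewrite big_mkcond (eq_bigr (fun kj => vterm s e kj v)); last first.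
    by move=> kj _; rewrite ifT // in_setE.
  have iotaE M (F : nat -> B) : \sum_(i <- iota 0 M) F i = \sum_(i < M) F i.
    by rewrite -(big_mkord xpredT) /index_iota subn0.
  by rewrite big_allpairs iotaE; apply: eq_bigr => k _; rewrite iotaE.
- by apply: allpairs_uniq => [||[? ?] [? ?]] //; exact: iota_uniq.
move=> [k j] _ kj; apply: HN; move: kj; apply: contraR;
  rewrite negb_or -!ltnNge => /andP[k1 j1].
by apply/allpairsP; exists (k, j); rewrite !mem_iota /=; split => //; lia.
Qed.

Lemma vop_linear s e : s * s = 1 -> linear (vop s e).
Proof.
move=> ss a u v; have [N1 H1] := vop_sum e u ss; have [N2 H2] := vop_sum e v ss.
have [N3 H3] := vop_sum e (a *: u + v) ss; pose M := (N1 + N2 + N3)%N.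
rewrite (H1 M M) ?(H2 M M) ?(H3 M M); try by rewrite /M; lia.
rewrite scaler_sumr -big_split; apply: eq_bigr => k _ /=.
rewrite scaler_sumr -big_split; apply: eq_bigr => j _ /=.
exact: vterm_linear.
Qed.

Lemma vop_single s e kj v : s * s = 1 ->
  (forall kj', kj' != kj -> vterm s e kj' v = 0) -> vop s e v = vterm s e kj v.
Proof.
move=> ss H; rewrite /vop (fsbigE [:: kj]) //.
  by rewrite big_cons big_nil ifT ?in_setE //; exact: addr0.
by move=> kj' _; rewrite inE => /H.
Qed.

Lemma vop_hdeg s e l w z mu v : s * s = 1 -> (forall m, w (ic, m) = m.+1) ->
  l ic = mu%:~R -> vsupp (hdeg l w z) v ->
  vsupp (hdeg (l + flam4 0 0 0 s%:~R) w (z + (e - s * mu))) (vop s e v).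
Proof.
move=> ss wc lmu vz; have [N HN] := vop_sum e v ss; rewrite (HN N N) //.
by apply: vsupp_sum => k _; apply: vsupp_sum => j _; exact: vterm_hdeg.
Qed.

Lemma vop_comm (D : B -> B) s e v : s * s = 1 -> linear D ->
  (forall n u, n != 0 -> D (c n u) = c n (D u)) ->
  (forall mu u, D (fchproj mu u) = fchproj mu (D u)) ->
  (forall u, D (fexpQ (flam4 0 0 0 s%:~R) u) =
    fexpQ (flam4 0 0 0 s%:~R) (D u)) ->
  D (vop s e v) = vop s e (D v).
Proof.
move=> ss lD Dc DP DQ.
have [N1 H1] := vop_sum e v ss; have [N2 H2] := vop_sum e (D v) ss.
pose M := (N1 + N2)%N.
rewrite (H1 M M) ?leq_addr // (H2 M M) ?leq_addl //.
rewrite (lin_sum _ _ _ lD); apply: eq_bigr => k _.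
rewrite (lin_sum _ _ _ lD); apply: eq_bigr => j _.
rewrite /vterm DQ (expser_comm (craise_linear s) (@craise_comm s) _ _ lD);
  last first.
  by case=> // m u _; rewrite /craise (linZ _ _ lD) Dc.
rewrite (expser_comm (clower_linear s) (@clower_comm s) _ _ lD) ?DP //.
by case=> // m u _; rewrite /clower (linZ _ _ lD) Dc.
Qed.

Lemma sum_shift (F : nat -> B) (n M : nat) :
  \sum_(k < n + M) (if (n <= k)%N then F (k - n)%N else 0) = \sum_(k < M) F k.
Proof.
rewrite big_split_ord /= big1 ?add0r; last by move=> i _;
  rewrite leqNgt ltn_ord.
by apply: eq_bigr => i _; rewrite leq_addr addKn.
Qed.

Let QZ mu a v : fexpQ mu (a *: v) = a *: fexpQ mu v.
Proof. exact: (linZ _ _ (@fexpQ_linear C B mu)). Qed.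
Let Q0 mu : fexpQ mu (0 : B) = 0.
Proof. exact: (lin0 (@fexpQ_linear C B mu)). Qed.
Let QD mu : {morph (@fexpQ C B mu) : u v / u + v}.
Proof. exact: (linD (@fexpQ_linear C B mu)). Qed.

(** For n > 0 only the creation exponential fails to commute with c_n. Lowering its degree k by n
    amounts to replacing e by e - n. *)
Lemma c_vop_pos s e (n : nat) v : s * s = 1 -> (0 < n)%N ->
  c n (vop s e v) = vop s e (c n v) + (s%:~R * kappa n) *: vop s (e - n%:Z) v.
Proof.
move=> ss n0; have [N1 H1] := vop_sum e v ss;
  have [N2 H2] := vop_sum e (c n v) ss.
have [N3 H3] := vop_sum (e - n%:Z) v ss; pose M := (N1 + N2 + N3)%N.
rewrite (H1 (n + M)%N M) ?(H2 (n + M)%N M) ?(H3 M M); try by rewrite /M; lia.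
rewrite (lin_sum _ _ _ (@fosc_linear _ _ _ _ _)).
rewrite -(sum_shift (fun k =>
  \sum_(j < M) vterm s (e - n%:Z) (k, j : nat) v) n M).
rewrite scaler_sumr -big_split; apply: eq_bigr => k _ /=.
rewrite (lin_sum _ _ _ (@fosc_linear _ _ _ _ _)).
have -> : (s%:~R * kappa n) *: (if (n <= k)%N then
     \sum_(j < M) vterm s (e - n%:Z) ((k - n)%N, j : nat) v else 0) =
   \sum_(j < M) if (n <= k)%N then (s%:~R * kappa n) *:
     vterm s (e - n%:Z) ((k - n)%N, j : nat) v else 0.
  by case: ifP => _; rewrite ?scaler_sumr // scaler0 big1.
rewrite -big_split; apply: eq_bigr => j _ /=.
rewrite /vterm fosc_fexpQ; last by rewrite -lt0n.
rewrite (expser_derivation (craise_linear s) (@craise_comm s) _ _ (@fosc_linear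
  _ _ _ _ _) n0
  (fun m w _ => c_craise s m w n0)).
rewrite (expser_comm (clower_linear s) (@clower_comm s) _ _ (@fosc_linear _ _ _
  _ _)); last first.
  by move=> m w _; exact: c_clower_comm.
rewrite fosc_fchproj QD; congr (_ + _); case: ifP => nk; last by rewrite Q0.
rewrite QZ; congr (_ *: fexpQ _ (S s _ (T s _ (fchproj (_ * _) _)))).
by move: nk => /= nk; rewrite -{1}(subnK nk) PoszD; ring.
Qed.

Lemma c_vop_neg s e (n : nat) v : s * s = 1 -> (0 < n)%N ->
  c (- n%:Z) (vop s e v) =
  vop s e (c (- n%:Z) v) + (s%:~R * kappa n) *: vop s (e + n%:Z) v.
Proof.
move=> ss n0; have [N1 H1] := vop_sum e v ss;
  have [N2 H2] := vop_sum e (c (- n%:Z) v) ss.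
have [N3 H3] := vop_sum (e + n%:Z) v ss; pose M := (N1 + N2 + N3)%N.
rewrite (H1 M (n + M)%N) ?(H2 M (n + M)%N) ?(H3 M M); try by rewrite /M; lia.
rewrite (lin_sum _ _ _ (@fosc_linear _ _ _ _ _)) scaler_sumr -big_split.
apply: eq_bigr => k _ /=.
rewrite (lin_sum _ _ _ (@fosc_linear _ _ _ _ _)).
rewrite -(sum_shift (fun j =>
  vterm s (e + n%:Z) (k : nat, j) v) n M) scaler_sumr.
rewrite -big_split; apply: eq_bigr => j _ /=.
rewrite /vterm fosc_fexpQ; last by rewrite oppr_eq0 -lt0n.
rewrite (expser_comm (craise_linear s) (@craise_comm s) _ _ (@fosc_linear _ _ _
  _ _)); last first.
  by move=> m w _; exact: c_craise_comm.
rewrite (expser_derivation (clower_linear s) (@clower_comm s) _ _ (@fosc_linear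
  _ _ _ _ _) n0
  (fun m w _ => c_clower s m w n0)).
rewrite fosc_fchproj (linD (S_linear _ _)) QD; congr (_ + _); case: ifP => nj;
  last first.
  by rewrite (lin0 (S_linear _ _)) Q0 scaler0.
rewrite (linZ _ _ (S_linear _ _)) QZ.
congr (_ *: fexpQ _ (S s _ (T s _ (fchproj (_ * _) _)))).
by move: nj => /= nj; rewrite -{1}(subnK nj) PoszD; ring.
Qed.

(** Coefficientwise, the commutator of c_n with :e^(s c(z;0)): is s ([n] / n) z^n :e^(s c(z;0)):. *)
Lemma c_vop s e (n : int) v : s * s = 1 -> n != 0 ->
  c n (vop s e v) = vop s e (c n v) + (s%:~R * kappa n) *: vop s (e - n) v.
Proof.
case: n => [[//|n]|n] ss _; first exact: c_vop_pos.
by rewrite NegzE c_vop_neg // kappaN opprK.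
Qed.

(** [eta_] m and [xi_] n have the exponents e = - m - 1 and e' = - n, so that the scalar 1 expected
    for m + n = 0 belongs to e + e' = -1. *)
Definition anticomm (s s' e e' : int) (v : B) : B :=
  vop s e (vop s' e' v) + vop s' e' (vop s e v)
  - (if (s' == - s) && (e + e' == -1) then v else 0).

Lemma anticomm_linear s s' e e' : s * s = 1 -> s' * s' = 1 ->
  linear (anticomm s s' e e').
Proof.
move=> ss ss'; apply: linear_sub; last first.
  by case: (_ && _); [exact: linear_id|exact: linear_zero].
by apply: linear_add; apply: linear_comp; exact: vop_linear.
Qed.

(** The scalar terms of the two shifted defects carry the factors s [kappa] n and s' [kappa] n; they
    are present only for s' = - s and then cancel. *)
Lemma c_anticomm s s' e e' n v : s * s = 1 -> s' * s' = 1 -> n != 0 ->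
  c n (anticomm s s' e e' v) = anticomm s s' e e' (c n v) +
  (s%:~R * kappa n) *: anticomm s s' (e - n) e' v +
  (s'%:~R * kappa n) *: anticomm s s' e (e' - n) v.
Proof.
move=> ss ss' n0; rewrite /anticomm.
rewrite (linB (@fosc_linear _ _ _ _ _)) (linD (@fosc_linear _ _ _ _ _)).
rewrite !c_vop // !(linD (vop_linear _ ss)) !(linD (vop_linear _ ss')).
rewrite !(linZ _ _ (vop_linear _ ss)) !(linZ _ _ (vop_linear _ ss')).
rewrite (fun_if (c n)) (lin0 (@fosc_linear _ _ _ _ _)) (addrA e e' (- n)) [e -
  n + e']addrAC.
set a := s%:~R * _; set b := s'%:~R * _.
have E : a *: (if (s' == - s) && (e + e' - n == -1) then v else 0) +
         b *: (if (s' == - s) && (e + e' - n == -1) then v else 0) = 0.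
  rewrite -scalerDl /a /b; case: ifP => [/andP[/eqP-> _]|_];
    last by rewrite scaler0.
  by rewrite mulrNz mulNr subrr scale0r.
apply: coef_ext => t; move/(congr1 (coef t)): E.
rewrite fcoef0 !(fcoefD, fcoefN, fcoefZ) => E.
by apply/eqP; rewrite -subr_eq0; apply/eqP; rewrite -[RHS]E; ring.
Qed.

Lemma fexpQ_comp mu mu' v : fexpQ mu (fexpQ mu' v) = fexpQ (mu' + mu) v.
Proof.
apply: (@fm_ext _ _ _ (fun v => fexpQ mu (fexpQ mu' v)) (fexpQ (mu' + mu))) =>
  [||t].
- by apply: linear_comp; exact: fexpQ_linear.
- exact: fexpQ_linear.
- by rewrite !fexpQ_bas addrA.
Qed.

Lemma fexpQ0 v : fexpQ 0 v = v.
Proof.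
apply: (@fm_ext _ _ _ (fexpQ 0) id); [exact: fexpQ_linear|exact: linear_id|].
by case=> l k; rewrite fexpQ_bas addr0.
Qed.

(* Coefficient of w^D in exp (- s s' sum_(j >= 1) w^j / j) for signs s, s'. *)
Definition pairing (s s' : int) (D : nat) : C :=
  if s == s' then (D == 0%N)%:R - (D == 1%N)%:R else 1.

(** The series f = (1 - w)^(s s') satisfies w f' = - s s' (w / (1 - w)) f, and the coefficients of
    (w / (1 - w)) f are the partial sums of those of f. *)
Lemma sum_pairing s s' D : s * s = 1 -> s' * s' = 1 ->
  \sum_(i < D) pairing s s' i = - (s * s')%:~R * D%:R * pairing s s' D.
Proof.
move=> ss ss'; rewrite /pairing; case: eqP => [->|ne]; last first.
  have -> : s * s' = -1.
    have : (s - s') * (s + s') =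
      0 by rewrite mulrBl !mulrDr ss ss' [s' * s]mulrC; ring.
    move/eqP; rewrite mulf_eq0 subr_eq0 => /orP[/eqP//|];
      rewrite addr_eq0 => /eqP->.
    by rewrite mulNr ss'.
  by rewrite mulrNz opprK mul1r mulr1 sumr_const card_ord.
rewrite ss'; case: D => [|[|D]]; first by rewrite big_ord0 mulr0 mul0r.
  by rewrite big_ord_recl big_ord0 /= subr0 addr0 sub0r mulr1 mulrNN mulr1.
rewrite !big_ord_recl big1 => [|i _]; last by rewrite /= subr0.
by rewrite /= subr0 sub0r addr0 subrr subr0 mulr0.
Qed.

Lemma clower_S s s' (m D : nat) v : (0 < m)%N -> c m v = 0 ->
  clower s m (S s' D v) =
  if (m <= D)%N then (- (s * s')%:~R / m%:R) *: S s' (D - m) v else 0.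
Proof.
case: m => // m _ cv; rewrite /clower.
rewrite (expser_derivation (craise_linear s') (@craise_comm s') _ _
  (@fosc_linear _ _ _ _ _) (ltn0Sn m)
  (fun m' w _ => c_craise s' m' w (ltn0Sn m))).
rewrite cv (lin0 (S_linear _ _)) add0r; case: ifP => mD;
  last by rewrite scaler0.
rewrite scalerA; congr (_ *: _); rewrite /kappa intrM.
move: (qint q m.+1) (qint_neq0 m) => x x0.
by field; rewrite nat1r pnatr_eq0 x0.
Qed.

(** The case of equal degrees in exp A exp B = exp [A, B] exp B exp A, on a vector killed by the
    annihilation operators. The recurrence of [expser_deriv] in D becomes that of [sum_pairing]. *)
Lemma T_S s s' D v : s * s = 1 -> s' * s' = 1 ->
  (forall m, c m.+1 v = 0) -> T s D (S s' D v) = pairing s s' D *: v.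
Proof.
move=> ss ss' cv; have [n Dn] := ubnP D; elim: n D Dn => // n IH [|D] Dn.
  rewrite !expser0 /pairing; case: ifP => _; last by rewrite scale1r.
  by rewrite subr0 scale1r.
apply: (@natscaleI _ _ D.+1); first by [].
rewrite (expser_deriv (clower_linear s) (@clower_comm s)).
rewrite (eq_bigr (fun i : 'I_D.+1 =>
  (- (s * s')%:~R) *: (pairing s s' (D - i)%N *: v))).
  rewrite -scaler_sumr -scaler_suml (reindex_inj rev_ord_inj) /=.
  rewrite (eq_bigr (fun i : 'I_D.+1 => pairing s s' i)); last first.
    by move=> i _; rewrite subSS subKn // -ltnS.
  rewrite (sum_pairing D.+1 ss ss') !scalerA; congr (_ *: _).
  rewrite !mulrA mulrNN -intrM [s * s' * _]mulrACA ss ss' mulr1.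
  by rewrite [X in X * _]mul1r.
move=> i _; rewrite (expser_comm (clower_linear s) (@clower_comm s) _ _
  (clower_linear s i.+1)); last first.
  by move=> m w _; exact: clower_comm.
rewrite clower_S // ifT ?subSS // (linZ _ _ (T_linear _ _)) scalerA IH;
  last by lia.
by congr (_ *: _); field; rewrite nat1r pnatr_eq0.
Qed.

(** Without c-excitations only j = 0 survives, and the charge then forces k = D. *)
Lemma vop_cfree s e (D : nat) l mu v : s * s = 1 -> l ic = mu%:~R ->
  e - s * mu = D -> vsupp (hdeg l cweight 0) v ->
  vop s e v = fexpQ (flam4 0 0 0 s%:~R) (S s D v).
Proof.
move=> ss lmu De vl; rewrite (@vop_single _ _ (D, 0%N)) //.
  rewrite /vterm /= expser0 (fchproj_hdeg _ vl) lmu ifT // -De.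
  by apply/eqP; congr (_%:~R); rewrite addr0 opprB addrC subrK mulrA ss mul1r.
move=> [k [|j]] kj; rewrite /vterm /=; last first.
  rewrite (@hdeg_lt0 _ _ _ _ _ (T s j.+1 _) _ (@T_hdeg s j.+1 l _ 0 _ cweightE
    _)) //.
    by rewrite (lin0 (S_linear _ _)) Q0.
  rewrite (fchproj_hdeg _ vl); case: ifP => // _; exact: vsupp0.
rewrite expser0 (fchproj_hdeg _ vl) lmu ifF ?(lin0 (S_linear _ _)) ?Q0 //.
apply/negbTE; move: kj; apply: contra => /eqP/intr_inj E.
have {}E : s * mu = e - k%:Z by rewrite E mulrA ss mul1r addr0.
by rewrite xpair_eqE andbT -eqz_nat -De E opprB addrC subrK.
Qed.

(** The charge forces j = D + k, and more than D annihilations kill a vector of c-degree D; so k = 0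
    and j = D. *)
Lemma vop_bottom s e (D : nat) l mu v : s * s = 1 -> l ic = mu%:~R ->
  e - s * mu = - D%:Z -> vsupp (hdeg l cweight D) v ->
  vop s e v = fexpQ (flam4 0 0 0 s%:~R) (T s D v).
Proof.
move=> ss lmu De vl; rewrite (@vop_single _ _ (0%N, D)) //.
  rewrite /vterm /= expser0 (fchproj_hdeg _ vl) lmu ifT //.
  apply/eqP; congr (_%:~R); have -> : e = s * mu - D%:Z by rewrite -De; ring.
  by rewrite subr0 subrK mulrA ss mul1r.
move=> [k j] kj; rewrite /vterm /= (fchproj_hdeg _ vl) lmu.
case: eqP => [/intr_inj E|_]; last first.
  by rewrite (lin0 (T_linear _ _)) (lin0 (S_linear _ _)) Q0.
have {}E : s * mu = e - k%:Z + j%:Z by rewrite E mulrA ss mul1r.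
rewrite (@hdeg_lt0 _ _ _ _ _ (T s j _) _ (@T_hdeg s j l _ _ _ cweightE vl)).
  by rewrite (lin0 (S_linear _ _)) Q0.
move: kj; rewrite xpair_eqE; lia.
Qed.

Lemma sgn4_neq0 i : sgn4 C i != 0.
Proof. by rewrite /sgn4; case: ifP; rewrite ?oppr_eq0 oner_eq0. Qed.

(** In nonzero c-degree every state has an occupied mode (ic, m), and its coefficient in v is, up to
    a nonzero factor, a coefficient of c_(m+1) v. *)
Lemma c_killed l z v : (forall m, c m.+1 v = 0) -> z != 0 ->
  vsupp (hdeg l cweight z) v -> v = 0.
Proof.
move=> cv z0 vz; apply: coef_ext => -[l' k]; rewrite fcoef0.
have [[_ kz]|] := pselect (hdeg l cweight z (l', k)); last exact: vz.
have [|[i m]] := @wdeg_neq0 cweight k; first by rewrite -eqz_nat kz.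
rewrite /cweight muln_gt0 /= => /andP[]; case: eqP => // -> _ k0.
have := coef_fosc_pos q ic m l' (set_occ k (ic, m) (k (ic, m)).-1) v.
rewrite cv fcoef0 set_occ_predK // => /esym/eqP.
have a0 n : sgn4 C ic * (qint q m.+1 ^+ 2 / m.+1%:R) * n.+1%:R != 0.
  apply: mulf_neq0; last by rewrite pnatr_eq0.
  apply: (mulf_neq0 (sgn4_neq0 _)); apply: mulf_neq0; first exact: expf_neq0.
  by rewrite invr_neq0 // pnatr_eq0.
by rewrite mulf_eq0 (negPf (a0 _)) => /eqP.
Qed.

Lemma c_cfree l m v : vsupp (hdeg l cweight 0) v -> c m.+1 v = 0.
Proof.
by move=> /(@fosc_hdeg_pos _ _ q ic m) /hdeg_lt0; apply; rewrite cweightE.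
Qed.

Lemma flam_ic (s : int) : flam4 0 0 0 s%:~R ic = s%:~R.
Proof. by rewrite ffunE /ic inordK. Qed.

Lemma flamN (s : int) : flam4 0 0 0 (- s)%:~R = - flam4 0 0 0 s%:~R.
Proof.
apply/ffunP => -[[|[|[|[|//]]]] i4]; rewrite !ffunE /= ?oppr0 //.
by rewrite mulrNz.
Qed.

(* The hypothesis on [e + e'] says that the product preserves the c-degree. *)
Lemma vop_vop_bottom s s' e e' l mu v : s * s = 1 -> s' * s' = 1 ->
  l ic = mu%:~R -> vsupp (hdeg l cweight 0) v ->
  e + e' = s * s' + (s + s') * mu :> int ->
  vop s e (vop s' e' v) =
  (if e' - s' * mu is Posz D then pairing s s' D else 0) *:
    fexpQ (flam4 0 0 0 s%:~R + flam4 0 0 0 s'%:~R) v.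
Proof.
move=> ss ss' lmu vl z0.
have v'l := @vop_hdeg s' e' _ _ _ _ _ ss' cweightE lmu vl.
(* This difference is the c-degree of the intermediate vector, which vanishes if the degree is
   negative. *)
case De: (e' - s' * mu) v'l => [D|D]; last first.
  move=> /hdeg_lt0 -> //; first by rewrite (lin0 (vop_linear _ ss)) scale0r.
rewrite add0r => v'l.
have l'mu : (l + flam4 0 0 0 s'%:~R) ic = (mu + s')%:~R.
  by rewrite ffunE lmu flam_ic intrD.
rewrite (@vop_bottom s e D _ _ _ ss l'mu) //; last first.
  by rewrite -De; apply/eqP; rewrite -subr_eq0; apply/eqP; move: z0;
    rewrite -[RHS]subr0; lia.
rewrite (vop_cfree ss' lmu De vl).
rewrite -(expser_comm (clower_linear s) (@clower_comm s) _ _ (@fexpQ_linear _ _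
  _)); last first.
  by move=> m w m0; rewrite /clower QZ fosc_fexpQ // -lt0n.
rewrite T_S //; last by move=> m; exact: c_cfree vl.
by rewrite !QZ fexpQ_comp addrC.
Qed.

(* Induction on the c-degree of the result: by [c_anticomm] it is killed by all
   c_n with n > 0, hence vanishes unless its c-degree is zero. *)
Lemma anticomm_cfree s s' e e' l mu v : s * s = 1 -> s' * s' = 1 ->
  l ic = mu%:~R -> vsupp (hdeg l cweight 0) v -> anticomm s s' e e' v = 0.
Proof.
move=> ss ss' lmu vl.
(* The c-degree of both products: one factor adds e' - s' mu, the other, acting on charge mu + s',
   adds e - s (mu + s'). *)
pose z (e e' : int) := e + e' - s * s' - (s + s') * mu.
pose l' := l + flam4 0 0 0 s%:~R + flam4 0 0 0 s'%:~R.
have az e1 e2 : vsupp (hdeg l' cweight (z e1 e2)) (anticomm s s' e1 e2 v).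
  rewrite /anticomm -scaleN1r; apply: vsuppD; first apply: vsuppD.
  - have := @vop_hdeg s e1 _ _ _ (mu + s') _ ss cweightE _ (@vop_hdeg s' e2 _ _
    _ _ _ ss' cweightE lmu vl).
    rewrite ffunE lmu flam_ic intrD => /(_ erefl).
    rewrite addrAC -/l'; congr (vsupp (hdeg _ _ _) _).
    by rewrite /z; ring.
  - have := @vop_hdeg s' e2 _ _ _ (mu + s) _ ss' cweightE _ (@vop_hdeg s e1 _ _
    _ _ _ ss cweightE lmu vl).
    rewrite ffunE lmu flam_ic intrD => /(_ erefl).
    rewrite -/l'; congr (vsupp (hdeg _ _ _) _).
    by rewrite /z; ring.
  apply: vsuppZ; case: ifP => [/andP[/eqP s'E /eqP eE]|_]; last exact: vsupp0.
  move: vl; congr (vsupp (hdeg _ _ _) _); first by rewrite /l' s'E flamN addrK.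
  by rewrite /z eE s'E mulrN ss; ring.
have step e1 e2 : (forall m, anticomm s s' (e1 - m.+1%:Z) e2 v = 0) ->
    (forall m, anticomm s s' e1 (e2 - m.+1%:Z) v = 0) ->
    z e1 e2 != 0 -> anticomm s s' e1 e2 v = 0.
  move=> H1 H2 zn; apply: (c_killed _ zn (az e1 e2)) => m.
  rewrite c_anticomm // H1 H2 !scaler0 !addr0 (c_cfree _ vl).
  exact: (lin0 (anticomm_linear _ _ ss ss')).
suff : forall n e1 e2, z e1 e2 < n%:Z -> anticomm s s' e1 e2 v = 0.
  by move=> H; apply: (H (absz (z e e')).+1); move: (z e e') => y; lia.
elim=> [|n IH] e1 e2 zn; first exact: hdeg_lt0 zn (az _ _).
have zm1 m : z (e1 - m.+1%:Z) e2 < n by rewrite /z; move: zn; rewrite /z; lia.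
have zm2 m : z e1 (e2 - m.+1%:Z) < n by rewrite /z; move: zn; rewrite /z; lia.
have [z0|] := eqVneq (z e1 e2) 0; last first.
  by apply: step => m; exact: IH.
have e12 : e1 + e2 = s * s' + (s + s') * mu 
  by apply/eqP; rewrite -subr_eq0; apply/eqP; rewrite -[RHS]z0 /z; ring.
rewrite /anticomm (@vop_vop_bottom s s' e1 e2 l mu) // (@vop_vop_bottom s' s e2
  e1 l mu) //; last first.
  by rewrite addrC e12 [s' * s]mulrC [s' + s]addrC.
rewrite [flam4 _ _ _ s'%:~R + _]addrC -scalerDl.
(* For opposite signs, e1 - s mu and e2 - s' mu add up to -1: exactly one of them is nonnegative, so
   exactly one product survives, with pairing 1. *)
have [s'E|s'E] := eqVneq s' (- s).
  rewrite e12 s'E mulrN ss subrr mul0r addr0 eqxx /= flamN subrr fexpQ0.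
  apply/eqP; rewrite subr_eq0 -[X in _ == X]scale1r; apply/eqP; congr (_ *: _).
  have sN : (s == - s) = false.
    by apply/negbTE/eqP => sN; move: ss; lia.
  have e2E : e2 - - s * mu = -1 - (e1 - s * mu).
    by move: e12; rewrite s'E mulrN ss subrr mul0r addr0 => <-; ring.
  have p1 D : pairing s (- s) D = 1 by rewrite /pairing sN.
  have p2 D : pairing (- s) s D = 1 by rewrite /pairing eq_sym sN.
  rewrite e2E; case: (e1 - s * mu) => D.
    by rewrite (_ : -1 - D%:Z = Negz D) ?p2 ?add0r // NegzE; lia.
  by rewrite (_ : -1 - Negz D = Posz D) ?p1 ?addr0 // NegzE; lia.
(* For equal signs the two differences add up to 1. The pairing is then a coefficient of 1 - w, and
   the values 1 and -1 at 0 and 1 cancel. *)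
have s'E2 : s' = s.
  have : (s' - s) * (s' + s) =
    0 by rewrite mulrBl !mulrDr ss ss' [s' * s]mulrC; ring.
  move/eqP; rewrite mulf_eq0 subr_eq0 => /orP[/eqP//|].
  by rewrite addr_eq0 (negPf s'E).
rewrite /= subr0 -[RHS](scale0r (fexpQ (flam4 0 0 0 s%:~R + flam4 0 0 0 s'%:~R)
  v)).
congr (_ *: _); rewrite s'E2 /pairing eqxx.
have e2E : e2 - s * mu = 1 - (e1 - s * mu).
  by move: e12; rewrite s'E2 ss => /(canRL (addKr _)) ->; ring.
rewrite e2E; case: (e1 - s * mu) => [[|[|D]]|D].
- by rewrite (_ : 1 - Posz 0 = Posz 1) //= subr0 sub0r addNr.
- by rewrite (_ : 1 - Posz 1 = Posz 0) //= subr0 sub0r subrr.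
- by rewrite (_ : 1 - D.+2%:Z = Negz D) /= ?subr0 ?addr0 // NegzE; lia.
- by rewrite (_ : 1 - Negz D = Posz D.+2) /= ?subr0 ?addr0 // NegzE; lia.
Qed.

Definition int_charge (st : fstate C) : Prop :=
  exists mu : int, st.1 ic = mu%:~R.

(** On non-integral charges all modes vanish and the relation with scalar 1 fails; alpha in Z makes
    the charges - alpha + j + l integral. There [c_anticomm] strips off one creation operator at a
    time, shifting e and e', until [anticomm_cfree] applies. *)
Lemma anticomm_eq0 s s' e e' v : s * s = 1 -> s' * s' = 1 ->
  vsupp int_charge v -> anticomm s s' e e' v = 0.
Proof.
move=> ss ss'.
apply: (@lin_vsupp_eq _ _ int_charge _ (anticomm s s' e e') (fun _ => 0)).
- exact: anticomm_linear.
- exact: linear_zero.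
case=> l k [mu /= lmu]; have [n] := ubnP (wdeg cweight k).
elim: n k e e' => // n IH k e e' kn.
have [k0|] := eqVneq (wdeg cweight k) 0%N.
  by apply: (anticomm_cfree _ _ ss ss' lmu); apply: vsupp_bas; split;
    rewrite ?k0.
move=> /wdeg_neq0[[i m]]; rewrite muln_gt0 => /andP[im k0].
have iE : i = ic by move: im; rewrite /cweight /=; case: eqP.
rewrite iE in k0.
have -> : bas (l, k) = c (Negz m) (bas (l, set_occ k (ic, m) (k (ic,
  m)).-1)) :> B.
  by rewrite fosc_neg_bas /= set_occ_predK.
have kn' : (wdeg cweight (set_occ k (ic, m) (k (ic, m)).-1) < n)%N.
  by have := wdeg_pred cweight k0; rewrite cweightE; lia.
apply/(addIr (s%:~R * kappa (Negz m) *: anticomm s s' (e - Negz m) e'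
   (bas (l, set_occ k (ic, m) (k (ic, m)).-1)))).
apply/(addIr (s'%:~R * kappa (Negz m) *: anticomm s s' e (e' - Negz m)
   (bas (l, set_occ k (ic, m) (k (ic, m)).-1)))).
rewrite -c_anticomm // !IH // !scaler0 !addr0.
exact: (lin0 (@fosc_linear _ _ _ _ _)).
Qed.

End VertexOperators.

(** * Finite dimension, idempotents and traces *)

Section Dimension.
Variables (C : fieldType) (V : lmodType C).
Implicit Types (S : set V).

Definition lbasis S (n : nat) (e : 'I_n -> V) : Prop :=
  [/\ forall i, S (e i),
      forall v, S v -> exists x : 'I_n -> C, v = \sum_(i < n) x i *: e i
    & forall x : 'I_n -> C, \sum_(i < n) x i *: e i = 0 -> forall i, x i = 0].

Definition has_dim S n : Prop := exists e : 'I_n -> V, lbasis S e.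

Definition lsubspace S : Prop :=
  S 0 /\ forall (a : C) u v, S u -> S v -> S (a *: u + v).

Definition rcomb n (e : 'I_n -> V) (x : 'rV[C]_n) : V :=
  \sum_(i < n) x 0 i *: e i.

Lemma rcomb_linear n (e : 'I_n -> V) : linear (rcomb e).
Proof.
move=> a x y; rewrite /rcomb scaler_sumr -big_split; apply: eq_bigr => i _ /=.
by rewrite !mxE scalerDl scalerA.
Qed.

Lemma rcomb_eq0 S n (e : 'I_n -> V) x : lbasis S e -> rcomb e x = 0 -> x = 0.
Proof.
by move=> [_ _ e0] /e0 x0; apply/rowP => i; rewrite x0 mxE.
Qed.

Lemma rcomb_inj S n (e : 'I_n -> V) : lbasis S e -> injective (rcomb e).
Proof.
move=> be x y xy; apply/eqP; rewrite -subr_eq0; apply/eqP;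
  apply: (rcomb_eq0 be).
by rewrite (linB (rcomb_linear e)) xy subrr.
Qed.

Lemma rcomb_mul m n (e : 'I_n -> V) (A : 'M_(m, n)) x :
  rcomb e (x *m A) = rcomb (fun i => rcomb e (row i A)) x.
Proof.
rewrite mulmx_sum_row (lin_sum _ _ _ (rcomb_linear e)).
by apply: eq_bigr => i _; rewrite (linZ _ _ (rcomb_linear e)).
Qed.

Lemma rcomb_surj S n (e : 'I_n -> V) v : lbasis S e -> S v -> exists x,
  v = rcomb e x.
Proof.
move=> [_ eS _] /eS[x ->]; exists (\row_i x i).
by apply: eq_bigr => i _; rewrite mxE.
Qed.

Lemma lsub_sum S n (x : 'I_n -> C) (e : 'I_n -> V) : lsubspace S ->
  (forall i, S (e i)) -> S (\sum_(i < n) x i *: e i).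
Proof.
move=> [S0 SD] Se; apply: big_ind => [//|u v Su Sv|i _].
  by rewrite -[u]scale1r; exact: SD.
by rewrite -[_ *: _]addr0; exact: SD.
Qed.

Lemma lbasis_mx S n (e : 'I_n -> V) m (u : 'I_m -> V) : lbasis S e ->
  (forall i, S (u i)) -> exists A : 'M_(m, n), forall i,
    u i = rcomb e (row i A).
Proof.
move=> be Su; have [x xE] := choice (fun i => rcomb_surj be (Su i)).
by exists (\matrix_i x i) => i; rewrite rowK.
Qed.

(** The coordinate matrix of a free family of m vectors is row free, so its rank m is bounded by its
    n columns. *)
Lemma has_dim_le S n m : has_dim S n -> has_dim S m -> (m <= n)%N.
Proof.
move=> [e be] [u bu]; have [A AE] := lbasis_mx be (fun i => let: And3 h _ _ :=
  bu in h i).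
have Af : row_free A.
  rewrite -kermx_eq0; apply/eqP/row_matrixP => i; rewrite row0.
  apply: (rcomb_eq0 bu).
  rewrite (_ : rcomb u _ = rcomb e (row i (kermx A) *m A)); last first.
    by rewrite rcomb_mul; apply: eq_bigr => j _; rewrite AE.
  by rewrite -row_mul mulmx_ker row0 (lin0 (rcomb_linear e)).
by move: Af; rewrite /row_free => /eqP <-; exact: rank_leq_col.
Qed.

Lemma has_dim_unique S n m : has_dim S n -> has_dim S m -> n = m.
Proof. by move=> Sn Sm; apply/eqP;
  rewrite eqn_leq !(has_dim_le Sn Sm, has_dim_le Sm Sn). Qed.

Lemma has_dim0 S : (forall v, S v -> v = 0) -> has_dim S 0.
Proof.
move=> S0; exists (fun _ => 0); split=> [[]//|v /S0 ->|x _ []//].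
by exists (fun _ => 0); rewrite big_ord0.
Qed.

Lemma has_dim_image (V' : lmodType C) (f : V -> V') S n : linear f ->
  lsubspace S ->
  (forall v, S v -> f v = 0 -> v = 0) -> has_dim S n ->
  exists e : 'I_n -> V', [/\ forall i, (f @` S) (e i),
      forall v, (f @` S) v -> exists x : 'I_n -> C, v = \sum_(i < n) x i *: e i
    & forall x : 'I_n -> C, \sum_(i < n) x i *: e i = 0 -> forall i, x i = 0].
Proof.
move=> lf sS f0 [e [eS e1 e2]]; exists (fun i => f (e i)); split.
- by move=> i; exists (e i).
- move=> _ [v /e1[x ->] <-]; exists x; rewrite (lin_sum _ _ _ lf).
  by apply: eq_bigr => i _; rewrite (linZ _ _ lf).
- move=> x fx; apply: e2; apply: f0; first exact: lsub_sum.
  by rewrite (lin_sum _ _ _ lf) -[RHS]fx; apply: eq_bigr => i _;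
    rewrite (linZ _ _ lf).
Qed.

Lemma has_dim_rowspace S n (e : 'I_n -> V) (p : V -> V) (P : 'M[C]_n) :
  lsubspace S -> lbasis S e -> linear p -> (forall x,
    p (rcomb e x) = rcomb e (x *m P)) ->
  has_dim (p @` S) (\rank P).
Proof.
move=> sS be lp pP; have sub i : exists x, row i (row_base P) = x *m P.
  have /submxP[D DE] : (row_base P <= P)%MS by rewrite eq_row_base.
  by exists (row i D); rewrite -row_mul -DE.
have [x xE] := choice sub.
have Se y : S (rcomb e y).
  by apply: lsub_sum => // i; have [] := be.
exists (fun i => rcomb e (row i (row_base P))); split.
- move=> i; rewrite xE -pP; exists (rcomb e (x i)) => //.
- move=> _ [v /(rcomb_surj be)[y ->] <-]; rewrite pP.
  have /submxP[D DE] : (y *m P <= row_base P)%MS by rewrite eq_row_base submxMl.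
  exists (fun i => D 0 i); rewrite DE rcomb_mul.
  by apply: eq_bigr => i _.
- move=> y yE i.
  have : rcomb e ((\row_i y i) *m row_base P) = 0.
    by rewrite rcomb_mul -[RHS]yE; apply: eq_bigr => j _; rewrite mxE.
  move=> /(rcomb_eq0 be) /eqP; rewrite -[X in _ == X](mul0mx _ (row_base P)).
  by rewrite (inj_eq (row_free_inj (row_base_free _))) => /eqP/rowP/(_ i);
    rewrite !mxE.
Qed.

(** In coordinates p is an idempotent matrix P, and 1 - P has the kernel of P as its row space. *)
Lemma has_dim_split S n (p : V -> V) : lsubspace S -> linear p ->
  (forall v, S v -> S (p v)) -> (forall v,
    S v -> p (p v) = p v) -> has_dim S n ->
  exists k, [/\ (k <= n)%N, has_dim (p @` S) k &
                has_dim ((fun v => v - p v) @` S) (n - k)].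
Proof.
move=> sS lp pS pp [e be]; have Se i : S (e i) by have [] := be.
have [P PE] := lbasis_mx be (fun i => pS _ (Se i)).
have pP x : p (rcomb e x) = rcomb e (x *m P).
  rewrite rcomb_mul /rcomb (lin_sum _ _ _ lp); apply: eq_bigr => i _.
  by rewrite (linZ _ _ lp) PE.
have PP : P *m P = P.
  apply/row_matrixP => i; rewrite rowE [in RHS]rowE mulmxA;
    apply: (rcomb_inj be).
  by rewrite -!pP pp //; apply: lsub_sum.
have ker : (1%:M - P :=: kermx P)%MS.
  apply/eqmxP/andP; split.
    by rewrite sub_kermx mulmxBl mul1mx PP subrr.
  by apply/submxP; exists (kermx P); rewrite mulmxBr mulmx1 mulmx_ker subr0.
exists (\rank P); split; first exact: rank_leq_row.
  exact: has_dim_rowspace be lp pP.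
rewrite -mxrank_ker -ker; apply: has_dim_rowspace be _ _ => //.
  by apply: linear_sub => //; exact: linear_id.
by move=> x; rewrite pP mulmxBr mulmx1 (linB (rcomb_linear e)).
Qed.

Lemma lsubspace_image S (p : V -> V) : linear p -> lsubspace S ->
  lsubspace (p @` S).
Proof.
move=> lp [S0 SD]; split; first by exists 0 => //; exact: lin0 lp.
move=> a _ _ [u Su <-] [v Sv <-]; exists (a *: u + v); first exact: SD.
exact: lp.
Qed.

Definition ltrace S (f : V -> V) (t : C) : Prop :=
  exists n (e : 'I_n -> V) (M : 'M[C]_n),
    [/\ lbasis S e, forall i, f (e i) = \sum_(j < n) M i j *: e j
      & t = \tr M].

(** A scalar operator has the matrix c%:M in every basis. The uniqueness half determines the value
    that [xget] picks in a supercharacter. *)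
Lemma ltrace_scalar S n (f : V -> V) c t : has_dim S n ->
  (forall v, S v -> f v = c *: v) -> ltrace S f t <-> t = c * n%:R.
Proof.
move=> Sn fc; split=> [[m [e [M [be eM ->]]]]|->].
  have nm : n = m by apply: has_dim_unique Sn _; exists e.
  have Se i : S (e i) by have [] := be.
  have -> : M = c%:M.
    apply/row_matrixP => i; apply: (rcomb_inj be).
    transitivity (f (e i)); first by rewrite eM; apply: eq_bigr => j _;
      rewrite mxE.
    rewrite fc // /rcomb (bigD1 i) //= !mxE eqxx mulr1n big1 ?addr0 // => j ji.
    by rewrite !mxE eq_sym (negPf ji) mulr0n scale0r.
  by rewrite mxtrace_scalar nm mulr_natr.
have [e be] := Sn; have Se i : S (e i) by have [] := be.
exists n, e, c%:M; split=> // [i|]; last by rewrite mxtrace_scalar mulr_natr.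
rewrite fc // (bigD1 i) //= !mxE eqxx mulr1n big1 ?addr0 // => j ji.
by rewrite !mxE eq_sym (negPf ji) mulr0n scale0r.
Qed.

End Dimension.

Lemma sum_I4 (W : nmodType) (f : 'I_4 -> W) :
  \sum_(i < 4) f i = f ia1 + f ia2 + f ib + f ic.
Proof.
rewrite !big_ord_recl big_ord0 addr0 !addrA.
by congr (f _ + f _ + f _ + f _); apply: val_inj; rewrite /= inordK.
Qed.

Lemma wdeg_box (w : 'I_4 * nat -> nat) (k : occupation) M :
  (forall i m, (M <= m)%N -> k (i, m) = 0%N) ->
  wdeg w k = (\sum_(m < M) \sum_(i < 4) w (i, m : nat) * k (i, m : nat))%N.
Proof.
move=> kM; rewrite exchange_big /=.
pose r := [seq (i, m) | i <- index_enum 'I_4, m <- iota 0 M].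
have ur : uniq r.
  apply: allpairs_uniq; [exact: index_enum_uniq|exact: iota_uniq|].
  by move=> [? ?] [? ?].
have kr x : x \notin r -> k x = 0%N.
  case: x => i m; apply: contraNeq => k0; apply/allpairsP; exists (i, m).
  rewrite mem_index_enum mem_iota /=; split => //.
  by rewrite ltnNge; apply: contraNN k0 => /kM ->.
rewrite (wdegEw w (D := seq_fset tt r)); last first.
  by apply/fsubsetP => x; rewrite seq_fsetE; apply: contraLR => /kr k0;
    rewrite memNfinsupp k0.
rewrite (perm_big _ (seq_fset_perm tt r)) (undup_id ur).
rewrite big_allpairs; apply: eq_bigr => i _.
by rewrite -(big_mkord xpredT (fun m =>
  w (i, m) * k (i, m))%N) /index_iota subn0.
Qed.

Lemma posnat_sum (W : nmodType) (F : nat -> W) M : (forall m,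
  (M <= m)%N -> F m.+1 = 0) ->
  \sum_(m \in posnat) F m = \sum_(m < M) F m.+1.
Proof.
move=> F0; rewrite (fsbigE (iota 1 M)) ?iota_uniq //; first last.
- move=> [|m] // _; rewrite mem_iota negb_and /= add1n ltnS -leqNgt => Mm.
  exact: F0.
- by move=> m /=; rewrite mem_iota => /andP[].
rewrite big_mkcond big_seq_cond (eq_bigr (fun m => F m)); last first.
  by move=> m; rewrite mem_iota => /andP[/andP[m0 _] _]; rewrite ifT // in_setE.
rewrite -big_seq_cond (iotaDl 1 0) big_map.
by rewrite -(big_mkord xpredT (fun m => F m.+1)) /index_iota subn0.
Qed.

(* The second component [m] of an oscillator stands for the mode of index -(m+1). *)
Definition tweight (x : 'I_4 * nat) : nat := x.2.+1.

(** * The Fock space of h^1, h^2, c inside that of the four oscillators *)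

Section FreeFieldFock.
Variables (C : numFieldType) (B : fmodule C) (q sq : C).
Hypothesis sqE : sq ^+ 2 = q.
Hypothesis sq_neq0 : sq != 0.
Hypothesis qint_neq0 : forall m, qint q m.+1 != 0.
Hypothesis fosc_comm : forall i j m n (v : B),
  fosc q i m (fosc q j n v) = fosc q j n (fosc q i m v) +
  (if [&& i == j, m + n == 0 & m != 0]
   then sgn4 C i * (qint q m ^+ 2 / m%:~R) else 0) *: v.
Implicit Types (u v : B) (l : {ffun 'I_4 -> C}) (P : fstate C -> Prop).

Definition fh1 (m : int) (v : B) : B :=
  sq ^- `|m|%N *: fosc q ia1 m v - sq ^+ `|m|%N *: fosc q ia2 m v.
Definition fh2 (m : int) (v : B) : B :=
  sq ^- `|m|%N *: fosc q ia2 m v + sq ^- `|m|%N *: fosc q ib m v.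
Definition ftdec (m : int) (v : B) : B :=
  q ^+ `|m|%N *: fosc q ia1 m v + fosc q ia2 m v + fosc q ib m v.

Lemma fh1_linear m : linear (fh1 m).
Proof. by apply: linear_sub; apply: linear_scale; exact: fosc_linear. Qed.

Lemma fh2_linear m : linear (fh2 m).
Proof. by apply: linear_add; apply: linear_scale; exact: fosc_linear. Qed.

Lemma ftdec_linear m : linear (ftdec m).
Proof.
apply: linear_add; last exact: fosc_linear.
by apply: linear_add; last exact: fosc_linear; apply: linear_scale;
  exact: fosc_linear.
Qed.

Let oZ i n a v : fosc q i n (a *: v) = a *: fosc q i n v.
Proof. exact: (linZ _ _ (@fosc_linear _ _ _ _ _)). Qed.
Let oD i n u v : fosc q i n (u + v) = fosc q i n u + fosc q i n v.
Proof. exact: (linD (@fosc_linear _ _ _ _ _)). Qed.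
Let oB i n u v : fosc q i n (u - v) = fosc q i n u - fosc q i n v.
Proof. exact: (linB (@fosc_linear _ _ _ _ _)). Qed.

Lemma ind_eqE : ((ia1 == ia2) = false) * ((ia1 == ib) = false) *
  ((ia1 == ic) = false) * ((ia2 == ia1) = false) * ((ia2 == ib) = false) *
  ((ia2 == ic) = false) * ((ib == ia1) = false) * ((ib == ia2) = false) *
  ((ib == ic) = false) * ((ic == ia1) = false) * ((ic == ia2) = false) *
  ((ic == ib) = false).
Proof. by do !split; apply/negbTE/eqP => /(congr1 val); rewrite /= !inordK. Qed.

Lemma sgn4E : (sgn4 C ia1 = 1) * (sgn4 C ia2 = 1) * (sgn4 C ib =
  -1) * (sgn4 C ic = 1).
Proof. by rewrite /sgn4 !ind_eqE eqxx. Qed.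

Definition tnull v : Prop := forall m : nat, ftdec m.+1 v = 0.

Lemma tnull_linear a u v : tnull u -> tnull v -> tnull (a *: u + v).
Proof. by move=> tu tv m; rewrite ftdec_linear tu tv scaler0 addr0. Qed.

Lemma tnull0 : tnull 0.
Proof. by move=> m; exact: (lin0 (ftdec_linear _)). Qed.

Lemma ftdec_comm (D : B -> B) n v : linear D ->
  (forall u, D (fosc q ia1 n u) = fosc q ia1 n (D u)) ->
  (forall u, D (fosc q ia2 n u) = fosc q ia2 n (D u)) ->
  (forall u, D (fosc q ib n u) = fosc q ib n (D u)) ->
  ftdec n (D v) = D (ftdec n v).
Proof. by move=> lD D1 D2 D3;
  rewrite /ftdec !(linD lD) (linZ _ _ lD) D1 D2 D3. Qed.

Lemma ftdec_c n m v : ftdec n (fosc q ic m v) = fosc q ic m (ftdec n v).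
Proof.
by apply: ftdec_comm; first exact: fosc_linear;
  move=> u; rewrite fosc_comm ind_eqE scale0r addr0.
Qed.

Lemma tnull_vop s e v : s * s = 1 -> tnull v -> tnull (vop q s e v).
Proof.
move=> ss tv m; have := @vop_comm C B q fosc_comm (ftdec m.+1) s e v ss
  (ftdec_linear _).
rewrite tv (lin0 (@vop_linear _ _ _ fosc_comm _ _ ss)); apply.
- by move=> n u _; exact: ftdec_c.
- move=> mu u; apply: ftdec_comm (@fchproj_linear _ _ _) _ _ _ => w;
    by rewrite fosc_fchproj.
- move=> u; apply: ftdec_comm (@fexpQ_linear _ _ _) _ _ _ => w;
    by rewrite fosc_fexpQ.
Qed.

Lemma ftdec_h1 (n m : nat) v : ftdec n.+1 (fh1 (- m.+1%:Z) v) =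
  fh1 (- m.+1%:Z) (ftdec n.+1 v).
Proof.
rewrite /ftdec /fh1 !(oB, oD, oZ).
rewrite !(fosc_comm _ _ n.+1 (- m.+1%:Z)) !ind_eqE !eqxx /= subr_eq0 andbT.
rewrite ?abszN ?absz_nat ?eqz_nat ?eqSS !sgn4E !scale0r !addr0 !mul1r.
set k := (if _ then _ else _).
have E : q ^+ n.+1 * sq ^- m.+1 * k = sq ^+ m.+1 * k.
  rewrite /k; case: eqP => [->|_]; last by rewrite !mulr0.
  by rewrite -sqE exprAC expr2 mulfK // expf_neq0.
apply: coef_ext => t; rewrite !(fcoefD, fcoefN, fcoefZ).
apply/eqP; rewrite -subr_eq0; apply/eqP.
transitivity ((q ^+ n.+1 * sq ^- m.+1 * k - sq ^+ m.+1 * k) * coef t v).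
  by ring.
by rewrite E subrr mul0r.
Qed.

Lemma ftdec_h2 (n m : nat) v : ftdec n.+1 (fh2 (- m.+1%:Z) v) =
  fh2 (- m.+1%:Z) (ftdec n.+1 v).
Proof.
rewrite /ftdec /fh2 !(oB, oD, oZ).
rewrite !(fosc_comm _ _ n.+1 (- m.+1%:Z)) !ind_eqE !eqxx /= subr_eq0 andbT.
rewrite ?abszN ?absz_nat ?eqz_nat ?eqSS !sgn4E !scale0r !addr0 !mul1r.
case: eqP => _; apply: coef_ext => t; rewrite !(fcoefD, fcoefN, fcoefZ); ring.
Qed.

Lemma fosc_vproj i m P P' v :
  (forall l k, P' (l, k) <-> P (l, set_occ k (i, m) (k (i, m)).+1)) ->
  fosc q i m.+1 (vproj P v) = vproj P' (fosc q i m.+1 v).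
Proof.
move=> PP'; apply: coef_ext => -[l k].
rewrite coef_fosc_pos !coef_vproj coef_fosc_pos.
rewrite (_ : `[< P' (l, k) >] = `[< P (l, set_occ k (i, m) (k (i, m)).+1) >]).
  by case: asboolP; rewrite ?mulr0.
exact: asbool_equiv_eq.
Qed.

(** One P' has to serve all i, because [ftdec] adds the lowering operators of three different
    oscillators. *)
Lemma tnull_vproj P v :
  (forall m, exists P', forall i l k, P' (l, k) <-> P (l, set_occ k (i,
    m) (k (i, m)).+1)) ->
  tnull v -> tnull (vproj P v).
Proof.
move=> PP' tv m; have [P' P'E] := PP' m.
rewrite /ftdec !(fosc_vproj _ (P'E _)) -(linZ _ _ (@vproj_linear _ _ _)).
by rewrite -!(linD (@vproj_linear _ _ _)) -/(ftdec m.+1 v) tv (lin0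
  (@vproj_linear _ _ _)).
Qed.

Lemma tnull_vproj_hdeg l z v : tnull v -> tnull (vproj (hdeg l tweight z) v).
Proof.
apply: tnull_vproj => m; exists (hdeg l tweight (z - m.+1%:Z)) => i l' k.
rewrite /hdeg /= wdegS PoszD; split=> [[-> ->]|[-> <-]]; first by rewrite subrK.
by rewrite addrK.
Qed.

Lemma tnull_vproj_fst l v : tnull v -> tnull (vproj (fun s => s.1 = l) v).
Proof. by apply: tnull_vproj => m; exists (fun s => s.1 = l). Qed.

Lemma vproj_decomp (T : eqType) (f : fstate C -> T) v : exists r : seq T,
  v = \sum_(t <- r) vproj (fun s => f s = t) v.
Proof.
have [S HS] := finite_coef v; exists (undup (map f S)).
apply: coef_ext => s; rewrite fcoef_sum.
under eq_bigr do rewrite coef_vproj.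
have [fs|fs] := boolP (f s \in undup (map f S)).
  rewrite (bigD1_seq (f s)) ?undup_uniq //= asboolT // big1 ?addr0 // => t tf.
  by rewrite asboolF // => E; rewrite E eqxx in tf.
have -> : coef s v = 0.
  apply/eqP; apply: contraNT fs => /HS sS; rewrite mem_undup; exact: map_f.
by rewrite big1 // => t _; rewrite if_same.
Qed.

Definition fd_op (v : B) : B :=
  \sum_(m \in posnat) ((m%:R ^+ 2 / qint q m ^+ 2) *:
     (fh1 (- m%:Z) (fh2 m v) + fh2 (- m%:Z) (fh1 m v)
      + (q ^+ m + q ^- m) *: fh2 (- m%:Z) (fh2 m v)))
  - \sum_(m \in posnat) ((m%:R ^+ 2 / qint q m ^+ 2) *:
      fosc q ic (- m%:Z) (fosc q ic m v))
  + fh1 0 (fh2 0 v) + fh2 0 (fh2 0 v)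
  - 2^-1 *: fosc q ic 0 (fosc q ic 0 v + v).

Lemma coef_number i m l k v :
  coef (l, k) (fosc q i (- m.+1%:Z) (fosc q i m.+1 v)) =
  sgn4 C i * (qint q m.+1 ^+ 2 / m.+1%:R) * (k (i, m))%:R * coef (l, k) v.
Proof.
rewrite -NegzE coef_fosc_neg; have [k0|k0] := posnP (k (i, m)).
  by rewrite k0 mulr0 mul0r.
by rewrite coef_fosc_pos set_occ_predK // set_occE eqxx prednK.
Qed.

(* On the common kernel of the [ftdec m], the quadratic form of h^1, h^2 becomes
   diagonal in the oscillators. *)
Lemma tnull_quadratic m v : tnull v ->
  fh1 (- m.+1%:Z) (fh2 m.+1 v) + fh2 (- m.+1%:Z) (fh1 m.+1 v)
      + (q ^+ m.+1 + q ^- m.+1) *: fh2 (- m.+1%:Z) (fh2 m.+1 v) =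
  fosc q ib (- m.+1%:Z) (fosc q ib m.+1 v) -
  fosc q ia1 (- m.+1%:Z) (fosc q ia1 m.+1 v) -
  fosc q ia2 (- m.+1%:Z) (fosc q ia2 m.+1 v).
Proof.
move=> tv; have E : fosc q ia2 m.+1 v =
    (- 1) *: (q ^+ m.+1 *: fosc q ia1 m.+1 v + fosc q ib m.+1 v).
  by rewrite scaleN1r; apply/eqP;
    rewrite -addr_eq0 addrA [fosc q ia2 _ _ + _]addrC; apply/eqP/tv.
have qE : q ^+ m.+1 = (sq ^+ m.+1) ^+ 2 by rewrite -sqE exprAC.
rewrite /fh1 /fh2 abszN absz_nat E !qE.
have x0 : sq ^+ m.+1 != 0 by rewrite expf_neq0.
move: (sq ^+ m.+1) x0 => x x0.
rewrite !(oB, oD, oZ); apply: coef_ext => t; rewrite !(fcoefD, fcoefN, fcoefZ).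
by field.
Qed.

Let half_sum (k : occupation) m : nat :=
  (k (ia1, m) + k (ia2, m) + k (ib, m))%N.

Let bounded_modes v : exists M, forall l k i m,
  coef (l, k) v != 0 -> (M <= m)%N -> k (i, m) = 0%N.
Proof.
have [S HS] := finite_coef v.
exists (\max_(s <- S) \max_(x <- finsupp s.2) x.2.+1)%N => l k i m /HS kS.
apply: contraTeq => k0; rewrite -ltnNge.
have kx : (i, m) \in finsupp k by rewrite mem_finsupp.
by apply: leq_trans (leq_bigmax_seq (l, k) kS isT);
  apply: (leq_bigmax_seq (i, m) kx isT).
Qed.

Lemma coef_fh1_0 l k u : coef (l, k) (fh1 0 u) = (l ia1 - l ia2) * coef (l,
  k) u.
Proof. by rewrite /fh1 !expr0 invr1 !scale1r fcoefB !coef_fosc0 !sgn4E;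
  ring. Qed.

Lemma coef_fh2_0 l k u : coef (l, k) (fh2 0 u) = (l ia2 - l ib) * coef (l, k) u.
Proof. by rewrite /fh2 !expr0 invr1 !scale1r fcoefD !coef_fosc0 !sgn4E;
  ring. Qed.

(** By [tnull_quadratic] only number operators and zero modes remain. The factor m^2 / [m]^2
    normalizes the commutators, and the negative commutator of b matches its sign in the quadratic
    form, so every quantum of mode m lowers d by m. *)
Lemma coef_fd_op v l k : tnull v -> coef (l, k) (fd_op v) =
  ((l ia1 - l ia2) * (l ia2 - l ib) + (l ia2 - l ib) ^+ 2
   - 2^-1 * l ic * (l ic + 1) - (wdeg tweight k)%:R) * coef (l, k) v.
Proof.
move=> tv; have [M HM] := bounded_modes v.
have F1 m l' k' : coef (l', k') ((m.+1%:R ^+ 2 / qint q m.+1 ^+ 2) *: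
     (fh1 (- m.+1%:Z) (fh2 m.+1 v) + fh2 (- m.+1%:Z) (fh1 m.+1 v)
      + (q ^+ m.+1 + q ^- m.+1) *: fh2 (- m.+1%:Z) (fh2 m.+1 v))) =
     - (m.+1%:R * (half_sum k' m)%:R * coef (l', k') v).
  rewrite tnull_quadratic // fcoefZ !(fcoefD,
    fcoefN) !coef_number !sgn4E /half_sum !natrD.
  have x0 := qint_neq0 m; move: (qint q m.+1) x0 => x x0.
  by field; rewrite nat1r pnatr_eq0 x0.
have F2 m l' k' : coef (l', k') ((m.+1%:R ^+ 2 / qint q m.+1 ^+ 2) *:
     fosc q ic (- m.+1%:Z) (fosc q ic m.+1 v)) =
     m.+1%:R * (k' (ic, m))%:R * coef (l', k') v.
  rewrite fcoefZ !coef_number !sgn4E.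
  have x0 := qint_neq0 m; move: (qint q m.+1) x0 => x x0.
  by field; rewrite nat1r pnatr_eq0 x0.
(* From index M on all modes are empty in v; the summands vanish there and both sums over [posnat]
   become finite. *)
have zero m (b : C) (u : B) (g : nat -> occupation -> nat) : (M <= m)%N ->
   (forall k' : occupation, (forall i, k' (i, m) = 0%N) -> g m k' = 0%N) ->
   (forall l' k', coef (l', k') u = b * (g m k')%:R * coef (l', k') v) -> u = 0.
  move=> Mm g0 uE; apply: coef_ext => -[l' k']; rewrite fcoef0 uE.
  have [->|v0] := eqVneq (coef (l', k') v) 0; first by rewrite mulr0.
  by rewrite g0 ?mulr0 ?mul0r // => i; apply: HM v0 Mm.
rewrite /fd_op (@posnat_sum _ _ M); last first.
  move=> m Mm; apply: (zero m (- m.+1%:R) _ (fun m (k' : occupation) =>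
    half_sum k' m)) => //.
    by move=> k' k'0; rewrite /half_sum !k'0.
  by move=> l' k'; rewrite F1 !mulNr.
rewrite (@posnat_sum _ _ M); last first.
  move=> m Mm; apply: (zero m m.+1%:R _ (fun m (k' : occupation) =>
    k' (ic, m))) => //.
rewrite fcoefB 2!fcoefD fcoefB !fcoef_sum (eq_bigr _ (fun (m : 'I_M) _ =>
  F1 m l k)).
rewrite (eq_bigr _ (fun (m : 'I_M) _ => F2 m l k)).
rewrite !(coef_fh1_0, coef_fh2_0) fcoefZ coef_fosc0 fcoefD coef_fosc0 !sgn4E.
rewrite sumrN -!mulr_suml /=.
have [->|v0] := eqVneq (coef (l, k) v) 0;
  first by rewrite !(mulr0, addr0, oppr0).
have kM i m : (M <= m)%N -> k (i, m) = 0%N by apply: HM v0.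
have -> : (wdeg tweight k)%:R = \sum_(m < M) m.+1%:R * (half_sum k m)%:R +
    \sum_(m < M) m.+1%:R * (k (ic, m : nat))%:R :> C.
  rewrite (@wdeg_box _ _ M) // natr_sum -big_split; apply: eq_bigr => m _ /=.
  by rewrite sum_I4 /tweight /= /half_sum -mulrDr -natrD -natrM !mulnDr.
by ring.
Qed.

Definition a2free (s : fstate C) : Prop := forall m, s.2 (ia2, m) = 0%N.

(* [ftdec] expresses the coefficient of a state with an occupied a^2-mode through
   those of states with one a^2-excitation less. *)
Lemma vproj_a2free_inj v : tnull v -> vproj a2free v = 0 -> v = 0.
Proof.
move=> tv pv; apply: coef_ext => -[l k]; rewrite fcoef0.
pose w (x : 'I_4 * nat) : nat := x.1 == ia2.
have [n] := ubnP (wdeg w k); elim: n k => // n IH k kn.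
have [k0|] := eqVneq (wdeg w k) 0%N.
  have := congr1 (coef (l, k)) pv; rewrite coef_vproj fcoef0 asboolT // => m.
  by have := wdeg_eq0 k0 (ia2, m); rewrite /w eqxx mul1n.
move=> /wdeg_neq0[[i m]]; rewrite muln_gt0 /w /= lt0b => /andP[/eqP-> km].
set k' := set_occ k (ia2, m) (k (ia2, m)).-1.
have k'E : (wdeg w k' + 1 = wdeg w k)%N by rewrite -(wdeg_pred w km) /w /= eqxx.
have := congr1 (coef (l, k')) (tv m).
rewrite /ftdec fcoef0 !fcoefD fcoefZ !coef_fosc_pos.
rewrite (IH (set_occ k' (ia1, m) _)); last first.
  by rewrite wdegS /w /= ind_eqE; rewrite /w in k'E kn; lia.
rewrite (IH (set_occ k' (ib, m) _)); last first.
  by rewrite wdegS /w /= ind_eqE; rewrite /w in k'E kn; lia.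
rewrite set_occ_predK // !mulr0 add0r addr0 sgn4E mul1r => /eqP.
have a0 n' : (qint q m.+1 ^+ 2 / m.+1%:R) * n'.+1%:R != 0 :> C.
  apply: mulf_neq0; last by rewrite pnatr_eq0.
  by apply: mulf_neq0; [exact: expf_neq0|rewrite invr_neq0 // pnatr_eq0].
by rewrite mulf_eq0 (negPf (a0 _)) => /eqP.
Qed.

Lemma vproj_a2free_neg i m v : i != ia2 ->
  vproj a2free (fosc q i (Negz m) v) = fosc q i (Negz m) (vproj a2free v).
Proof.
move=> i2; apply: coef_ext => -[l k].
rewrite coef_vproj !coef_fosc_neg coef_vproj.
case: eqP => [_|k0]; first by rewrite if_same.
rewrite (_ : `[< a2free (l, k) >] =
  `[< a2free (l, set_occ k (i, m) (k (i, m)).-1) >]) //.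
apply: asbool_equiv_eq; rewrite /a2free /=; split=> H m'; have := H m';
  by rewrite set_occE xpair_eqE eq_sym (negPf i2).
Qed.

Lemma vproj_a2free_ia2 m v : vproj a2free (fosc q ia2 (Negz m) v) = 0.
Proof.
apply: coef_ext => -[l k]; rewrite coef_vproj coef_fosc_neg fcoef0.
by case: asboolP => // /(_ m) /= ->.
Qed.

Definition fket (l : {ffun 'I_4 -> C}) : B :=
  fexpQ l (bas (0, [fsfun of _ => 0%N])).

Definition fFock (l : {ffun 'I_4 -> C}) : set B :=
  smallest
    [set S | lsubspace S /\
       forall (m : nat) v, (0 < m)%N -> S v ->
         [/\ S (fh1 (- m%:Z) v), S (fh2 (- m%:Z) v) & S (fosc q ic (- m%:Z) v)]]
    [set fket l].

Lemma fketE l : fket l = bas (l, [fsfun of _ => 0%N]).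
Proof. by rewrite /fket fexpQ_bas add0r. Qed.

Lemma fFock_subspace l : lsubspace (fFock l).
Proof.
split=> [|a u v Fu Fv] S [[sS cS] GS]; first exact: sS.1.
by apply: sS.2; [exact: Fu|exact: Fv].
Qed.

Lemma fFock_closed l m v : fFock l v ->
  [/\ fFock l (fh1 (- m.+1%:Z) v), fFock l (fh2 (- m.+1%:Z) v) &
      fFock l (fosc q ic (- m.+1%:Z) v)].
Proof.
by move=> Fv; split=> S [[sS cS] GS];
  have [] := cS m.+1 v isT (Fv S (conj (conj sS cS) GS)).
Qed.

Lemma fosc_fst i n l v : vsupp (fun s => s.1 = l) v -> vsupp (fun s =>
  s.1 = l) (fosc q i n v).
Proof.
apply: lin_vsupp; first exact: fosc_linear.
move=> s sl; rewrite /fosc lext_bas.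
by case: n => [[|n]|n]; [apply: vsuppZ|apply: vsuppZ|]; apply: vsupp_bas.
Qed.

Lemma fFock_sub l v : fFock l v -> vsupp (fun s => s.1 = l) v /\ tnull v.
Proof.
apply: (@smallest_sub _ _ [set fket l]
  [set v | vsupp (fun s => s.1 = l) v /\ tnull v]) => [|u ->]; last first.
  rewrite fketE; split; first exact: vsupp_bas.
  by move=> m; rewrite /ftdec !fosc_pos_bas /= !fsfunE !mulr0 !scale0r scaler0
    !addr0.
split.
  split; first by split; [exact: vsupp0|exact: tnull0].
  by move=> a u w [u1 u2] [w1 w2]; split;
    [exact: vsupp_linear|exact: tnull_linear].
case=> // m w _ [w1 w2]; split.
- split; last by move=> n; rewrite ftdec_h1 w2 (lin0 (fh1_linear _)).
  by rewrite /fh1 -scaleN1r; apply: vsuppD; do ?apply: vsuppZ; exact: fosc_fst.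
- split; last by move=> n; rewrite ftdec_h2 w2 (lin0 (fh2_linear _)).
  by rewrite /fh2; apply: vsuppD; do ?apply: vsuppZ; exact: fosc_fst.
- split; last by move=> n; rewrite ftdec_c w2 (lin0 (@fosc_linear _ _ _ _ _)).
  exact: fosc_fst.
Qed.

(** Creation by a^2 leaves the [a2free] states, so after projection the creation modes of h^1 and
    h^2 act as multiples of those of a^1 and b. Hence every monomial in a^1, b, c lifts. *)
Lemma fFock_lift l k : a2free (l, k) ->
  exists2 v, fFock l v & vproj a2free v = bas (l, k).
Proof.
have [n] := ubnP (wdeg (fun=> 1%N) k); elim: n k => // n IH k kn k2.
have [k0|] := eqVneq (wdeg (fun=> 1%N) k) 0%N.
  exists (fket l); first by move=> S [_ GS]; exact: GS.
  have -> : k = [fsfun of _ => 0%N].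
    by apply/fsfunP => x; rewrite fsfunE; have := wdeg_eq0 k0 x; rewrite mul1n.
  rewrite fketE vproj_id //; by apply: vsupp_bas => m; rewrite /= fsfunE.
move=> /wdeg_neq0[[i m]]; rewrite mul1n => km.
have i2 : i != ia2 by apply: contraTneq km => ->; rewrite k2.
pose k' := set_occ k (i, m) (k (i, m)).-1.
have k'n : (wdeg (fun=> 1%N) k' < n)%N.
  by have := wdeg_pred (fun=> 1%N) km; rewrite -/k'; lia.
have [|v Fv pv] := IH k' k'n.
  move=> m'; rewrite /= set_occE xpair_eqE eq_sym (negPf i2); exact: k2.
have kE : bas (l, k) = fosc q i (Negz m) (vproj a2free v) :> B.
  by rewrite pv fosc_neg_bas /= set_occ_predK.
have [F1 F2 F3] := fFock_closed m Fv.
have [s0 sS] := fFock_subspace l.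
have pF : linear (vproj a2free : B -> B) := @vproj_linear _ _ _.
have x0 : sq ^+ m.+1 != 0 by rewrite expf_neq0.
have : [\/ i = ia1, i = ib | i = ic].
  have := sum_I4 (fun j => (j == i : nat)); rewrite (bigD1 i) //= eqxx.
  rewrite [ia2 == i]eq_sym (negPf i2).
  case: eqP => [->|_]; first by constructor 1.
  case: eqP => [->|_]; first by constructor 2.
  by case: eqP => [->|_]; first by constructor 3.
case=> iE.
- exists (sq ^+ m.+1 *: fh1 (- m.+1%:Z) v); first by rewrite -[_ *: _]addr0;
  apply: sS.
  rewrite (linZ _ _ pF) /fh1 abszN absz_nat (linB pF) !(linZ _ _ pF) -NegzE.
  by rewrite vproj_a2free_ia2 scaler0 subr0 vproj_a2free_neg ?ind_eqE //
    scalerA mulfV // scale1r kE iE.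
- exists (sq ^+ m.+1 *: fh2 (- m.+1%:Z) v); first by rewrite -[_ *: _]addr0;
  apply: sS.
  rewrite (linZ _ _ pF) /fh2 abszN absz_nat (linD pF) !(linZ _ _ pF) -NegzE.
  rewrite vproj_a2free_ia2 scaler0 add0r vproj_a2free_neg;
    last by rewrite eq_sym ind_eqE.
  by rewrite scalerA mulfV // scale1r kE iE.
- exists (fosc q ic (- m.+1%:Z) v) => //.
  by rewrite -NegzE vproj_a2free_neg ?kE ?iE // eq_sym ind_eqE.
Qed.

(** For the nontrivial inclusion, [fFock_lift] yields a Fock vector with the same projection as v,
    and [vproj_a2free_inj] identifies the two. *)
Lemma fFockE l : fFock l = [set v | vsupp (fun s => s.1 = l) v /\ tnull v].
Proof.
apply/seteqP; split=> [v /fFock_sub//|v [vl tv]].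
have [s0 sS] := fFock_subspace l.
have pF : linear (vproj a2free : B -> B) := @vproj_linear _ _ _.
have [u Fu uE] : exists2 u, fFock l u & vproj a2free u = vproj a2free v.
  apply: (@vsupp_ind _ _ (fun s => s.1 = l /\ a2free s)
    (fun w => exists2 u, fFock l u & vproj a2free u = w)).
  - by exists 0 => //; exact: (lin0 pF).
  - move=> a _ _ [u1 F1 <-] [u2 F2 <-]; exists (a *: u1 + u2); first exact: sS.
    exact: pF.
  - by move=> [l' k] /= [-> k2]; exact: fFock_lift.
  move=> s ns; rewrite coef_vproj; case: asboolP => // s2.
  by apply: vl => sl; apply: ns.
suff -> : v = u by [].
apply/eqP; rewrite -subr_eq0; apply/eqP; apply: vproj_a2free_inj.
  have [_ tu] := fFock_sub Fu.
  by move=> m; rewrite (linB (ftdec_linear _)) tv tu subrr.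
by rewrite (linB pF) uE subrr.
Qed.

End FreeFieldFock.

(** * Occupations of a fixed degree as a finite set *)

Section BoundedOccupations.
Variable K : nat.
Implicit Types (f : {ffun 'I_4 * 'I_K -> 'I_K.+1}) (k : occupation).

Definition occ_of f : occupation :=
  [fsfun x in seq_fset tt [seq (i, m) | i <- enum 'I_4, m <- iota 0 K] =>
     oapp (fun m : 'I_K => f (x.1, m) : nat) 0%N (insub x.2)].

Lemma occ_ofE f x : occ_of f x = oapp (fun m : 'I_K =>
  f (x.1, m) : nat) 0%N (insub x.2).
Proof.
rewrite /occ_of fsfunE seq_fsetE; case: ifP => // /negbT xD.
case: insubP => //= m mK; case/negP: xD; apply/allpairsP; exists x.
by rewrite mem_enum mem_iota /= -surjective_pairing mK.
Qed.

Lemma occ_of_in f i (m : 'I_K) : occ_of f (i, m : nat) = f (i, m).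
Proof. by rewrite occ_ofE /= valK. Qed.

Lemma occ_of_out f i m : (K <= m)%N -> occ_of f (i, m) = 0%N.
Proof. by move=> Km; rewrite occ_ofE /= insubF // ltnNge Km. Qed.

Lemma occ_of_inj : injective occ_of.
Proof.
move=> f g fg; apply/ffunP => -[i m]; apply: val_inj.
by rewrite /= -!occ_of_in fg.
Qed.

(** Partitions in the three colours a^1, b, c. K is twice their size, as it is an exponent of q in
    q^(-2d), so the set is empty for odd K. The bound K on modes and occupation numbers loses
    nothing ([occset_surj]). *)
Definition occset : {set {ffun 'I_4 * 'I_K -> 'I_K.+1}} :=
  [set f : {ffun 'I_4 * 'I_K -> 'I_K.+1} |
    [forall m, f (ia2, m) == ord0] && (\sum_(x : 'I_4 * 'I_K) 2 * x.2.+1 * f x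
      == K)%N].

Lemma wdeg_occ_of f : (\sum_(x : 'I_4 * 'I_K) 2 * x.2.+1 * f x =
  2 * wdeg tweight (occ_of f))%N.
Proof.
rewrite (@wdeg_box _ _ K); last by move=> i m; exact: occ_of_out.
rewrite (eq_bigr (fun x : 'I_4 * 'I_K => 2 * x.2.+1 * f (x.1, x.2))%N);
  last by case.
rewrite exchange_big big_distrr /= -(pair_bigA _ (fun (i : 'I_4) (m : 'I_K) =>
  2 * m.+1 * f (i, m))%N) /=.
apply: eq_bigr => i _; rewrite big_distrr /=; apply: eq_bigr => m _.
by rewrite occ_of_in mulnA.
Qed.

Lemma occset_a2 f m : f \in occset -> occ_of f (ia2, m) = 0%N.
Proof.
rewrite inE => /andP[/forallP f0 _]; rewrite occ_ofE /=.
by case: insubP => //= m' _ _; rewrite (eqP (f0 m')).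
Qed.

Lemma occset_wdeg f : f \in occset -> (2 * wdeg tweight (occ_of f) = K)%N.
Proof. by rewrite inE => /andP[_ /eqP <-]; rewrite wdeg_occ_of. Qed.

Lemma occset_surj k : (forall m, k (ia2,
  m) = 0%N) -> (2 * wdeg tweight k = K)%N ->
  exists2 f, f \in occset & occ_of f = k.
Proof.
move=> k2 kK.
have kle x : (tweight x * k x <= wdeg tweight k)%N.
  have [xk|xk] := boolP (x \in finsupp k); last by rewrite fsfun_dflt ?muln0.
  by rewrite /wdeg (big_fsetD1 x xk) /= leq_addr.
have kout i m : (K <= m)%N -> k (i, m) = 0%N.
  move=> Km; have := kle (i, m); case: (k (i, m)) => // n;
    rewrite -[tweight (i, m)]/(m.+1) mulnS.
  by move=> /(leq_trans (leq_addr _ _)); lia.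
have kK1 x : (k x < K.+1)%N.
  have := kle x; rewrite -[tweight x]/(x.2.+1) mulSn =>
    /(leq_trans (leq_addr _ _)); lia.
pose f : {ffun 'I_4 * 'I_K -> 'I_K.+1} :=
  [ffun x : 'I_4 * 'I_K => inord (k (x.1, x.2 : nat))].
have fk : occ_of f = k.
  apply/fsfunP => -[i m]; rewrite occ_ofE /=; case: insubP => [m' _ <-|mK] /=.
    by rewrite ffunE inordK.
  by rewrite kout // leqNgt.
exists f => //; rewrite inE wdeg_occ_of fk kK eqxx andbT.
by apply/forallP => m; apply/eqP/val_inj; rewrite /= ffunE k2 inordK.
Qed.

End BoundedOccupations.

Definition npart3 (K : nat) : nat := #|occset K|.

(** * Dimension of the common kernel in fixed zero modes and degree *)

Section WeightSpaces.
Variables (C : numFieldType) (B : fmodule C) (q sq : C).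
Hypothesis sqE : sq ^+ 2 = q.
Hypothesis sq_neq0 : sq != 0.
Hypothesis qint_neq0 : forall m, qint q m.+1 != 0.
Hypothesis fosc_comm : forall i j m n (v : B),
  fosc q i m (fosc q j n v) = fosc q j n (fosc q i m v) +
  (if [&& i == j, m + n == 0 & m != 0]
   then sgn4 C i * (qint q m ^+ 2 / m%:~R) else 0) *: v.
Implicit Types (u v : B) (lam : {ffun 'I_4 -> C}).

Definition tspace (P : fstate C -> Prop) : set B :=
  [set v | vsupp P v /\ tnull q v].

Lemma tspace_lsubspace P : lsubspace (tspace P).
Proof.
split; first by split; [exact: vsupp0|exact: tnull0].
by move=> a u v [u1 u2] [v1 v2]; split;
  [exact: vsupp_linear|exact: tnull_linear].
Qed.

(** The basis consists of lifts of the [a2free] states of this degree; coordinates are read off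
    after the injective projection. *)
Lemma has_dim_tspace lam K :
  has_dim (tspace (fun s => s.1 = lam /\ (2 * wdeg tweight s.2 =
    K)%N)) (npart3 K).
Proof.
set P := fun s => _; have pF : linear (vproj (@a2free C) : B -> B) :=
  @vproj_linear _ _ _.
pose st (i : 'I_(npart3 K)) : fstate C := (lam, occ_of (enum_val i)).
have st_inj : injective st.
  by move=> i j [] /occ_of_inj /enum_val_inj.
have lift i : exists v, tspace P v /\ vproj (@a2free C) v = bas (st i).
  have iK : enum_val i \in occset K := enum_valP i.
  have st2 : a2free (st i) by move=> m; exact: occset_a2.
  have [v Fv pv] := @fFock_lift C B q sq sq_neq0 _ _ (st2 : a2free (lam,
    occ_of (enum_val i))).
  have [vl tv] := fFock_sub sqE sq_neq0 fosc_comm Fv.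
  (* The lift is not known to be homogeneous. Cutting it down to its degree preserves [tnull] and
     the prescribed projection. *)
  exists (vproj (hdeg lam tweight (wdeg tweight (occ_of (enum_val i)))%:Z) v);
    split.
    split; last exact: tnull_vproj_hdeg.
    apply: (@vsupp_sub _ _ (hdeg lam tweight (wdeg tweight (occ_of (enum_val
      i)))%:Z));
      last exact: vproj_supp.
    by move=> s [sl [sw]]; split=> //; rewrite sw occset_wdeg.
  apply: coef_ext => s; have := congr1 (coef s) pv;
    rewrite !coef_vproj coef_bas.
  case: asboolP => // _ ->; case: asboolP => // ns; case: eqP => // E.
  by case: ns; rewrite E.
have [e eP] := choice lift; exists e.
have pi_sum (x : 'I_(npart3 K) -> C) : vproj (@a2free C) (\sum_i x i *: e i) =
    \sum_i x i *: bas (st i).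
  rewrite (lin_sum _ _ _ pF); apply: eq_bigr => i _.
  by rewrite (linZ _ _ pF) (eP i).2.
have coef_comb (x : 'I_(npart3 K) -> C) j :
    coef (st j) (\sum_i x i *: bas (st i) : B) = x j.
  rewrite fcoef_sum (bigD1 j) //= fcoefZ coef_bas eqxx mulr1 big1 ?addr0 // =>
    i ij.
  by rewrite fcoefZ coef_bas (inj_eq st_inj) eq_sym (negPf ij) mulr0.
split; first by move=> i; exact: (eP i).1.
- move=> v [vP tv]; exists (fun i => coef (st i) v).
  apply/eqP; rewrite -subr_eq0; apply/eqP.
  apply: (vproj_a2free_inj sq_neq0 qint_neq0).
    have [_ tS] := tspace_lsubspace P.
    have : tspace P (\sum_i coef (st i) v *: e i).
      by apply: lsub_sum; [exact: tspace_lsubspace|move=> i; exact: (eP i).1].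
    by move=> [_ t2] m; rewrite (linB (@ftdec_linear _ _ _ _)) tv t2 subrr.
  rewrite (linB pF) pi_sum; apply/eqP; rewrite subr_eq0; apply/eqP;
    apply: coef_ext => s.
  rewrite coef_vproj; case: asboolP => [s2|s2].
    have [[sl sw]|nP] := pselect (P s); last first.
      rewrite vP // fcoef_sum big1 // => i _; rewrite fcoefZ coef_bas.
      case: eqP => [E|_]; last by rewrite mulr0.
      by case: nP; rewrite E; split=> //=; rewrite occset_wdeg // enum_valP.
    have [f fK fE] := occset_surj s2 sw.
    have -> : s = st (enum_rank_in fK f).
      by rewrite /st enum_rankK_in // fE -sl; case: (s).
    by rewrite coef_comb.
  rewrite fcoef_sum big1 // => i _; rewrite fcoefZ coef_bas.
  case: eqP => [E|_]; last by rewrite mulr0.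
  by case: s2; rewrite E => m /=; rewrite occset_a2 // enum_valP.
- move=> x x0 i; have := congr1 (coef (st i)) (congr1 (vproj (@a2free C)) x0).
  by rewrite pi_sum coef_comb (lin0 pF) fcoef0.
Qed.

End WeightSpaces.

(** * The complex of the F^(l), its weight spaces and supercharacters *)

Section Supercharacters.
Variables (C : numFieldType) (B : fmodule C) (q sq : C).
Hypothesis sqE : sq ^+ 2 = q.
Hypothesis sq_neq0 : sq != 0.
Hypothesis qint_neq0 : forall m, qint q m.+1 != 0.
Hypothesis fosc_comm : forall i j m n (v : B),
  fosc q i m (fosc q j n v) = fosc q j n (fosc q i m v) +
  (if [&& i == j, m + n == 0 & m != 0]
   then sgn4 C i * (qint q m ^+ 2 / m%:~R) else 0) *: v.
Variables (al : int) (be : C).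
Implicit Types (u v : B) (S : set B) (l n a b i j : int).

Definition flamij l (ij : int * int) : {ffun 'I_4 -> C} :=
  flam4 (be + ij.1%:~R) (be - ij.1%:~R + ij.2%:~R)
        (be - al%:~R + ij.2%:~R) (- al%:~R + ij.2%:~R + l%:~R).

Definition fFl l : set B :=
  smallest (@lsubspace C B)
    (\bigcup_(ij in [set: int * int])
       fFock q sq (flam4 (be + ij.1%:~R)
                  (be - ij.1%:~R + ij.2%:~R)
                  (be - al%:~R + ij.2%:~R)
                  (- al%:~R + ij.2%:~R + l%:~R))).

Definition feta : B -> B := vop q 1 (- 0 - 1).
Definition fxi : B -> B := vop q (-1) (- 0).

Definition fweight S n a b : set B :=
  [set v | [/\ S v, (-2) *: fd_op q sq v = n%:~R *: v,
               fh1 q sq 0 v = a%:~R *: v & fh2 q sq 0 v = b%:~R *: v]].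

Lemma smallest_lsubspace (G : set B) : lsubspace (smallest (@lsubspace C B) G).
Proof.
split=> [|c u v Su Sv] S [sS GS]; first exact: sS.1.
by apply: sS.2; [exact: Su|exact: Sv].
Qed.

Definition charge_state l (s : fstate C) : Prop := exists ij, s.1 = flamij l ij.

(** A vector is a finite sum of its components of fixed zero modes. Each of them is again in the
    common kernel, hence in a single Fock space by [fFockE]. *)
Lemma fFlE l : fFl l = tspace q (charge_state l).
Proof.
apply/seteqP; split.
  apply: smallest_sub; first exact: tspace_lsubspace.
  move=> v [ij _]; rewrite (fFockE sqE sq_neq0 qint_neq0 fosc_comm) => -[vl tv].
  by split=> //; apply: (vsupp_sub _ vl) => s sE; exists ij.
move=> v [vl tv]; have [r ->] := vproj_decomp (fun s : fstate C => s.1) v.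
have [S0 SD] := smallest_lsubspace (\bigcup_(ij in [set: int * int]) fFock q sq
  (flamij l ij) : set B).
apply: big_ind => [//|u w Su Sw|lam _].
  by rewrite -[u]scale1r; exact: SD.
have [[ij lamE]|nlam] := pselect (exists ij, lam = flamij l ij).
  move=> S [_ GS]; apply: GS; exists ij => //.
  rewrite -[flam4 _ _ _ _]/(flamij l ij) -lamE (fFockE sqE sq_neq0 qint_neq0
    fosc_comm); split; first exact: vproj_supp.
  exact: tnull_vproj_fst.
rewrite (_ : vproj _ v = 0) //; apply: coef_ext => s; rewrite coef_vproj fcoef0.
case: asboolP => // sl; apply: vl => -[ij sij]; apply: nlam; exists ij.
by rewrite -sl.
Qed.

Lemma flamijE l ij :
  [/\ flamij l ij ia1 - flamij l ij ia2 = (2 * ij.1 - ij.2)%:~R,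
      flamij l ij ia2 - flamij l ij ib = (al - ij.1)%:~R,
      flamij l ij ic = (- al + ij.2 + l)%:~R &
      flamij l ij ib = be - al%:~R + ij.2%:~R].
Proof.
rewrite /flamij !ffunE /ia1 /ia2 /ib /ic !inordK //=.
by split=> //; rewrite ?(intrD, intrM, intrN) ?mulrNz; ring.
Qed.

Lemma flamij_succ l (e : int) ij :
  flamij l ij + flam4 0 0 0 e%:~R = flamij (l + e) ij.
Proof.
apply/ffunP => -[[|[|[|[|//]]]] i4]; rewrite !ffunE /= ?addr0 //.
by rewrite intrD addrA.
Qed.

(** The eigenvalue of - 2 d on the ket with zero modes [flamij] l (i, j), arranged so as to isolate
    the dependence on l. *)
Definition energy l i j : int :=
  - (al * (al + 1)) + (l * (l + 1) - 2 * l * (al - j)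
     + (2 * i ^+ 2 - 2 * i * j + j ^+ 2 + j)).

(** The pair (i, j) is the unique solution of 2 i - j = a and al - i = b, the eigenvalues of h^1_0
    and h^2_0. *)
Definition weight_state l n a b (s : fstate C) : Prop :=
  s.1 = flamij l (al - b, 2 * (al - b) - a) /\
  energy l (al - b) (2 * (al - b) - a) + 2 * (wdeg tweight s.2)%:Z = n.

Lemma coef_d l ij k v : tnull q v ->
  coef (flamij l ij, k) ((-2) *: fd_op q sq v) =
  (energy l ij.1 ij.2 + 2 * (wdeg tweight k)%:Z)%:~R * coef (flamij l ij, k) v.
Proof.
move=> tv; rewrite fcoefZ (coef_fd_op sqE sq_neq0 qint_neq0) // mulrA.
congr (_ * _); have [-> -> -> _] := flamijE l ij.
rewrite /energy -[(wdeg tweight k)%:R]/((wdeg tweight k)%:Z%:~R : C).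
move: (wdeg tweight k)%:Z => w.
rewrite !(intrD, intrM, mulrNz, rmorphXn) /=;
  move: (al%:~R : C) (ij.1%:~R : C) (ij.2%:~R : C) (l%:~R : C) (w%:~R : C) =>
  A I J L W.
by field.
Qed.

Lemma fweightE l n a b : fweight (fFl l) n a b =
  tspace q (weight_state l n a b).
Proof.
rewrite fFlE; apply/seteqP; split=> [v [[vl tv] vd v1 v2]|v [vw tv]].
  split=> // -[lam k] ns; apply/eqP; apply: contra_notT ns => v0.
  have [ij /= lamE] : charge_state l (lam, k).
    by apply: contrapT => nc; move: v0; rewrite vl // eqxx.
  have [e1 e2 _ _] := flamijE l ij.
  have scal c (x : C) : x * coef (lam, k) v = c%:~R * coef (lam,
    k) v -> x = c%:~R.
    by apply: mulIf.
  have i2 : al - ij.1 = b.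
    have := congr1 (coef (lam, k)) v2; rewrite coef_fh2_0 fcoefZ => /scal.
    by rewrite lamE e2 => /intr_inj.
  have j1 : 2 * ij.1 - ij.2 = a.
    have := congr1 (coef (lam, k)) v1; rewrite coef_fh1_0 fcoefZ => /scal.
    by rewrite lamE e1 => /intr_inj.
  have iE : ij.1 = al - b by rewrite -i2; ring.
  have jE : ij.2 = 2 * (al - b) - a by rewrite -iE -j1; ring.
  have ijE : ij = (al - b, 2 * (al - b) - a) by rewrite -jE -iE; case: (ij).
  split; first by rewrite /= lamE ijE.
  have := congr1 (coef (lam, k)) vd;
    rewrite [RHS]fcoefZ lamE coef_d // -lamE => /scal/intr_inj.
  by rewrite ijE.
split.
- by split=> //; apply: (vsupp_sub _ vw) => s [sl _]; eexists; exact: sl.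
- apply: coef_ext => -[lam k];
  have [[/= -> <-]|ns] := pselect (weight_state l n a b (lam, k)).
    by rewrite coef_d // fcoefZ.
  rewrite [RHS]fcoefZ (vw _ ns) mulr0 fcoefZ (coef_fd_op sqE sq_neq0 qint_neq0)
    //.
  by rewrite (vw _ ns) !mulr0.
- apply: coef_ext => -[lam k]; rewrite coef_fh1_0 fcoefZ.
  have [[/= -> _]|ns] := pselect (weight_state l n a b (lam, k));
    last by rewrite (vw _ ns) !mulr0.
  by have [-> _ _ _] := flamijE l (al - b, 2 * (al - b) - a);
    congr (_%:~R * _); rewrite /=; ring.
- apply: coef_ext => -[lam k]; rewrite coef_fh2_0 fcoefZ.
  have [[/= -> _]|ns] := pselect (weight_state l n a b (lam, k));
    last by rewrite (vw _ ns) !mulr0.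
  by have [_ -> _ _] := flamijE l (al - b, 2 * (al - b) - a);
    congr (_%:~R * _); rewrite /=; ring.
Qed.

Lemma vop_state (e e' l : int) ij k : e * e = 1 ->
  vsupp (hdeg (flamij (l + e) ij) tweight
    ((wdeg tweight k)%:Z + (e' - e * (- al + ij.2 + l))))
  (vop q e e' (bas (flamij l ij, k) : B)).
Proof.
move=> ee; rewrite -flamij_succ; apply: vop_hdeg => //;
  first by have [_ _ -> _] := flamijE l ij.
by apply: vsupp_bas.
Qed.

Lemma feta_charge l v : tspace q (charge_state l) v ->
  tspace q (charge_state (l + 1)) (feta v).
Proof.
move=> [vl tv]; split; last exact: tnull_vop.
apply: (lin_vsupp _ _ vl); first exact: vop_linear.
move=> [lam k] [ij /= ->]; apply: (vsupp_sub _ (@vop_state 1 _ l ij k erefl)).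
by move=> s [sl _]; exists ij.
Qed.

Lemma fxi_charge l v : tspace q (charge_state l) v ->
  tspace q (charge_state (l - 1)) (fxi v).
Proof.
move=> [vl tv]; split; last exact: tnull_vop.
apply: (lin_vsupp _ _ vl); first exact: vop_linear.
move=> [lam k] [ij /= ->]; apply: (vsupp_sub _ (@vop_state (-1) _ l ij k
  erefl)).
by move=> s [sl _]; exists ij.
Qed.

(** On charge c_0 the c-degree drops by c_0 + 1 while the energy grows by 2 (c_0 + 1). This balance
    expresses that eta_0 commutes with d. *)
Lemma feta_weight l n a b v :
  tspace q (weight_state l n a b) v ->
    tspace q (weight_state (l + 1) n a b) (feta v).
Proof.
move=> [vl tv]; split; last exact: tnull_vop.
apply: (lin_vsupp _ _ vl); first exact: vop_linear.
move=> [lam k] [/= -> nE]; apply: (vsupp_sub _ (@vop_state 1 _ l _ k erefl)).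
by move=> s [sl sw]; split=> //; rewrite sw -nE /energy /=; ring.
Qed.

Lemma fxi_weight l n a b v :
  tspace q (weight_state l n a b) v ->
    tspace q (weight_state (l - 1) n a b) (fxi v).
Proof.
move=> [vl tv]; split; last exact: tnull_vop.
apply: (lin_vsupp _ _ vl); first exact: vop_linear.
move=> [lam k] [/= -> nE]; apply: (vsupp_sub _ (@vop_state (-1) _ l _ k erefl)).
by move=> s [sl sw]; split=> //; rewrite sw -nE /energy /=; ring.
Qed.

Lemma feta_linear : linear feta. Proof. exact: vop_linear. Qed.
Lemma fxi_linear : linear fxi. Proof. exact: vop_linear. Qed.

Lemma charge_int l (s : fstate C) : charge_state l s -> int_charge s.
Proof.
move=> [ij sE]; have [_ _ icE _] := flamijE l ij.
by exists (- al + ij.2 + l); rewrite sE.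
Qed.

Lemma feta_fxi l v : tspace q (charge_state l) v ->
  feta (fxi v) + fxi (feta v) = v.
Proof.
move=> [vl _]; have vi : vsupp (@int_charge C) v.
  by apply: (vsupp_sub _ vl) => s; exact: charge_int.
apply/eqP; rewrite -subr_eq0; apply/eqP.
exact: (@anticomm_eq0 C B q qint_neq0 fosc_comm 1 (-1) (- 0 - 1) (- 0) v erefl
  erefl vi).
Qed.

Lemma double_eq0 v : v + v = 0 -> v = 0.
Proof.
move=> v2; have : (2%:R : C) *: v = 0 by rewrite scaler_nat mulr2n.
by move/eqP; rewrite scaler_eq0 pnatr_eq0 /= => /eqP.
Qed.

Lemma feta_feta l v : tspace q (charge_state l) v -> feta (feta v) = 0.
Proof.
move=> [vl _]; have vi : vsupp (@int_charge C) v.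
  by apply: (vsupp_sub _ vl) => s; exact: charge_int.
apply: double_eq0; rewrite -[LHS]subr0.
exact: (@anticomm_eq0 C B q qint_neq0 fosc_comm 1 1 (- 0 - 1) (- 0 - 1) v erefl
  erefl vi).
Qed.

Lemma weight_charge l n a b v :
  tspace q (weight_state l n a b) v -> tspace q (charge_state l) v.
Proof.
by move=> [vl tv]; split=> //; apply: (vsupp_sub _ vl) => s [sl _]; eexists;
  exact: sl.
Qed.

Lemma proj_ker_idem l v : tspace q (charge_state l) v ->
  feta (fxi (feta (fxi v))) = feta (fxi v).
Proof.
move=> cv; have cx := fxi_charge cv; have cex := feta_charge cx.
rewrite subrK in cex.
have := feta_fxi cex; rewrite (feta_feta cx) (lin0 fxi_linear) addr0.
by [].
Qed.

Lemma proj_coker_idem l v : tspace q (charge_state l) v ->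
  fxi (feta (fxi (feta v))) = fxi (feta v).
Proof.
move=> cv; have : fxi (feta v) = v - feta (fxi v).
  by rewrite -{2}(feta_fxi cv) addrC addKr.
move=> {1}->; rewrite (linB feta_linear) (linB fxi_linear).
by rewrite (feta_feta (fxi_charge cv)) (lin0 fxi_linear) subr0.
Qed.

Definition wdim l n a b : nat :=
  if (n - energy l (al - b) (2 * (al - b) - a))%R is Posz K then npart3 K else
    0%N.

Lemma has_dim_weight l n a b : has_dim (tspace q (weight_state l n a b) : set
  B) (wdim l n a b).
Proof.
rewrite /wdim; case E: (n - _) => [K|K].
  have := @has_dim_tspace C B q sq sqE sq_neq0 qint_neq0 fosc_comm
    (flamij l (al - b, 2 * (al - b) - a)) K.
  rewrite (_ : (fun s => _ /\ _) = weight_state l n a b) //.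
  apply/funext => s; apply/propext; rewrite /weight_state.
  split=> -[-> sw]; split=> //; last by lia.
  by rewrite -[RHS](subrK (energy l (al - b) (2 * (al - b) - a))) E -sw addrC.
apply: has_dim0 => v [vw _]; apply: vsupp_false vw => s [_ sw].
by move: E; rewrite -sw addrC addKr.
Qed.

(** Inside a weight, 1 - eta_0 xi_0 = xi_0 eta_0. Moreover eta_0 maps the image of xi_0 eta_0 in
    F^(l) bijectively onto the image of eta_0 xi_0 in F^(l+1), with inverse xi_0, so one function
    [kd] counts both images. *)
Lemma complex_dims n a b : exists kd : int -> nat, forall l,
  [/\ has_dim ((fun v => feta (fxi v)) @` (tspace q (weight_state l n a b)))
    (kd l),
      has_dim ((fun v => fxi (feta v)) @` (tspace q (weight_state l n a b)))
        (kd (l + 1)) &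
      wdim l n a b = (kd l + kd (l + 1)%R)%N].
Proof.
pose W l : set B := tspace q (weight_state l n a b).
have lex : linear (fun v => feta (fxi v)) := linear_comp feta_linear fxi_linear.
have lxe : linear (fun v => fxi (feta v)) := linear_comp fxi_linear feta_linear.
have Wex l v : W l v -> W l (feta (fxi v)).
  by move=> /fxi_weight/feta_weight; rewrite subrK.
have Wxe l v : W l v -> W l (fxi (feta v)).
  by move=> /feta_weight/fxi_weight; rewrite addrK.
have spl l := has_dim_split (@tspace_lsubspace C B q (weight_state l n a b)) lex
  (@Wex l) (fun v Wv => proj_ker_idem (weight_charge Wv)) (has_dim_weight l n a
    b).
have [kd kdP] := choice spl; exists kd => l.
have [kl1 kl2 kl3] := kdP l.
have E : (fun v => v - feta (fxi v)) @` W l = (fun v => fxi (feta v)) @` W l.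
  have e v : W l v -> v - feta (fxi v) = fxi (feta v).
    by move=> /weight_charge/feta_fxi vE; rewrite -{1}vE addrC addKr.
  by apply/seteqP; split=> _ [v Wv <-]; exists v; rewrite ?e.
rewrite E in kl3.
have kl4 : has_dim ((fun v => feta (fxi v)) @` W (l + 1)) (wdim l n a b - kd l).
  rewrite (_ : _ @` _ = feta @` ((fun v => fxi (feta v)) @` W l)).
    apply: (has_dim_image feta_linear) kl3.
      by apply: lsubspace_image lxe _; exact: tspace_lsubspace.
    move=> _ [u Wu <-] /(congr1 fxi);
      rewrite (proj_coker_idem (weight_charge Wu)).
    by rewrite (lin0 fxi_linear).
  apply/seteqP; split=> [_ [w Ww <-]|_ [_ [u Wu <-] <-]]; last first.
    by exists (feta u) => //; exact: feta_weight.
  exists (fxi (feta (fxi w))); last exact: proj_ker_idem (weight_charge Ww).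
  by exists (fxi w) => //; have := fxi_weight Ww; rewrite addrK.
have kE : (wdim l n a b - kd l)%N = kd (l + 1).
  by apply: has_dim_unique kl4 _; have [] := kdP (l + 1).
by rewrite -kE; split=> //; rewrite subnKC.
Qed.

Lemma wdim_eq0 n a b : exists N : nat, forall L : nat, (N <= L)%N ->
  wdim L n a b = 0%N /\ wdim (- L%:Z) n a b = 0%N.
Proof.
pose i := al - b; pose j := 2 * i - a; pose D := 1 - 2 * (al - j).
pose c := - (al * (al + 1)) + (2 * i ^+ 2 - 2 * i * j + j ^+ 2 + j).
have eE l : energy l i j = c + (l * l + D * l) by rewrite /energy /c /D; ring.
(* For |l| = L above this bound, l^2 + D l >= |l| (|l| - |D|) >= |l| > n - c. *)
exists (absz (n - c)%R + absz D + 1)%N => L NL.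
have pos l : absz l = L -> n - energy l i j < 0.
  move=> lL; rewrite eE; move: NL lL; clearbody D c; clear eE => NL lL.
  have : (absz l)%:Z <= l * l + D * l.
    case: l lL => l lL; nia.
  by lia.
have w0 l : absz l = L -> wdim l n a b = 0%N.
  by move=> /pos; rewrite /wdim -/i -/j; case: (n - _).
by split; apply: w0; rewrite ?abszN.
Qed.

(** Iteration of kd (l + 1) = w l - kd l towards negative l. The remainder is kept and disappears
    once w vanishes. *)
Lemma ker_dim_sum (kd w : int -> nat) (L : nat) :
  (forall l, w l = (kd l + kd (l + 1)%R)%N) ->
  (kd 0)%:R = \sum_(l < L) (-1) ^+ l * (w (- l.+1%:Z))%:R + (-1) ^+ L * (kd (-
    L%:Z))%:R :> C.
Proof.
move=> wE; elim: L => [|L IH]; first by rewrite big_ord0 add0r mul1r oppr0.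
rewrite big_ord_recr /= -addrA [LHS]IH; congr (_ + _).
rewrite wE (_ : - L.+1%:Z + 1 = - L%:Z); last by lia.
by rewrite natrD exprS; ring.
Qed.

Lemma coker_dim_sum (kd w : int -> nat) (L : nat) :
  (forall l, w l = (kd l + kd (l + 1)%R)%N) ->
  (kd 1)%:R = \sum_(l < L) (-1) ^+ l * (w l.+1%:Z)%:R + (-1) ^+ L * (kd
    L.+1%:Z)%:R :> C.
Proof.
move=> wE; elim: L => [|L IH]; first by rewrite big_ord0 add0r mul1r.
rewrite big_ord_recr /= -addrA [LHS]IH; congr (_ + _).
rewrite wE (_ : L.+1%:Z + 1 = L.+2%:Z); last by lia.
by rewrite natrD exprS; ring.
Qed.

Variable chi : C -> C.

Definition ffermi : B -> B := lext (fun s => chi (s.1 ib) *: bas s).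

Definition fSch S n a b : C :=
  xget 0 [set t | ltrace (fweight S n a b) ffermi t].

Definition fhas_Sch S : Prop :=
  S `<=` smallest (@lsubspace C B)
           (\bigcup_(w in [set: int * int * int]) fweight S w.1.1 w.1.2 w.2) /\
  forall n a b, exists t, ltrace (fweight S n a b) ffermi t.

(** The weights a and b fix j, and with it the coefficient of Q_b, independently of l and n. *)
Definition chi_weight a b : C := chi (be - al%:~R + (2 * (al - b) - a)%:~R).

Lemma ffermi_weight l n a b v : tspace q (weight_state l n a b) v ->
  ffermi v = chi_weight a b *: v.
Proof.
move=> [vw _].
apply: (@lin_vsupp_eq _ _ _ _ ffermi (fun v => chi_weight a b *: v)) vw.
- exact: lext_linear.
- by apply: linear_scale; exact: linear_id.
move=> s [sl _]; rewrite /ffermi lext_bas sl.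
by have [_ _ _ ->] := flamijE l (al - b, 2 * (al - b) - a).
Qed.

Lemma fSch_dim S l n a b N : has_dim (fweight S n a b) N ->
  (forall v, fweight S n a b v -> tspace q (weight_state l n a b) v) ->
  (exists t, ltrace (fweight S n a b) ffermi t) /\
  fSch S n a b = chi_weight a b * N%:R.
Proof.
move=> SN Sw; have tE t := ltrace_scalar t SN (fun v Sv =>
  ffermi_weight (Sw v Sv)).
split; first by exists (chi_weight a b * N%:R); apply/tE.
rewrite /fSch; case: xgetP => [t _ /tE //|H].
by case: (H (chi_weight a b * N%:R)); apply/tE.
Qed.

(** By idempotence a weight vector in the image of p is its own image under p, and it lies in F^(l)
    since p preserves that space. *)
Lemma fweight_image l (p : B -> B) n a b :
  (forall v, tspace q (charge_state l) v -> tspace q (charge_state l) (p v)) ->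
  (forall v, tspace q (weight_state l n a b) v ->
    tspace q (weight_state l n a b) (p v)) ->
  (forall v, tspace q (charge_state l) v -> p (p v) = p v) ->
  fweight (p @` fFl l) n a b = p @` tspace q (weight_state l n a b).
Proof.
move=> pc pw pp; apply/seteqP; split=> [_ [[u Fu <-] e1 e2 e3]|_ [u Wu <-]].
  rewrite fFlE in Fu; exists (p u); last exact: pp.
  by rewrite -fweightE; split=> //; rewrite fFlE; exact: pc.
have := pw u Wu; rewrite -fweightE => -[_ e1 e2 e3]; split=> //.
by exists u => //; rewrite fFlE; exact: weight_charge Wu.
Qed.

Lemma charge_decomp l v : tspace q (charge_state l) v ->
  smallest (@lsubspace C B) (\bigcup_(w in [set: int * int * int])
    tspace q (weight_state l w.1.1 w.1.2 w.2)) v.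
Proof.
move=> [vl tv]; have [r ->] :=
  vproj_decomp (fun s : fstate C => (s.1, wdeg tweight s.2)) v.
have [S0 SD] := smallest_lsubspace (\bigcup_(w in [set: int * int * int])
    tspace q (weight_state l w.1.1 w.1.2 w.2) : set B).
apply: big_ind => [//|u w Su Sw|[lam m] _].
  by rewrite -[u]scale1r; exact: SD.
rewrite (_ : (fun s => _) = hdeg lam tweight m%:Z); last first.
  apply/funext => s; apply/propext; rewrite /hdeg; split; first by case=> -> ->.
  by case=> -> [->].
have [[ij lamE]|nlam] := pselect (exists ij, lam = flamij l ij); last first.
  rewrite (_ : vproj _ v = 0) //; apply: coef_ext => s;
    rewrite coef_vproj fcoef0.
  case: asboolP => // -[sl _]; apply: vl => -[ij sij]; apply: nlam; exists ij.
  by rewrite -sl.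
move=> S [_ GS]; apply: GS.
exists (energy l ij.1 ij.2 + 2 * m%:Z, 2 * ij.1 - ij.2, al - ij.1) => //=.
split; last exact: tnull_vproj_hdeg.
apply: (vsupp_sub _ (@vproj_supp _ _ _ _)) => s [sl sw].
have i1 : al - (al - ij.1) = ij.1 by ring.
have j1 : 2 * ij.1 - (2 * ij.1 - ij.2) = ij.2 by ring.
by split; rewrite i1 j1 ?sw // sl lamE; case: (ij).
Qed.

(** Applied with p the identity, eta_0 xi_0 and xi_0 eta_0, which treats F^(l), kernel and cokernel
    alike. *)
Lemma fhas_Sch_image l (p : B -> B) (N : int -> int -> int -> nat) : linear p ->
  (forall v, tspace q (charge_state l) v -> tspace q (charge_state l) (p v)) ->
  (forall n a b v, tspace q (weight_state l n a b) v ->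
    tspace q (weight_state l n a b) (p v)) ->
  (forall v, tspace q (charge_state l) v -> p (p v) = p v) ->
  (forall n a b, has_dim (p @` tspace q (weight_state l n a b)) (N n a b)) ->
  fhas_Sch (p @` fFl l) /\
  forall n a b, fSch (p @` fFl l) n a b = chi_weight a b * (N n a b)%:R.
Proof.
move=> lp pc pw pp dimN.
have wE n a b := fweight_image pc (@pw n a b) pp.
have dimE n a b : has_dim (fweight (p @` fFl l) n a b) (N n a b) by rewrite wE.
have sub n a b v : fweight (p @` fFl l) n a b v ->
  tspace q (weight_state l n a b) v.
  by rewrite wE => -[u Wu <-]; exact: pw.
have res n a b := fSch_dim (dimE n a b) (@sub n a b).
split; last by move=> n a b; exact: (res n a b).2.
split; last by move=> n a b; exact: (res n a b).1.
move=> _ [u Fu <-]; rewrite fFlE in Fu.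
set G := \bigcup_(w in _) _; have [S0 SD] := smallest_lsubspace G.
pose S' : set B := [set w | smallest (@lsubspace C B) G (p w)].
rewrite -[smallest _ _ _]/(S' u); apply: (charge_decomp Fu); split.
  split; first by rewrite /S' /= (lin0 lp).
  by move=> c x y Sx Sy; rewrite /S' /= lp; exact: SD.
move=> w [[[n a] b] _ Ww] S [_ GS]; apply: GS; exists (n, a, b) => //=.
by rewrite wE; exists w.
Qed.

Lemma fSch_Fl l : fhas_Sch (fFl l) /\
  forall n a b, fSch (fFl l) n a b = chi_weight a b * (wdim l n a b)%:R.
Proof.
rewrite -(image_id (fFl l)).
apply: (@fhas_Sch_image l id (wdim l)) => // n a b.
by rewrite image_id; exact: has_dim_weight.
Qed.

Definition fKer S : set B := (fun v => feta (fxi v)) @` S.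
Definition fCoker S : set B := (fun v => fxi (feta v)) @` S.

(** The threshold N serves twice: beyond it the terms vanish, and truncation there already gives the
    exact value. *)
Lemma fSch_KerCoker :
  [/\ fhas_Sch (fKer (fFl 0)), fhas_Sch (fCoker (fFl 0)) &
   forall n a b, exists N : nat, forall L : nat, (N <= L)%N ->
    [/\ fSch (fFl (- L%:Z)) n a b = 0, fSch (fFl L%:Z) n a b = 0,
        fSch (fKer (fFl 0)) n a b =
          \sum_(l < L) (-1) ^+ l * fSch (fFl (- l.+1%:Z)) n a b &
        fSch (fCoker (fFl 0)) n a b =
          \sum_(l < L) (-1) ^+ l * fSch (fFl l.+1%:Z) n a b]].
Proof.
have ex (w : int * int * int) := complex_dims w.1.1 w.1.2 w.2.
have [kd kdP] := choice ex.
have kdE n a b l := kdP (n, a, b) l.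
have [kS kE] : fhas_Sch (fKer (fFl 0)) /\ forall n a b,
    fSch (fKer (fFl 0)) n a b = chi_weight a b * (kd (n, a, b) 0)%:R.
  apply: (@fhas_Sch_image 0 _ (fun n a b => kd (n, a, b) 0)).
  - exact: linear_comp feta_linear fxi_linear.
  - by move=> v /fxi_charge/feta_charge; rewrite subrK.
  - by move=> n a b v /fxi_weight/feta_weight; rewrite subrK.
  - exact: proj_ker_idem.
  - by move=> n a b; have [] := kdE n a b 0.
have [cS cE] : fhas_Sch (fCoker (fFl 0)) /\ forall n a b,
    fSch (fCoker (fFl 0)) n a b = chi_weight a b * (kd (n, a, b) 1)%:R.
  apply: (@fhas_Sch_image 0 _ (fun n a b => kd (n, a, b) 1)).
  - exact: linear_comp fxi_linear feta_linear.
  - by move=> v /feta_charge/fxi_charge; rewrite addrK.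
  - by move=> n a b v /feta_weight/fxi_weight; rewrite addrK.
  - exact: proj_coker_idem.
  - by move=> n a b; have [_] := kdE n a b 0; rewrite add0r.
split=> // n a b; have [N HN] := wdim_eq0 n a b; exists N => L NL.
have [w1 w2] := HN L NL; have [w3 _] := HN L.+1 (leqW NL).
have dimE l : wdim l n a b = (kd (n, a, b) l + kd (n, a, b) (l + 1)%R)%N.
  by have [] := kdE n a b l.
(* A vanishing dimension is a sum of two natural numbers, so both are zero and the remainders drop
   out. *)
have k1 : kd (n, a, b) (- L%:Z) = 0%N by have := dimE (- L%:Z); rewrite w2; lia.
have k2 : kd (n, a, b) L.+1%:Z = 0%N by have := dimE L.+1%:Z; rewrite w3; lia.
have FlE l := (fSch_Fl l).2 n a b.
rewrite !FlE w1 w2 !mulr0 kE cE (ker_dim_sum L dimE) (coker_dim_sum L dimE) k1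
  k2.
rewrite !mulr0 !addr0 !mulr_sumr; split=> //; apply: eq_bigr => l _.
  by rewrite FlE mulrCA.
by rewrite FlE mulrCA.
Qed.

End Supercharacters.

(** * The generating function of three-coloured partitions *)

Section GeneratingFunction.
Variable C : comNzRingType.
Implicit Types p r : {poly C}.

Definition eqmodX n p r : Prop := exists u, p = r + 'X^n * u.

Lemma eqmodX_coef n p r k : eqmodX n p r -> (k < n)%N -> p`_k = r`_k.
Proof. by move=> [u ->] kn; rewrite coefD coefXnM kn addr0. Qed.

Lemma eqmodX_mul1 n p r : eqmodX n p 1 -> eqmodX n r 1 -> eqmodX n (p * r) 1.
Proof. by move=> [u ->] [v ->]; exists (u + v + 'X^n * u * v); ring. Qed.

Lemma eqmodX_prod1 n (I : Type) (s : seq I) (F : I -> {poly C}) :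
  (forall i, eqmodX n (F i) 1) -> eqmodX n (\prod_(i <- s) F i) 1.
Proof.
move=> F1; apply: (big_ind (fun p => eqmodX n p 1)) => // [|p r].
  by exists 0; rewrite mulr0 addr0.
exact: eqmodX_mul1.
Qed.

(* Both sides invert P modulo 'X^n. *)
Lemma eqmodX_inv n p r P : eqmodX n (p * P) 1 -> eqmodX n (r * P) 1 ->
  eqmodX n p r.
Proof.
move=> [u pE] [v rE]; exists (r * u - p * v).
have : p * (r * P) = r * (p * P) by ring.
rewrite pE rE => E; apply/eqP; rewrite -subr_eq0; apply/eqP.
transitivity (p * (1 + 'X^n * v) - r * (1 + 'X^n * u)); first by ring.
by rewrite E subrr.
Qed.

(** Expanding the product gives one monomial for each bounded occupation function; the factors of
    colour a^2 admit only the value 0. *)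
Lemma coef_occset K :
  (\prod_(x : 'I_4 * 'I_K) \sum_(r < K.+1)
      if x.1 == ia2 then (r == ord0)%:R else 'X^(2 * x.2.+1 * r) : {poly C})`_K
        =
  (npart3 K)%:R.
Proof.
rewrite bigA_distr_bigA /= coef_sum /npart3 -sum1_card natr_sum.
rewrite [RHS]big_mkcond; apply: eq_bigr => f _.
rewrite inE; case: forallP => [f0|nf0] /=.
  rewrite (eq_bigr (fun x : 'I_4 * 'I_K => 'X^(2 * x.2.+1 * f x))).
    by rewrite prodrXr coefXn eq_sym; case: eqP.
  move=> [i m] _ /=; case: eqP => // ->.
  by rewrite (eqP (f0 m)) eqxx muln0.
have [m fm] : exists m, f (ia2, m) != ord0.
  by apply: contrapT => H; apply: nf0 => m; apply: contrapT => Hm; apply: H;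
    exists m; apply/negP.
by rewrite (bigD1 (ia2, m)) //= eqxx (negPf fm) mul0r coef0.
Qed.

Lemma eqmodX_exp1 n p k : eqmodX n p 1 -> eqmodX n (p ^+ k) 1.
Proof.
move=> p1; elim: k => [|k IH]; first by exists 0; rewrite mulr0 addr0.
by rewrite exprS; exact: eqmodX_mul1.
Qed.

Lemma prod_I4 (f : 'I_4 -> {poly C}) :
  \prod_(i < 4) f i = f ia1 * f ia2 * f ib * f ic.
Proof.
rewrite !big_ord_recl big_ord0 mulr1 !mulrA.
by congr (f _ * f _ * f _ * f _); apply: val_inj; rewrite /= inordK.
Qed.

(** Both polynomials invert P modulo X^(K+1): the sum of powers because X divides 1 - P, the product
    of truncated geometric series because each mode carries three of them. *)
Lemma inv_prod3E K :
  let P : {poly C} := \prod_(1 <= n < K.+1) (1 - 'X^(2 * n)) ^+ 3 in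
  (\sum_(r < K.+1) (1 - P) ^+ r)`_K = (npart3 K)%:R.
Proof.
move=> P; have PE : P = \prod_(m < K) (1 - 'X^(2 * m.+1)) ^+ 3.
  by rewrite /P big_add1 big_mkord.
rewrite -coef_occset; apply: (@eqmodX_coef K.+1) => //.
apply: (@eqmodX_inv _ _ _ P).
  have [u uE] : exists u, 1 - P = 'X * u.
    have : eqmodX 1 P 1.
      rewrite PE; apply: eqmodX_prod1 => m; apply: eqmodX_exp1.
      by exists (- 'X^((2 * m).+1)); rewrite mulrN -exprD mulnS.
    by move=> [u ->]; exists (- u); rewrite opprD addNKr mulrN expr1.
  exists (- u ^+ K.+1); rewrite mulrN -exprMn -uE.
  have := subrX1 (1 - P) K.+1; rewrite (_ : 1 - P - 1 = - P); last by ring.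
  rewrite mulNr mulrC => E; rewrite -[LHS]opprK -E; ring.
rewrite PE -(pair_bigA _ (fun (i : 'I_4) (m : 'I_K) => \sum_(r < K.+1)
   if i == ia2 then (r == ord0)%:R else 'X^(2 * m.+1 * r))) /=.
rewrite exchange_big -big_split /=; apply: eqmodX_prod1 => m.
have ne : ((ia1 == ia2) = false) * ((ib == ia2) = false) * ((ic == ia2) =
  false).
  by do !split; apply/negbTE/eqP => /(congr1 val); rewrite /= !inordK.
rewrite prod_I4 !ne eqxx.
have -> : \sum_(r < K.+1) (r == ord0)%:R = 1 :> {poly C}.
  by rewrite big_ord_recl eqxx big1 ?addr0.
set S := \sum_(r < K.+1) _.
(* The geometric sum telescopes to 1 - X^(2 (m+1) (K+1)), and X^(K+1) divides the last term. *)
have SE : eqmodX K.+1 (S * (1 - 'X^(2 * m.+1))) 1.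
  exists (- 'X^((2 * m.+1).-1 * K.+1)); rewrite mulrN -exprD -mulSn.
  have -> : (2 * m.+1).-1.+1 = (2 * m.+1)%N by rewrite prednK.
  have := subrX1 ('X^(2 * m.+1) : {poly C}) K.+1; rewrite -exprM.
  rewrite (eq_bigr (fun r : 'I_K.+1 => 'X^(2 * m.+1 * r))) => [|r _];
    last by rewrite -exprM.
  rewrite -/S => /(canRL (subrK _)) ->; move: ('X^(2 * m.+1)) => x; ring.
have -> : S * 1 * S * S * (1 - 'X^(2 * m.+1)) ^+ 3 =
    (S * (1 - 'X^(2 * m.+1))) ^+ 3 by ring.
exact: eqmodX_exp1.
Qed.

End GeneratingFunction.

(** A zero of [m+1] would force q^(2 (m+1)) = 1. *)
Lemma qint_neq0 (C : numFieldType) (q : C) : q != 0 ->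
  (forall n : nat, (0 < n)%N -> q ^+ n != 1) -> forall m, qint q m.+1 != 0.
Proof.
move=> q0 qn m; have x0 k : q ^+ k.+1 - (q ^+ k.+1)^-1 != 0.
  have qk : q ^+ k.+1 != 0 by rewrite expf_neq0.
  rewrite subr_eq0; apply/eqP => E; have /eqP[] := qn (k.+1 * 2)%N isT.
  by rewrite exprM expr2 {1}E mulVf.
rewrite /qint -exprnN -exprnP mulf_neq0 ?invr_neq0 //; last by have := x0 0%N;
  rewrite expr1.
Qed.

(** * Alternating series with growing exponents *)

Definition pdeg (z : int) : nat := if z is Posz K then npart3 K else 0%N.

Section SignedSeries.
Variables (C : numFieldType) (e : nat -> int) (D : int).
Hypothesis e_ge : forall l : nat, l.+1%:Z <= e l.+1 + D.

(** The coefficient of q^n in the sum over l >= 1 of (-1)^(l+1) q^(e l); by [e_ge] only l <= n + D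
    contribute. *)
Definition gcoef (n : int) : C :=
  \sum_(l \in posnat) ((-1) ^+ l.+1 * (n == e l)%:R : C).

Let sign2 l : (-1) ^+ l.+2 = (-1) ^+ l :> C.
Proof. by rewrite !exprS !mulN1r opprK. Qed.

Lemma gcoef_sum n (L : nat) : n + D < L%:Z ->
  gcoef n = \sum_(l < L) (-1) ^+ l * (n == e l.+1)%:R.
Proof.
move=> nL; rewrite /gcoef (@posnat_sum _ _ L) => [|m Lm].
  by apply: eq_bigr => l _; rewrite sign2.
by case: eqP => [E|]; [have := e_ge m; lia|rewrite mulr0].
Qed.

Lemma gcoef_eq0 n : n + D <= 0 -> gcoef n = 0.
Proof.
move=> nD; rewrite (@gcoef_sum n 1); last by lia.
rewrite big_ord1 /=; case: eqP => [E|_]; last by rewrite mulr0.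
by have := e_ge 0%N; rewrite -E; lia.
Qed.

Lemma pdeg_eq0 n (l : nat) : n + D < l.+1%:Z -> pdeg (n - e l.+1) = 0%N.
Proof. by move=> nl; have := e_ge l; rewrite /pdeg; case E: (n - _) => [K|//];
  lia. Qed.

(** After truncation of both sums and exchange, each l leaves the single index k = n - e l, if that
    is nonnegative. *)
Lemma gcoef_conv (c : C) (n : int) :
  \sum_(k \in [set: nat]) (npart3 k)%:R * (c * gcoef (n - k%:Z)) =
  c * \sum_(l \in posnat) ((-1) ^+ l.+1 * (pdeg (n - e l))%:R : C).
Proof.
pose M := (absz (n + D)).+1.
rewrite (@posnat_sum _ _ M) => [|m Mm]; last by rewrite pdeg_eq0 ?mulr0 //; lia.
rewrite (fsbigE (iota 0 M)) ?iota_uniq //; last first.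
  by move=> k _; rewrite mem_iota /= add0n -leqNgt => Mk;
    rewrite gcoef_eq0 ?mulr0 //; lia.
rewrite big_mkcond (eq_bigr (fun k => (npart3 k)%:R * (c * gcoef (n - k%:Z))));
  last first.
  by move=> k _; rewrite ifT // in_setE.
rewrite (_ : iota 0 M = index_iota 0 M); last by rewrite /index_iota subn0.
rewrite big_mkord mulr_sumr.
rewrite (eq_bigr (fun k : 'I_M => \sum_(l < M)
   c * ((-1) ^+ l * ((npart3 k)%:R * (n - k%:Z == e l.+1)%:R)))); last first.
  move=> k _; rewrite (@gcoef_sum _ M); last by lia.
  by rewrite !mulr_sumr; apply: eq_bigr => l _; ring.
rewrite exchange_big; apply: eq_bigr => l _ /=.
rewrite -!mulr_sumr sign2; congr (_ * (_ * _)).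
have el := e_ge l; rewrite /pdeg; case E: (n - e l.+1) => [K|K].
  have KM : (K < M)%N by lia.
  rewrite (bigD1 (Ordinal KM)) //= big1 ?addr0 => [|k kK].
    by rewrite (_ : n - K%:Z == e l.+1) ?mulr1 //; lia.
  rewrite (_ : (n - k%:Z == e l.+1) = false) ?mulr0 //.
  apply/negbTE; apply: contra kK => /eqP E2; apply/eqP; apply: val_inj => /=;
    lia.
rewrite big1 // => k _; rewrite (_ : (n - k%:Z == e l.+1) = false) ?mulr0 //.
by apply/negbTE/eqP; lia.
Qed.

End SignedSeries.

(** * Transfer from abstract free modules to the boson space *)

Section Bridge.
Variable R : realType.

Lemma basis_expand (v : boson R) : exists S : seq (state R),
  v = \sum_(s <- S) (mcoeff s v) *: basis_vec s.
Proof. by exists (msupp v); rewrite {1}[v]boson_basis linext.unlock. Qed.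

Lemma mcoeff_basis (s t : state R) : mcoeff s (basis_vec t) = (s == t)%:R.
Proof. by rewrite basis_vec.unlock mcoeffU eq_sym. Qed.

Lemma mcoeff_linear (s : state R) (a : R[i]) (u v : boson R) :
  mcoeff s (a *: u + v) = a * mcoeff s u + mcoeff s v.
Proof. by rewrite mcoeffD mcoeffZ. Qed.

Definition bosonM : fmodule R[i] :=
  @FModule R[i] (boson R) (@basis_vec R) (@linext R)
    (fun s v => mcoeff s v) (@linext_is_linear R)
    (@linext_basis R) mcoeff_linear mcoeff_basis basis_expand.

Variables (q sq : R[i]).

Lemma foscE : osc q = @fosc _ bosonM q.
Proof. by []. Qed.

Lemma h1E : h1 q sq = @fh1 _ bosonM q sq.
Proof. by []. Qed.

Lemma h2E : h2 q sq = @fh2 _ bosonM q sq.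
Proof. by []. Qed.

Lemma FockE : Fock q sq = @fFock _ bosonM q sq.
Proof. by apply/funext => l; rewrite /Fock /fFock h1E h2E /c_ foscE. Qed.

Lemma FlE : Fl q sq = @fFl _ bosonM q sq.
Proof. by rewrite /Fl /fFl FockE. Qed.

Lemma weight_spaceE : weight_space q sq = @fweight _ bosonM q sq.
Proof. by []. Qed.

(** Most identifications hold by conversion; here the sum over tuples has to be turned into the
    recursion of [powcoef]. *)
Lemma expcoefE (t : nat -> boson R -> boson R) k v :
  (forall m, linear (t m)) -> expcoef t k v = expser t k v.
Proof. by move=> lt; apply: eq_bigr => r _; rewrite powcoef_tuples. Qed.

Lemma vertex_coefE s e v : vertex_coef q s e v = @vop _ bosonM q s e v.
Proof.
apply: eq_fsbigr => kj _.
rewrite /vterm -(expcoefE _ _ (@craise_linear R[i] bosonM q s)).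
by rewrite -(expcoefE _ _ (@clower_linear R[i] bosonM q s)).
Qed.

Definition fermi_sign (z : R[i]) : R[i] := cexp (- ipi R * (eps R ib * z)).

Lemma fermiE : @fermi R = @ffermi _ bosonM fermi_sign.
Proof. by []. Qed.

Lemma SchE S n a b : Sch q sq S n a b = @fSch _ bosonM q sq fermi_sign S n a b.
Proof.
by rewrite /Sch /fSch weight_spaceE fermiE; congr (xget 0 _).
Qed.

Lemma has_SchE S : has_Sch q sq S = @fhas_Sch _ bosonM q sq fermi_sign S.
Proof.
by rewrite /has_Sch /fhas_Sch weight_spaceE fermiE.
Qed.

Lemma eta0E v : eta_ q 0 v = @feta _ bosonM q v.
Proof. exact: vertex_coefE. Qed.

Lemma xi0E v : xi_ q 0 v = @fxi _ bosonM q v.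
Proof. exact: vertex_coefE. Qed.

Lemma KerE S : Ker q S = @fKer _ bosonM q S.
Proof.
apply: (congr1 (fun f => f @` S)); apply/funext => v.
by rewrite eta0E xi0E.
Qed.

Lemma CokerE S : Coker q S = @fCoker _ bosonM q S.
Proof.
apply: (congr1 (fun f => f @` S)); apply/funext => v.
by rewrite xi0E eta0E.
Qed.

Lemma fosc_commE i j m n (v : bosonM) :
  fosc q i m (fosc q j n v) = fosc q j n (fosc q i m v) +
  (if [&& i == j, m + n == 0 & m != 0]
   then sgn4 R[i] i * (qint q m ^+ 2 / m%:~R) else 0) *: v.
Proof. exact: osc_comm. Qed.

End Bridge.

(** * Complex powers of -1 *)

Section Signs.
Variable R : realType.
Implicit Types z w : R[i].

Lemma cexpD z w : cexp (z + w) = cexp z * cexp w.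
Proof.
case: z w => [x y] [x' y']; rewrite /cexp /= expRD cosD sinD.
by apply/eqP; rewrite eq_complex /=; apply/andP; split; apply/eqP; ring.
Qed.

Lemma cexp_ipi : cexp (ipi R) = -1.
Proof.
by apply/eqP; rewrite eq_complex /= expR0 cospi sinpi !mul1r oppr0 !eqxx.
Qed.

Lemma m1powD z (j : int) : m1pow (z + j%:~R) = m1pow z * (-1) ^ j.
Proof.
have step (y : R[i]) : m1pow (y + 1) = - m1pow y.
  by rewrite /m1pow mulrDr mulr1 cexpD cexp_ipi mulrN1.
elim/int_ind: j => [|n IH|n IH].
- by rewrite addr0 expr0z mulr1.
- by rewrite -addn1 PoszD intrD addrA step IH -PoszD addn1 -!exprnP exprS
  mulN1r mulrN.
- apply: oppr_inj; rewrite -step -addn1 PoszD opprD intrD -addrA -addrA addNr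
  addr0 IH.
  by rewrite -opprD -PoszD addn1 -!exprnN exprS invfM invrN1 mulN1r mulrN opprK.
Qed.

Lemma fermi_signE z : fermi_sign z = m1pow z.
Proof. by rewrite /fermi_sign /m1pow /eps eqxx mulN1r mulrNN. Qed.

End Signs.

(** * Summability and the closed formula, for kernel and cokernel at once *)

Section SeriesExpansion.
Variables (R : realType) (al : int) (m : R[i]).
Variable ex : int * int -> nat -> int.
Hypothesis ex_ge : forall ij, exists D, forall l, l.+1%:Z <= ex ij l.+1 + D.
Variable F : nat -> fseries R.

(** The only (i, j) whose term involves x^a y^b; hence the sum over (i, j) has at most one term in
    each coefficient. *)
Let pos_ij (a b : int) : int * int := (al - b, 2 * (al - b) - a).

Hypothesis FE : forall l n a b, F l n a b =
  m * (-1) ^ (pos_ij a b).2 *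
  (pdeg (n + al * (al + 1) - ex (pos_ij a b) l))%:R.

Let term (ij : int * int) (l : nat) : fseries R :=
  sscale ((-1) ^+ l.+1) (smono R (ex ij l) (2 * ij.1 - ij.2) (al - ij.1)).
Let tij (ij : int * int) : fseries R :=
  sscale ((-1) ^ ij.2) (fsum posnat (term ij)).
Let sch (l : nat) : fseries R := sscale ((-1) ^+ l.+1) (F l).

Let bounded_finite (P : set nat) N : (forall l,
  P l -> (l < N)%N) -> finite_set P.
Proof. by move=> PN; apply: sub_finite_set (finite_II N) => l /PN. Qed.

Lemma summable_sch : summable posnat sch.
Proof.
move=> n a b; have [D De] := ex_ge (pos_ij a b).
apply: (@bounded_finite _ (absz (n + al * (al + 1) + D)).+1) => -[[//]|l] [_].
rewrite /sch /sscale FE; apply: contraR; rewrite -leqNgt => lN.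
by rewrite (pdeg_eq0 De) ?mulr0 //; lia.
Qed.

Lemma summable_term ij : summable posnat (term ij).
Proof.
move=> n a b; have [D De] := ex_ge ij.
apply: (@bounded_finite _ (absz (n + D)).+1) => -[[//]|l] [_].
rewrite /term /sscale /smono; apply: contraR; rewrite -leqNgt => lN.
have := De l; case: (n =P ex ij l.+1) => [E|_ _]; last by rewrite mulr0.
by rewrite -E; lia.
Qed.

Lemma tijE ij n a b : tij ij n a b =
  if ij == pos_ij a b then (-1) ^ (pos_ij a b).2 * gcoef R[i] (ex (pos_ij a b))
    n else 0.
Proof.
have exp_eq i' j' : (a == 2 * i' - j') && (b == al - i') = ((i',
  j') == pos_ij a b).
  by rewrite /pos_ij xpair_eqE; lia.
have termE l : term ij l n a b =
    (-1) ^+ l.+1 * (if ij == pos_ij a b then n == ex ij l else false)%:R.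
  rewrite /term /sscale /smono exp_eq -surjective_pairing;
    congr (_ * (nat_of_bool _)%:R).
  by case: (ij == _); rewrite ?andbT ?andbF.
rewrite /tij /sscale /fsum.
have -> : \sum_(l \in posnat) term ij l n a b = \sum_(l \in posnat)
    ((-1) ^+ l.+1 * (if ij == pos_ij a b then n == ex ij l else false)%:R :
      R[i]).
  by apply: eq_fsbigr => l _; exact: termE.
have [->|_] := eqVneq ij (pos_ij a b); first by [].
by rewrite fsbig1 => [|l _]; exact: mulr0.
Qed.

Lemma summable_tij : summable [set: int * int] tij.
Proof.
move=> n a b; apply: (@sub_finite_set _ _ [set pos_ij a b]);
  last exact: finite_set1.
move=> ij [_]; rewrite tijE; case: (ij =P pos_ij a b) => [-> _|_]; first by [].
by rewrite eqxx.
Qed.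

Lemma fsum_tij n a b : fsum [set: int * int] tij n a b =
  (-1) ^ (pos_ij a b).2 * gcoef R[i] (ex (pos_ij a b)) n.
Proof.
rewrite /fsum (fsbigE [:: pos_ij a b]) //; last first.
  by move=> ij _; rewrite inE tijE => /negbTE->.
by rewrite big_cons big_nil ifT ?in_setE // tijE eqxx; exact: addr0.
Qed.

Lemma summable_inv : summable [set: nat] (inv_prod3_terms (fsum [set: int *
  int] tij)).
Proof.
move=> n a b; have [D De] := ex_ge (pos_ij a b).
apply: (@bounded_finite _ (absz (n + D)).+1) => k [_].
rewrite /inv_prod3_terms /sscale /qshift fsum_tij.
apply: contraR; rewrite -leqNgt => lN.
by rewrite (gcoef_eq0 _ De) ?mulr0 //; lia.
Qed.

(** In the coefficient of x^a y^b only [pos_ij] a b is left, and the claim becomes [gcoef_conv] at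
    the exponent n + al (al + 1). *)
Lemma fsum_sch : fsum posnat sch =
  sscale m (qshift (- (al * (al + 1))) (div_prod3 (fsum [set: int * int] tij))).
Proof.
apply/funext => n; apply/funext => a; apply/funext => b.
have [D De] := ex_ge (pos_ij a b).
rewrite /sscale /qshift /div_prod3 /fsum opprK -/(fsum _ _).
transitivity (m * \sum_(k \in [set: nat]) (npart3 k)%:R *
   ((-1) ^ (pos_ij a b).2 * gcoef R[i] (ex (pos_ij a b)) (n + al * (al + 1) -
     k%:Z))).
  rewrite (gcoef_conv De) mulrA mulr_fsumr; apply: eq_fsbigr => l _.
  by rewrite /sch /sscale FE mulrCA.
congr (_ * _); apply: eq_fsbigr => k _.
rewrite /inv_prod3_terms /sscale /qshift /inv_prod3 inv_prod3E; congr (_ * _).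
by rewrite -fsum_tij.
Qed.

End SeriesExpansion.

(** * Supercharacters in the boson space *)

Section Proposition.
Variables (R : realType) (q sq : R[i]) (alpha : int) (beta : R[i]).
Hypothesis sqE : sq ^+ 2 = q.
Hypothesis q_neq0 : q != 0.
Hypothesis q_nroot : forall n : nat, (0 < n)%N -> q ^+ n != 1.

Let sq_neq0 : sq != 0.
Proof. by apply: contraNneq q_neq0 => sq0; rewrite -sqE sq0 expr0n. Qed.

Let qint0 := qint_neq0 q_neq0 q_nroot.

Lemma has_Sch_Fl l : has_Sch q sq (Fl q sq alpha beta l).
Proof.
rewrite has_SchE FlE.
exact: (@fSch_Fl _ _ _ _ sqE sq_neq0 qint0 (@fosc_commE R q) alpha beta
  (@fermi_sign R) l).1.
Qed.

Lemma Sch_Fl l n a b : Sch q sq (Fl q sq alpha beta l) n a b =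
  m1pow (beta - alpha%:~R) * (-1) ^ (2 * (alpha - b) - a) *
  (pdeg (n - energy alpha l (alpha - b) (2 * (alpha - b) - a)))%:R.
Proof.
rewrite SchE FlE.
rewrite (@fSch_Fl _ _ _ _ sqE sq_neq0 qint0 (@fosc_commE R q) alpha beta
  (@fermi_sign R) l).2.
by rewrite /chi_weight fermi_signE m1powD.
Qed.

Lemma Sch_KerCoker :
  [/\ has_Sch q sq (Ker q (Fl q sq alpha beta 0)),
      has_Sch q sq (Coker q (Fl q sq alpha beta 0)) &
   forall n a b, exists N : nat, forall L : nat, (N <= L)%N ->
    [/\ Sch q sq (Fl q sq alpha beta (- L%:Z)) n a b = 0,
        Sch q sq (Fl q sq alpha beta L%:Z) n a b = 0,
        Sch q sq (Ker q (Fl q sq alpha beta 0)) n a b =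
          \sum_(l < L) (-1) ^+ l * Sch q sq (Fl q sq alpha beta (- l.+1%:Z)) n
            a b &
        Sch q sq (Coker q (Fl q sq alpha beta 0)) n a b =
          \sum_(l < L) (-1) ^+ l * Sch q sq (Fl q sq alpha beta l.+1%:Z) n a
            b]].
Proof.
have [h1 h2 h3] := @fSch_KerCoker _ _ _ _ sqE sq_neq0 qint0 (@fosc_commE R q)
  alpha beta (@fermi_sign R).
rewrite KerE CokerE FlE; split; first by rewrite has_SchE; exact: h1.
  by rewrite has_SchE; exact: h2.
move=> n a b; have [N HN] := h3 n a b; exists N => L NL.
have [e1 e2 e3 e4] := HN L NL; split.
- by rewrite SchE; exact: e1.
- by rewrite SchE; exact: e2.
- by rewrite SchE e3; apply: eq_bigr => l _; rewrite SchE.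
- by rewrite SchE e4; apply: eq_bigr => l _; rewrite SchE.
Qed.

Lemma fsum_posnat (F : nat -> fseries R) (L : nat) n a b :
  (forall l, (L <= l)%N -> F l.+1 n a b = 0) ->
  fsum posnat (fun l => sscale ((-1) ^+ l.+1) (F l)) n a b =
  \sum_(l < L) (-1) ^+ l * F l.+1 n a b.
Proof.
move=> F0; rewrite /fsum /sscale (@posnat_sum _ _ L) => [|l /F0->];
  last exact: mulr0.
by apply: eq_bigr => l _; rewrite !exprS !mulN1r opprK.
Qed.

End Proposition.

Theorem proposition4 (R : realType) (q sq : R[i]) (alpha : int) (beta : R[i]) :
  sq ^+ 2 = q -> q != 0 -> (forall n : nat, (0 < n)%N -> q ^+ n != 1) ->
  let KerF := Ker q (Fab q sq alpha beta) in
  let CokerF := Coker q (Fab q sq alpha beta) in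
  let ker_l (ij : int * int) (l : nat) : fseries R :=
    let: (i, j) := ij in
    sscale ((-1) ^+ l.+1)
      (smono R (l%:Z * (l%:Z - 1) + 2 * l%:Z * (alpha - j)
                + (2 * i ^+ 2 - 2 * i * j + j ^+ 2 + j))
               (2 * i - j) (alpha - i)) in
  let coker_l (ij : int * int) (l : nat) : fseries R :=
    let: (i, j) := ij in
    sscale ((-1) ^+ l.+1)
      (smono R (l%:Z * (l%:Z + 1) - 2 * l%:Z * (alpha - j)
                + (2 * i ^+ 2 - 2 * i * j + j ^+ 2 + j))
               (2 * i - j) (alpha - i)) in
  let ker_ij (ij : int * int) : fseries R :=
    sscale ((-1) ^ ij.2) (fsum posnat (ker_l ij)) in
  let coker_ij (ij : int * int) : fseries R :=
    sscale ((-1) ^ ij.2) (fsum posnat (coker_l ij)) in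
  let ker_sch (l : nat) : fseries R :=
    sscale ((-1) ^+ l.+1) (Sch q sq (Fl q sq alpha beta (- l%:Z))) in
  let coker_sch (l : nat) : fseries R :=
    sscale ((-1) ^+ l.+1) (Sch q sq (Fl q sq alpha beta l%:Z)) in
  [/\ has_Sch q sq KerF,
      has_Sch q sq CokerF &
      forall l : int, has_Sch q sq (Fl q sq alpha beta l)] /\
  [/\ summable posnat ker_sch,
      forall ij, summable posnat (ker_l ij),
      summable [set: int * int] ker_ij &
      summable [set: nat] (inv_prod3_terms (fsum [set: int * int] ker_ij))] /\
  [/\ summable posnat coker_sch,
      forall ij, summable posnat (coker_l ij),
      summable [set: int * int] coker_ij &
      summable [set: nat] (inv_prod3_terms (fsum [set: int * int] coker_ij))] /\
  [/\ Sch q sq KerF = Sch q sq (Ker q (Fl q sq alpha beta 0)),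
      Sch q sq (Ker q (Fl q sq alpha beta 0)) = fsum posnat ker_sch &
      fsum posnat ker_sch =
        sscale (m1pow (beta - alpha%:~R))
          (qshift (- (alpha * (alpha + 1)))
            (div_prod3 (fsum [set: int * int] ker_ij)))] /\
  [/\ Sch q sq CokerF = Sch q sq (Coker q (Fl q sq alpha beta 0)),
      Sch q sq (Coker q (Fl q sq alpha beta 0)) = fsum posnat coker_sch &
      fsum posnat coker_sch =
        sscale (m1pow (beta - alpha%:~R))
          (qshift (- (alpha * (alpha + 1)))
            (div_prod3 (fsum [set: int * int] coker_ij)))].
Proof.
move=> sqE q0 qn KerF CokerF ker_l coker_l ker_ij coker_ij ker_sch coker_sch.
have [hK hC hKC] := Sch_KerCoker alpha beta sqE q0 qn.
pose Q (ij : int * int) : int :=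
  2 * ij.1 ^+ 2 - 2 * ij.1 * ij.2 + ij.2 ^+ 2 + ij.2.
pose exk (ij : int * int) (l : nat) : int :=
  l%:Z * (l%:Z - 1) + 2 * l%:Z * (alpha - ij.2) + Q ij.
pose exc (ij : int * int) (l : nat) : int :=
  l%:Z * (l%:Z + 1) - 2 * l%:Z * (alpha - ij.2) + Q ij.
(* The difference is the positive definite form x^2 + (p - 1) x + (p - 1)^2. With p the linear
   coefficient of the exponent in l, it provides the lower bounds required for summability. *)
have quad (x p : int) : x <= x * x + p * x + (p - 1) ^+ 2 by nia.
have exk_ge ij : exists D, forall l, l.+1%:Z <= exk ij l.+1 + D.
  pose p := 2 * (alpha - ij.2) - 1; exists ((p - 1) ^+ 2 - Q ij) => l.
  apply: (le_trans (quad l.+1%:Z p)); rewrite le_eqVlt; apply/orP; left;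
    apply/eqP.
  by rewrite /exk /p; ring.
have exc_ge ij : exists D, forall l, l.+1%:Z <= exc ij l.+1 + D.
  pose p := 1 - 2 * (alpha - ij.2); exists ((p - 1) ^+ 2 - Q ij) => l.
  apply: (le_trans (quad l.+1%:Z p)); rewrite le_eqVlt; apply/orP; left;
    apply/eqP.
  by rewrite /exc /p; ring.
pose m := m1pow (beta - alpha%:~R).
(* Replacing l by - l turns l (l + 1) - 2 l (alpha - j) in [energy] into l (l - 1) + 2 l (alpha -
   j). *)
have FkE l n a b : Sch q sq (Fl q sq alpha beta (- l%:Z)) n a b =
    m * (-1) ^ (2 * (alpha - b) - a) *
    (pdeg (n + alpha * (alpha + 1) - exk (alpha - b,
      2 * (alpha - b) - a) l))%:R.
  rewrite (Sch_Fl alpha beta sqE q0 qn) -/m; congr (_ * (pdeg _)%:R).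
  by rewrite /energy /exk /Q /=; ring.
have FcE (l : nat) n a b : Sch q sq (Fl q sq alpha beta l%:Z) n a b =
    m * (-1) ^ (2 * (alpha - b) - a) *
    (pdeg (n + alpha * (alpha + 1) - exc (alpha - b,
      2 * (alpha - b) - a) l))%:R.
  rewrite (Sch_Fl alpha beta sqE q0 qn) -/m; congr (_ * (pdeg _)%:R).
  by rewrite /energy /exc /Q /=; ring.
have ker_lE : ker_l = fun ij l => sscale ((-1) ^+ l.+1)
    (smono R (exk ij l) (2 * ij.1 - ij.2) (alpha - ij.1)).
  by apply/funext => -[i j].
have coker_lE : coker_l = fun ij l => sscale ((-1) ^+ l.+1)
    (smono R (exc ij l) (2 * ij.1 - ij.2) (alpha - ij.1)).
  by apply/funext => -[i j].
have ker_sum n a b : Sch q sq KerF n a b = fsum posnat ker_sch n a b.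
  have [N HN] := hKC n a b; have [_ _ e _] := HN N (leqnn N).
  rewrite /KerF /Fab e; apply/esym.
  apply: (@fsum_posnat R (fun l => Sch q sq (Fl q sq alpha beta (- l%:Z))) N).
  by move=> l Nl; have [e1 _ _ _] := HN l.+1 (leqW Nl); exact: e1.
have coker_sum n a b : Sch q sq CokerF n a b = fsum posnat coker_sch n a b.
  have [N HN] := hKC n a b; have [_ _ _ e] := HN N (leqnn N).
  rewrite /CokerF /Fab e; apply/esym.
  apply: (@fsum_posnat R (fun l => Sch q sq (Fl q sq alpha beta l%:Z)) N).
  by move=> l Nl; have [_ e1 _ _] := HN l.+1 (leqW Nl); exact: e1.
pose Fk (l : nat) := Sch q sq (Fl q sq alpha beta (- l%:Z)).
pose Fc (l : nat) := Sch q sq (Fl q sq alpha beta l%:Z).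
split; first by split; [exact: hK|exact: hC|exact: (has_Sch_Fl alpha beta sqE
  q0 qn)].
rewrite /ker_ij /coker_ij ker_lE coker_lE.
split.
  split.
  - exact: (@summable_sch R alpha m exk exk_ge Fk FkE).
  - exact: (@summable_term R alpha exk exk_ge).
  - exact: (@summable_tij R alpha exk).
  - exact: (@summable_inv R alpha exk exk_ge).
split.
  split.
  - exact: (@summable_sch R alpha m exc exc_ge Fc FcE).
  - exact: (@summable_term R alpha exc exc_ge).
  - exact: (@summable_tij R alpha exc).
  - exact: (@summable_inv R alpha exc exc_ge).
split.
  split; first by [].
  - by apply/funext => n; apply/funext => a; apply/funext => b; exact: ker_sum.
  - exact: (@fsum_sch R alpha m exk exk_ge Fk FkE).
split; first by [].
- by apply/funext => n; apply/funext => a; apply/funext => b; exact: coker_sum.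
- exact: (@fsum_sch R alpha m exc exc_ge Fc FcE).
Qed.
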